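(* Let $\mathcal L$: $u_t=A(t,x)u_{xx}+B(t,x)u_x+C(t,x)u$ with analytic $A,B,C$, $A\ne0$. Suppose that the associated system ${\rm DE}_1(\mathcal L)$ possesses a Lie invariance operator $Q_1$ with vanishing coefficient of $\partial_t$ and nonvanishing coefficient of $\partial_x$. Let a solution $(g^1,g^2,g^3)$ of ${\rm DE}_1(\mathcal L)$ be invariant with respect to $Q_1$. Then the associated reduction operator $\partial_t+g^1\partial_x+(g^2u+g^3)\partial_u$ of $\mathcal L$ is necessarily equivalent to a Lie invariance operator of $\mathcal L$.
   Context: All considerations are local: functions are smooth (or analytic) on a suitable domain, which may be shrunk so that expressions not vanishing identically do not vanish. ${\rm DE}_1(\mathcal L)$ is the system for $g^i=g^i(t,x)$, $i=1,2,3$: $$g^1_t-Ag^1_{xx}-Bg^1_x+\Bigl(2g^1_x-\tfrac{A_x}{A}g^1-\tfrac{A_t}{A}\Bigr)(g^1+B)+B_xg^1+2Ag^2_x+B_t=0,$$ $$g^2_t-Ag^2_{xx}-Bg^2_x+\Bigl(2g^1_x-\tfrac{A_x}{A}g^1-\tfrac{A_t}{A}\Bigr)(g^2-C)-C_xg^1-C_t=0,$$ $$g^3_t-Ag^3_{xx}-Bg^3_x+\Bigl(2g^1_x-\tfrac{A_x}{A}g^1-\tfrac{A_t}{A}\Bigr)g^3-Cg^3=0.$$ It is the condition that $\partial_t+g^1\partial_x+(g^2u+g^3)\partial_u$ is a reduction operator (nonclassical symmetry) of $\mathcal L$. Two operators in the space of $(t,x,u)$ are equivalent if they differ by a nonvanishing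 multiplier $\lambda(t,x,u)$. A Lie invariance operator of a system is an infinitesimal generator of a one-parametric group of point symmetries of that system (for ${\rm DE}_1(\mathcal L)$, in the space of $(t,x,g^1,g^2,g^3)$). *)

(* Defs.v *)
From HB Require Import structures.
From mathcomp Require Import all_boot all_order all_algebra.
From mathcomp Require Import all_classical all_reals all_analysis.

Set Implicit Arguments.
Unset Strict Implicit.
Unset Printing Implicit Defensive.

Import Order.TTheory GRing.Theory Num.Theory.
Import numFieldNormedType.Exports.

Local Open Scope classical_set_scope.
Local Open Scope ring_scope.

Definition iterD (R : realType) (V W : normedModType R) (s : seq V)
    (f : V -> W) : V -> W :=
  foldr (fun v h => 'D_v h) f s.

(* C^infinity; only meaningful for open U, as is analytic_on below. *)
Definition smooth_on (R : realType) (V W : normedModType R) (U : set V)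
    (f : V -> W) : Prop :=
  forall (s : seq V) (p : V), U p -> differentiable (iterD s f) p.

Definition smooth_near (R : realType) (V W : normedModType R) (p : V)
    (f : V -> W) : Prop :=
  exists U : set V, [/\ open U, U p & smooth_on U f].

(* Real analytic on an open set U: smooth, and around every point p of U the
   Taylor expansion f (p + v) = \sum_n (1 / n!) (v . grad)^n f (p) is valid for
   all sufficiently small v. *)
Definition analytic_on (R : realType) (V W : normedModType R) (U : set V)
    (f : V -> W) : Prop :=
  smooth_on U f /\
  forall p : V, U p -> \forall v \near (0 : V),
    series (fun n : nat => (n`!%:R : R)^-1 *: iterD (nseq n v) f p) @ \oo
      --> f (p + v).

(* Independent variables (t, x). *)
Definition plane (R : realType) : normedModType R := (R^o * R^o)%type.

Definition scalars (R : realType) : normedModType R := R^o.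
Definition triples (R : realType) : normedModType R := (R^o * R^o * R^o)%type.

(* Space of the independent variables (t, x) and of dependent variables
   ranging in W: W = scalars R for (t, x, u), W = triples R for
   (t, x, g1, g2, g3). *)
Definition varspace (R : realType) (W : normedModType R) : normedModType R :=
  (plane R * W)%type.

Definition Dt (R : realType) (W : normedModType R) (f : plane R -> W) :
  plane R -> W := 'D_((1, 0) : plane R) f.
Definition Dx (R : realType) (W : normedModType R) (f : plane R -> W) :
  plane R -> W := 'D_((0, 1) : plane R) f.

(* A differential system is given by its pointwise satisfaction predicate:
   S g p means that g satisfies the equations of the system at the point p. *)
Definition diff_system (R : realType) (W : normedModType R) : Type :=
  (plane R -> W) -> plane R -> Prop.

Definition solution_on (R : realType) (W : normedModType R)
    (S : diff_system W) (U : set (plane R)) (g : plane R -> W) : Prop :=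
  smooth_on U g /\ forall p, U p -> S g p.

(* The prolongation to second-order jets of the point transformation phi
   (defined near (p, g p)) is defined on the jet of g at p and carries it to
   the jet of h at the image point.  Here q |-> phi (q, g q) parametrizes the
   image of the graph of g; its projection to the plane of independent
   variables is required to have a nondegenerate differential at p, and the
   graph of h is required to have contact of order 2 with it. *)
Definition prolongs (R : realType) (W : normedModType R)
    (phi : varspace W -> varspace W) (p : plane R) (g h : plane R -> W) : Prop :=
  let F := fun q : plane R => (phi (q, g q)).1 : plane R in
  let G := fun q : plane R => (phi (q, g q)).2 in
  (forall v : plane R, 'D_v F p = 0 -> v = 0) /\
  (forall s : seq (plane R), (size s <= 2)%N ->
     iterD s (h \o F) p = iterD s G p).

(* Point symmetry, with local domain D, of a system S of order at most 2: the
   prolongation of phi maps the submanifold of the jet space J^2 defined by S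
   into itself. Second-order jets are represented by germs of functions g, h. *)
Definition point_symmetry (R : realType) (W : normedModType R)
    (S : diff_system W) (D : set (varspace W)) (phi : varspace W -> varspace W) : Prop :=
  forall (p : plane R) (g h : plane R -> W),
    D (p, g p) ->
    smooth_near p g -> smooth_near (phi (p, g p)).1 h ->
    prolongs phi p g h ->
    S g p -> S h (phi (p, g p)).1.

(* One-parameter local group of transformations of the open set M, with
   parameter e and domain of definition D (as in Olver's book). *)
Record local_group (R : realType) (E : normedModType R) (M : set E)
    (D : set (R^o * E)) (Phi : R^o * E -> E) : Prop := LocalGroup {
  lg_open : open D;
  lg_dom : forall e z, D (e, z) -> M z;
  lg_zero : forall z, M z -> D (0, z);
  lg_cod : forall e z, D (e, z) -> M (Phi (e, z));
  lg_smooth : smooth_on D Phi;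
  lg_id : forall z, M z -> Phi (0, z) = z;
  lg_comp : forall d e z, D (e, z) -> D (d, Phi (e, z)) -> D (d + e, z) ->
    Phi (d, Phi (e, z)) = Phi (d + e, z);
  lg_inv : forall e z, D (e, z) ->
    D (- e, Phi (e, z)) /\ Phi (- e, Phi (e, z)) = z
}.

(* The vector field Q on M (identified with its tuple of coefficients) is a
   Lie invariance operator of S: the infinitesimal generator of a
   one-parameter local group of point symmetries of S. *)
Definition Lie_invariance_operator (R : realType) (W : normedModType R)
    (S : diff_system W) (M : set (varspace W)) (Q : varspace W -> varspace W) : Prop :=
  exists (D : set (R^o * varspace W)) (Phi : R^o * varspace W -> varspace W),
    [/\ local_group M D Phi,
        (forall z, M z ->
           is_derive (0 : R^o) (1 : R^o) (fun e : R^o => Phi (e, z)) (Q z)) &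
        (forall e : R^o, point_symmetry S [set z | D (e, z)]
                           (fun z => Phi (e, z)))].

Definition coef_t (R : realType) (W : normedModType R)
  (Q : varspace W -> varspace W) (z : varspace W) : R := (Q z).1.1.
Definition coef_x (R : realType) (W : normedModType R)
  (Q : varspace W -> varspace W) (z : varspace W) : R := (Q z).1.2.

(* The function g is invariant with respect to Q: Q is tangent to the graph of
   g over U, i.e. tau g_t + xi g_x = eta for all components, along the graph. *)
Definition invariant_on (R : realType) (W : normedModType R)
    (Q : varspace W -> varspace W) (U : set (plane R)) (g : plane R -> W) : Prop :=
  forall p, U p ->
    coef_t Q (p, g p) *: Dt g p + coef_x Q (p, g p) *: Dx g p = (Q (p, g p)).2.

Definition equivalent_on (R : realType) (W : normedModType R)
    (N : set (varspace W)) (Q Q' : varspace W -> varspace W) : Prop :=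
  exists lam : varspace W -> R^o,
    smooth_on N lam /\
    forall z, N z -> lam z != 0 /\ Q' z = (lam z : R) *: Q z.

Definition eqL (R : realType) (A B C : plane R -> R^o) : diff_system (scalars R) :=
  fun u p => Dt u p = A p * Dx (Dx u) p + B p * Dx u p + C p * u p.

(* The condition on (g1, g2, g3) for reduction_op g1 g2 g3 below to be a
   reduction operator of eqL A B C. *)
Definition DE1 (R : realType) (A B C : plane R -> R^o) :
    diff_system (triples R) :=
  fun g p =>
    let g1 := fun q => (g q).1.1 : R^o in
    let g2 := fun q => (g q).1.2 : R^o in
    let g3 := fun q => (g q).2 : R^o in
    let K := 2%:R * Dx g1 p - Dx A p / A p * g1 p - Dt A p / A p in
    [/\ Dt g1 p - A p * Dx (Dx g1) p - B p * Dx g1 p + K * (g1 p + B p)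
          + Dx B p * g1 p + 2%:R * A p * Dx g2 p + Dt B p = 0,
        Dt g2 p - A p * Dx (Dx g2) p - B p * Dx g2 p + K * (g2 p - C p)
          - Dx C p * g1 p - Dt C p = 0 &
        Dt g3 p - A p * Dx (Dx g3) p - B p * Dx g3 p + K * g3 p
          - C p * g3 p = 0].

(* \partial_t + g1 \partial_x + (g2 u + g3) \partial_u *)
Definition reduction_op (R : realType) (g1 g2 g3 : plane R -> R^o) :
    varspace (scalars R) -> varspace (scalars R) :=
  fun z => ((1, g1 z.1), g2 z.1 * z.2 + g3 z.1).

(* Main.v *)
Require Import Defs.
From HB Require Import structures.
From mathcomp Require Import all_boot all_order all_algebra.
From mathcomp Require Import all_classical all_reals all_analysis.
From mathcomp Require Import ring lra.
Set Implicit Arguments.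
Unset Strict Implicit.
Unset Printing Implicit Defensive.
Import Order.TTheory GRing.Theory Num.Theory.
Import numFieldNormedType.Exports.
Local Open Scope classical_set_scope.
Local Open Scope ring_scope.

(* Let xi be the coefficient of d_x in Q1. Applying the group of Q1 to germs of
   solutions of DE1 and differentiating in the group parameter gives equations
   that are polynomial in the free jet coordinates. Their coefficients yield
   that xi depends on (t, x) only, that xi A_x = 2 A xi_x, and that the
   coefficient of d_g1 in Q1 is xi_t + xi_x g1. Along an invariant solution
   this means xi g1_x = xi_t + xi_x g1, that is, xi d_x commutes with
   tau (d_t + g1 d_x), where tau = xi^2 / |A| depends on t only.
   Choose coordinates T, W straightening these two fields, and n, k with
   (d_t + g1 d_x) n = g2 and (d_t + g1 d_x) k = exp (- n) g3. In the coordinates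
   T, W, v = exp (- n) u - k the operator tau (d_t + g1 d_x + (g2 u + g3) d_u) is
   d_T, and DE1 says exactly that the equation u_t = A u_xx + B u_x + C u, written
   in these coordinates, does not involve T; so the flow of this operator, the
   translation of T, is a group of symmetries. *)

(** * Calculus of smooth maps *)

(** The conclusion asks for an actual local group of point symmetries, so a flow has to be produced,
    not only an infinitesimal criterion checked. As [tau] depends on [t] only and the two fields
    commute, [dT = dt / tau] and [dW = (dx - g1 dt) / xi] are closed forms: everything reduces to
    quadratures and to implicit functions with one unknown. The choice of [tau] is forced. With
    [tau A = sg xi^2], [sg] being the sign of [A], the second order part of the equation gets a
    constant coefficient in the coordinates T, W, and [tau_t / tau] becomes the factor K common to
    the three equations of [DE1]. Multiplication by [tau] thus turns commutation modulo K into exact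
    commutation. In the other direction, a point symmetry only constrains jets that satisfy [DE1] at
    one point. Testing it on polynomial germs leaves their values, their x-slopes and the second
    x-derivative of g1 free, while the equations fix the t-slopes. The group keeps [t], so the jet
    of the moved germ is found from a triangular chain rule. *)

Section Calculus.
Variable R : realType.
Implicit Types V W : normedModType R.

(** The epsilon form of differentiability with a guessed differential, which is checked directly for
    functions equal near a point, for the criterion by partial derivatives and for implicit
    functions. *)
Lemma differentiable_approx V W (f df : V -> W) (p : V) :
  linear df -> continuous df ->
  (forall e : R, 0 < e -> \forall h \near 0, `|f (h + p) - f p - df h| <= e * `|h|) ->
  differentiable f p /\ 'd f p = df :> (V -> W).
Proof.
move=> lin_df cdf H.
pose m := GRing.isLinear.Build _ _ _ _ _ lin_df.
pose L : {linear _ -> _} := HB.pack df m.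
have o : f \o shift p = cst (f p) + L +o_ 0 id.
  apply/eqaddoP => e e0; near=> h.
  have -> : (f \o shift p - (cst (f p) + L)) h = f (h + p) - f p - df h.
    by rewrite /= !fctE opprD addrA.
  by near: h; exact: H.
have D : 'd f p = L :> (V -> W) by apply: (@diff_unique _ _ _ f L p).
split; last exact: D.
apply/diff_locallyP; split; first by rewrite D.
have -> : ('d f p : V -> W) = L by exact: D.
exact: o.
Unshelve. all: by end_near. Qed.

Lemma near_eq_differentiable V W (f g : V -> W) (p : V) :
  (\near p, f p = g p) -> differentiable f p -> differentiable g p.
Proof.
move=> fg df.
have lf : linear ('d f p) by move=> a x y; rewrite linearP.
suff [] : differentiable g p /\ 'd g p = 'd f p :> (V -> W) by [].
apply: differentiable_approx => //; first exact: diff_continuous.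
move=> e e0.
have /diff_locally/eqaddoP/(_ e e0) H := df.
have fg0 : \forall h \near (0 : V), f (h + p) = g (h + p).
  by have := fg; rewrite (near_shift 0) /= subr0.
near=> h.
have <- : f (h + p) = g (h + p) by near: h.
rewrite -(nbhs_singleton fg).
have -> : f (h + p) - f p - 'd f p h = (f \o shift p - (cst (f p) + 'd f p)) h.
  by rewrite /= !fctE opprD addrA.
by near: h.
Unshelve. all: by end_near. Qed.

Lemma open_near V (U : set V) (p : V) (P : V -> Prop) : open U -> U p ->
  (forall q, U q -> P q) -> \near p, P p.
Proof. by move=> oU Up H; apply: filterS H _; exact: open_nbhs_nbhs. Qed.

Lemma derive_on V W (U : set V) (f g : V -> W) (v p : V) : open U -> U p ->
  (forall q, U q -> f q = g q) -> 'D_v f p = 'D_v g p.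
Proof. by move=> oU Up fg; apply: near_eq_derive; exact: open_near fg. Qed.

Lemma differentiable_on V W (U : set V) (f g : V -> W) (p : V) : open U -> U p ->
  (forall q, U q -> f q = g q) -> differentiable f p -> differentiable g p.
Proof. by move=> oU Up fg; apply: near_eq_differentiable; exact: open_near fg. Qed.

Lemma derive_dirD V W (f : V -> W) (p u v : V) : differentiable f p ->
  'D_(u + v) f p = 'D_u f p + 'D_v f p.
Proof. by move=> df; rewrite !deriveE// linearD. Qed.

Lemma derive_dirZ V W (f : V -> W) (p v : V) (a : R) : differentiable f p ->
  'D_(a *: v) f p = a *: 'D_v f p.
Proof. by move=> df; rewrite !deriveE// linearZ. Qed.

Lemma derive_comp V1 V2 W (g : V2 -> W) (f : V1 -> V2) (p v : V1) :
  differentiable f p -> differentiable g (f p) ->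
  'D_v (fun q => g (f q)) p = 'D_('D_v f p) g (f p).
Proof.
move=> df dg.
have dgf : differentiable (g \o f) p by exact: differentiable_comp.
rewrite [LHS](deriveE v dgf) [RHS]deriveE// [X in 'd g _ X]deriveE//.
by rewrite diff_comp.
Qed.

(* Off by one: [Ck n] means [n + 1] times differentiable. *)
Fixpoint Ck V W (n : nat) (U : set V) (f : V -> W) : Prop :=
  (forall p, U p -> differentiable f p) /\
  (if n is m.+1 then forall v, Ck m U ('D_v f) else True).

Lemma iterD_rcons V W (s : seq V) v (f : V -> W) :
  Defs.iterD (rcons s v) f = Defs.iterD s ('D_v f).
Proof. by rewrite /Defs.iterD -cats1 foldr_cat. Qed.

Lemma smooth_Ck V W (U : set V) (f : V -> W) :
  smooth_on U f <-> forall n, Ck n U f.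
Proof.
split=> [sf n|cf s p Up].
  elim: n f sf => [|n IH] f sf; split=> //; try exact: (sf [::]).
  by move=> v; apply: IH => s p Up; rewrite -iterD_rcons; exact: sf.
have : Ck (size s) U f by [].
elim/last_ind: s f {cf} => [f [df _]|s v IH f]; first exact: df.
by rewrite size_rcons iterD_rcons => -[_ /(_ v)]; exact: IH.
Qed.

Lemma Ck_diff V W n (U : set V) (f : V -> W) p : Ck n U f -> U p ->
  differentiable f p.
Proof. by case: n => [|n] [df _]; exact: df. Qed.

Lemma CkW V W n (U : set V) (f : V -> W) : Ck n.+1 U f -> Ck n U f.
Proof. by elim: n f => [|n IH] f [df cf]; split=> // v; apply: IH; exact: cf. Qed.

Lemma Ck_derive V W n (U : set V) (f : V -> W) v : Ck n.+1 U f -> Ck n U ('D_v f).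
Proof. by move=> [_ /(_ v)]. Qed.

Lemma Ck_on V W n (U : set V) (f g : V -> W) : open U ->
  (forall q, U q -> f q = g q) -> Ck n U f -> Ck n U g.
Proof.
move=> oU; elim: n f g => [|n IH] f g fg [df cf]; split=> //.
- by move=> p Up; exact: (differentiable_on oU Up fg (df _ Up)).
- by move=> p Up; exact: (differentiable_on oU Up fg (df _ Up)).
- move=> v; apply: (IH ('D_v f) ('D_v g)); last exact: cf.
  by move=> q Uq; exact: (derive_on v oU Uq fg).
Qed.

Lemma Ck_sub V W n (U U' : set V) (f : V -> W) : U' `<=` U -> Ck n U f -> Ck n U' f.
Proof.
move=> UU; elim: n f => [|n IH] f [df cf]; split=> //; try by move=> p /UU; exact: df.
by move=> v; apply: IH; exact: cf.
Qed.

Lemma Ck_cst V W n (U : set V) (c : W) : Ck n U (cst c).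
Proof.
elim: n c => [|n IH] c; split=> //; try by move=> p _; exact: differentiable_cst.
by move=> v; rewrite (_ : 'D_v _ = cst 0) //; apply/funext => q; rewrite derive_cst.
Qed.

Lemma CkD V W n (U : set V) (f g : V -> W) : open U ->
  Ck n U f -> Ck n U g -> Ck n U (fun q => f q + g q).
Proof.
move=> oU; elim: n f g => [|n IH] f g [df cf] [dg cg]; split=> //.
- by move=> p Up; apply: differentiableD; [exact: df|exact: dg].
- by move=> p Up; apply: differentiableD; [exact: df|exact: dg].
- move=> v; apply: (@Ck_on _ _ _ _ (fun q => 'D_v f q + 'D_v g q)) => //; last by apply: IH; [exact: cf|exact: cg].
  move=> q Uq; rewrite [RHS](@deriveD _ _ _ f g)//; apply: diff_derivable; [exact: df|exact: dg].
Qed.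

Lemma linear_diff V W (l : V -> W) (p : V) : linear l -> continuous l ->
  differentiable l p /\ forall v, 'D_v l p = l v.
Proof.
move=> ll cl.
pose m := GRing.isLinear.Build _ _ _ _ _ ll.
pose L : {linear _ -> _} := HB.pack l m.
have dl : differentiable (L : _ -> _) p by exact: linear_differentiable.
by split=> // v; rewrite [LHS](deriveE v dl) diff_lin.
Qed.

Lemma Ck_linear V W W' n (U : set V) (f : V -> W) (l : W -> W') : open U ->
  linear l -> continuous l -> Ck n U f -> Ck n U (fun q => l (f q)).
Proof.
move=> oU ll cl.
have dl x : differentiable l x by have [] := linear_diff x ll cl.
have Dl x v : 'D_v l x = l v by have [] := linear_diff x ll cl.
elim: n f => [|n IH] f [df cf]; split=> //;
  try by move=> p Up; apply: (@differentiable_comp _ _ _ _ f l) => //; exact: df.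
move=> v; apply: (@Ck_on _ _ _ _ (fun q => l ('D_v f q))) => //; last by apply: IH; exact: cf.
by move=> q Uq; rewrite (derive_comp v (df _ Uq) (dl _)) Dl.
Qed.

(** Scaling is packed as a continuous bilinear map, so the Leibniz rule is the differential of a
    bilinear map composed with a pair. *)
Fact scale_diff V W (k : V -> R^o) (f : V -> W) p :
  differentiable k p -> differentiable f p ->
  differentiable (fun q => k q *: f q) p /\
  forall v, 'D_v (fun q => k q *: f q) p = k p *: 'D_v f p + 'D_v k p *: f p.
Proof.
move=> dk df.
have bl : bilinear_for (GRing.Scale.Law.clone _ _ *:%R _)
    (GRing.Scale.Law.clone _ _ *:%R _) (fun (a : R^o) (w : W) => a *: w).
  by split=> [u a x y|u a x y] /=; [rewrite scalerDl scalerA|rewrite scalerDr !scalerA mulrC].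
pose m := bilinear_isBilinear.Build R R^o W W _ _ _ bl.
pose B : {bilinear R^o -> W -> W} := HB.pack (fun (a : R^o) (w : W) => a *: w) m.
have cB : continuous (fun y : R^o * W => B y.1 y.2) by move=> x; exact: scale_continuous.
have dB z : differentiable (fun y : R^o * W => B y.1 y.2) z by exact: differentiable_bilin.
have dp : differentiable (fun q => (k q, f q)) p by exact: differentiable_pair.
split=> [|v].
  by apply: (@differentiable_comp _ _ _ _ (fun q => (k q, f q)) (fun y : R^o * W => B y.1 y.2)).
rewrite (@derive_comp _ _ _ (fun y : R^o * W => B y.1 y.2) (fun q => (k q, f q)))//.
by rewrite deriveE// diff_bilin//= deriveE// diff_pair//= !deriveE.
Qed.

Lemma differentiable_scale V W (k : V -> R^o) (f : V -> W) p :
  differentiable k p -> differentiable f p ->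
  differentiable (fun q => k q *: f q) p.
Proof. by move=> dk df; have [] := scale_diff dk df. Qed.

Lemma derive_scale V W (k : V -> R^o) (f : V -> W) p v :
  differentiable k p -> differentiable f p ->
  'D_v (fun q => k q *: f q) p = k p *: 'D_v f p + 'D_v k p *: f p.
Proof. by move=> dk df; have [] := scale_diff dk df. Qed.

Lemma CkZ V W n (U : set V) (k : V -> R^o) (f : V -> W) : open U ->
  Ck n U k -> Ck n U f -> Ck n U (fun q => k q *: f q).
Proof.
move=> oU; elim: n k f => [|n IH] k f ck cf; split=> //;
  try by move=> p Up; apply: differentiable_scale; apply: Ck_diff Up; eassumption.
move=> v; apply: (@Ck_on _ _ _ _ (fun q => k q *: 'D_v f q + 'D_v k q *: f q)) => //.
  by move=> q Uq; rewrite derive_scale//; apply: Ck_diff Uq; eassumption.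
by apply: CkD => //; apply: IH; [exact: CkW|exact: Ck_derive|exact: Ck_derive|exact: CkW].
Qed.

Lemma derive_pair V W1 W2 (f : V -> W1) (g : V -> W2) p v :
  differentiable f p -> differentiable g p ->
  'D_v (fun q => (f q, g q)) p = ('D_v f p, 'D_v g p).
Proof.
move=> df dg; rewrite [LHS]deriveE ?diff_pair//; last exact: differentiable_pair.
by rewrite !deriveE.
Qed.

Lemma Ck_pair V W1 W2 n (U : set V) (f : V -> W1) (g : V -> W2) : open U ->
  Ck n U f -> Ck n U g -> Ck n U (fun q => (f q, g q)).
Proof.
move=> oU; elim: n f g => [|n IH] f g cf cg; split=> //;
  try by move=> p Up; apply: differentiable_pair; apply: Ck_diff Up; eassumption.
move=> v; apply: (@Ck_on _ _ _ _ (fun q => ('D_v f q, 'D_v g q))) => //.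
  by move=> q Uq; rewrite derive_pair//; apply: Ck_diff Uq; eassumption.
by apply: IH; [exact: Ck_derive|exact: Ck_derive].
Qed.

(* Iterating the chain rule requires expanding ['D_v f] on a basis. *)
Definition fin_basis V (s : seq (V * (V -> R^o))) : Prop :=
  (forall i, (i < size s)%N -> linear (nth (0, cst 0) s i).2 /\ continuous (nth (0, cst 0) s i).2) /\
  forall v, v = \sum_(x <- s) x.2 v *: x.1.

Definition findim V := exists s : seq (V * (V -> R^o)), fin_basis s.

Lemma findim_scalar : findim R^o.
Proof.
exists [:: (1, id)]; split=> [[|i]//= _|v]; last by rewrite big_seq1 /= [_ *: _]mulr1.
by split=> // x; exact: cvg_id.
Qed.

Lemma findim_prod V1 V2 : findim V1 -> findim V2 -> findim (V1 * V2)%type.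
Proof.
move=> [s1 [l1 e1]] [s2 [l2 e2]].
exists ([seq ((x.1, 0), fun v => x.2 v.1) | x <- s1] ++
        [seq ((0, x.1), fun v => x.2 v.2) | x <- s2]); split=> [i|v].
  rewrite size_cat !size_map nth_cat size_map => lt0; have [lt|le] := ltnP i (size s1).
    rewrite (nth_map (0, cst 0))//=; have [ll cl] := l1 _ lt; split=> [a x y|x]/=.
      exact: ll.
    by apply: continuous_comp; [exact: cvg_fst|exact: cl].
  have lt2 : (i - size s1 < size s2)%N by rewrite ltn_subLR.
  rewrite (nth_map (0, cst 0))//=; have [ll cl] := l2 _ lt2; split=> [a x y|x]/=.
    exact: ll.
  by apply: continuous_comp; [exact: cvg_snd|exact: cl].
rewrite big_cat/= !big_map/=; case: v => v1 v2 /=.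
rewrite [in LHS](e1 v1) [in LHS](e2 v2).
have -> : \sum_(x <- s1) x.2 v1 *: ((x.1, 0) : V1 * V2) = (\sum_(x <- s1) x.2 v1 *: x.1, 0).
  elim: {e1 l1} s1 => [|x s IH]; rewrite ?big_nil// !big_cons IH.
  by apply/pair_equal_spec; split => /=; rewrite ?scaler0 ?addr0.
have -> : \sum_(x <- s2) x.2 v2 *: ((0, x.1) : V1 * V2) = (0, \sum_(x <- s2) x.2 v2 *: x.1).
  elim: {e2 l2} s2 => [|x s IH]; rewrite ?big_nil// !big_cons IH.
  by apply/pair_equal_spec; split => /=; rewrite ?scaler0 ?addr0.
by apply/pair_equal_spec; split => /=; rewrite ?addr0 ?add0r.
Qed.

Lemma Ck_sum V W n (U : set V) (I : Type) (s : seq I) (F : I -> V -> W) : open U ->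
  (forall x0 i, (i < size s)%N -> Ck n U (F (nth x0 s i))) ->
  Ck n U (fun q => \sum_(x <- s) F x q).
Proof.
move=> oU; elim: s => [|x s IH] H.
  rewrite (_ : (fun _ => _) = cst 0); first exact: Ck_cst.
  by apply/funext => q; rewrite big_nil.
rewrite (_ : (fun _ => _) = (fun q => F x q + \sum_(y <- s) F y q)); last first.
  by apply/funext => q; rewrite big_cons.
apply: CkD => //; first exact: (H x 0%N).
by apply: IH => x0 i lt; apply: (H x0 i.+1).
Qed.

(** Expanded on the basis, a derivative of the composite is a sum of coordinates of ['D_v f] times
    fixed partial derivatives of [g] taken at [f q]. The induction on [n] therefore generalizes over
    [g]. *)
Lemma Ck_comp V1 V2 W n (U1 : set V1) (U2 : set V2) (g : V2 -> W) (f : V1 -> V2) :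
  findim V2 -> open U1 -> (forall p, U1 p -> U2 (f p)) ->
  Ck n U2 g -> Ck n U1 f -> Ck n U1 (fun q => g (f q)).
Proof.
move=> [s [ls es]] oU1 Uf; elim: n g => [|n IH] g cg cf; split=> //;
  try by move=> p Up; apply: (@differentiable_comp _ _ _ _ f g);
    [apply: Ck_diff Up|apply: Ck_diff (Uf _ Up)]; eassumption.
move=> v; apply: (@Ck_on _ _ _ _ (fun q => \sum_(x <- s) x.2 ('D_v f q) *: 'D_(x.1) g (f q))) => //.
  move=> q Uq; rewrite (derive_comp v (Ck_diff cf Uq) (Ck_diff cg (Uf _ Uq))).
  rewrite [in RHS](es ('D_v f q)).
  have dg := Ck_diff cg (Uf _ Uq).
  elim: (s) => [|x s' IHs]; first by rewrite !big_nil derive0.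
  by rewrite !big_cons derive_dirD// derive_dirZ// IHs.
apply: (@Ck_sum _ _ _ _ _ s (fun x q => x.2 ('D_v f q) *: 'D_(x.1) g (f q))) => // x0 i lt.
rewrite (set_nth_default (0, cst 0))//; have [ll cl] := ls _ lt.
set c := (nth _ s i).2; set e := (nth _ s i).1.
apply: (@CkZ _ _ _ _ (fun q => c ('D_v f q)) (fun q => 'D_e g (f q))) => //.
  by apply: Ck_linear => //; exact: Ck_derive.
by apply: (IH ('D_e g)); [exact: Ck_derive|exact: CkW].
Qed.

Lemma Ck_inv n (U : set R^o) : open U -> (forall x, U x -> x != 0) ->
  Ck n U (fun x : R^o => x^-1 : R^o).
Proof.
move=> oU U0.
have dV (x : R^o) : U x -> differentiable (fun x : R^o => x^-1 : R^o) x.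
  by move=> Ux; apply: differentiable_Rinv; exact: U0.
elim: n => [|n IH]; split=> // v.
apply: (@Ck_on _ _ _ _ (fun x : R^o => ((- v * x^-1) *: x^-1 : R^o))) => //.
  move=> x Ux; rewrite [RHS](@deriveV _ _ id)//; last exact: U0.
  by rewrite derive_id /GRing.scale /=; field; exact: U0.
by apply: CkZ => //; apply: (@CkZ _ _ _ _ (cst (- v)) _) => //; exact: Ck_cst.
Qed.

Lemma Ck_exp n (U : set R^o) : open U -> Ck n U (expR : R^o -> R^o).
Proof.
move=> oU; have dE (x : R^o) : U x -> differentiable (expR : R^o -> R^o) x.
  by move=> _; apply/derivable1_diffP.
elim: n => [|n IH]; split=> // v.
apply: (@Ck_on _ _ _ _ (fun x : R^o => (cst (v : R^o)) x *: (expR x : R^o))) => //.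
  move=> x Ux; have E : v = (v : R) *: (1 : R^o) by rewrite [RHS]mulr1.
  rewrite [in RHS]E derive_dirZ; last exact: dE.
  by congr (_ *: _); rewrite derive_val.
by apply: CkZ => //; exact: Ck_cst.
Qed.
End Calculus.

(** * Closure properties of smooth maps and symmetry of second derivatives *)

Section Smooth.
Variable R : realType.
Implicit Types V W : normedModType R.

Lemma is_derive_line V W (f : V -> W) (p v : V) (s : R) :
  derivable f (p + s *: v) v ->
  is_derive s 1 (fun t : R => f (p + t *: v)) ('D_v f (p + s *: v)).
Proof.
have e : (fun h : R => h^-1 *: (f (p + (h *: (1 : R) + s) *: v) - f (p + s *: v))) =
  (fun h : R => h^-1 *: (f (h *: v + (p + s *: v)) - f (p + s *: v))).
  apply/funext => h; congr (_ *: (f _ - _)).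
  by rewrite [h *: (1 : R)]mulr1 scalerDl addrCA.
move=> df; split; first by rewrite /derivable /= e; exact: df.
by rewrite /derive /= e.
Qed.

Lemma is_derive_at_line V W (f : V -> W) (p v : V) (d : W) :
  is_derive (0 : R) (1 : R) (fun t : R => f (p + t *: v)) d -> is_derive p v f d.
Proof.
have e : (fun h : R => h^-1 *: (f (p + (h *: (1 : R) + 0) *: v) - f (p + (0 : R) *: v))) =
  (fun h : R => h^-1 *: (f (h *: v + p) - f p)).
  apply/funext => h; rewrite scale0r !addr0; congr (_ *: (f _ - _)).
  by rewrite [h *: (1 : R)]mulr1 addrC.
case; rewrite /derivable /derive /= e => df dE.
by split; rewrite /derivable /derive /=.
Qed.

Lemma is_derive_translate V W (f : V -> W) (p v c : V) (d : W) :
  is_derive (p + c) v f d -> is_derive p v (fun z => f (z + c)) d.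
Proof.
have e : (fun h : R => h^-1 *: (f (h *: v + p + c) - f (p + c))) =
  (fun h : R => h^-1 *: (f (h *: v + (p + c)) - f (p + c))).
  by apply/funext => h; rewrite addrA.
case; rewrite /derivable /derive /= -e => df dE.
by split; rewrite /derivable /derive /=.
Qed.

Lemma is_derive_approx V W (f : V -> W) (p v : V) (d : W) :
  (forall e : R, 0 < e -> \forall h \near (0 : R), `|f (h *: v + p) - f p - h *: d| <= e * `|h|) ->
  is_derive p v f d.
Proof.
move=> H.
have c : (fun h : R => h^-1 *: (f (h *: v + p) - f p)) @ 0^' --> d.
  apply/cvgrPdist_le => e e0; near=> h.
  have h0 : h != 0 by near: h; exact: nbhs_dnbhs_neq.
  have -> : d = h^-1 *: (h *: d) by rewrite scalerA mulVf// scale1r.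
  rewrite -scalerBr normrZ distrC normfV ler_pdivrMl ?normr_gt0// mulrC.
  by near: h; apply: nbhs_dnbhs; exact: H.
split; first by apply/cvg_ex; exists d.
by rewrite /derive; exact: cvg_lim.
Unshelve. all: by end_near. Qed.

Local Opaque derive.

Lemma smooth_diff V W (U : set V) (f : V -> W) p : smooth_on U f -> U p ->
  differentiable f p.
Proof. by move=> /(_ [::]); exact. Qed.

Lemma smooth_derive V W (U : set V) (f : V -> W) v : smooth_on U f ->
  smooth_on U ('D_v f).
Proof. by move=> sf s p Up; rewrite -iterD_rcons; exact: sf. Qed.

Lemma smooth_sub V W (U U' : set V) (f : V -> W) : U' `<=` U ->
  smooth_on U f -> smooth_on U' f.
Proof. by move=> UU sf s p /UU; exact: sf. Qed.

Lemma smooth_eq_on V W (U : set V) (f g : V -> W) : open U ->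
  (forall q, U q -> f q = g q) -> smooth_on U f -> smooth_on U g.
Proof.
by move=> oU fg /smooth_Ck cf; apply/smooth_Ck => n; exact: (Ck_on oU fg (cf n)).
Qed.

Lemma smooth_cst V W (U : set V) (c : W) : smooth_on U (fun=> c).
Proof. by apply/smooth_Ck => n; exact: Ck_cst. Qed.

Lemma smooth_pair V W1 W2 (U : set V) (f : V -> W1) (g : V -> W2) : open U ->
  smooth_on U f -> smooth_on U g -> smooth_on U (fun q => (f q, g q)).
Proof.
by move=> oU /smooth_Ck cf /smooth_Ck cg; apply/smooth_Ck => n; exact: Ck_pair.
Qed.

Lemma smooth_add V W (U : set V) (f g : V -> W) : open U ->
  smooth_on U f -> smooth_on U g -> smooth_on U (fun q => f q + g q).
Proof.
by move=> oU /smooth_Ck cf /smooth_Ck cg; apply/smooth_Ck => n; exact: CkD.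
Qed.

Lemma smooth_scale V W (U : set V) (k : V -> R^o) (f : V -> W) : open U ->
  smooth_on U k -> smooth_on U f -> smooth_on U (fun q => k q *: f q).
Proof.
by move=> oU /smooth_Ck cf /smooth_Ck cg; apply/smooth_Ck => n; exact: CkZ.
Qed.

Lemma smooth_mul V (U : set V) (f g : V -> R^o) : open U ->
  smooth_on U f -> smooth_on U g -> smooth_on U (fun q => f q * g q : R^o).
Proof. by move=> oU sf sg; exact: (@smooth_scale _ _ _ f g). Qed.

Lemma smooth_opp V (U : set V) (f : V -> R^o) : open U ->
  smooth_on U f -> smooth_on U (fun q => - f q : R^o).
Proof.
move=> oU sf; apply: (@smooth_eq_on _ _ _ (fun q => (-1 : R^o) * f q : R^o)) => //.
  by move=> q _; rewrite mulN1r.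
by apply: smooth_mul => //; exact: smooth_cst.
Qed.

Lemma smooth_linear V W (U : set V) (l : V -> W) : open U ->
  linear l -> continuous l -> smooth_on U l.
Proof.
move=> oU ll cl; apply/smooth_Ck; case=> [|n]; split=> //;
  try by move=> p _; have [] := linear_diff p ll cl.
move=> v; rewrite (_ : 'D_v l = cst (l v)); first exact: Ck_cst.
by apply/funext => p; have [_ ->] := linear_diff p ll cl.
Qed.

Lemma smooth_comp V1 V2 W (U1 : set V1) (U2 : set V2) (g : V2 -> W) (f : V1 -> V2) :
  findim V2 -> open U1 -> (forall p, U1 p -> U2 (f p)) ->
  smooth_on U2 g -> smooth_on U1 f -> smooth_on U1 (fun q => g (f q)).
Proof.
move=> fV oU1 Uf /smooth_Ck cg /smooth_Ck cf; apply/smooth_Ck => n.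
exact: (Ck_comp fV oU1 Uf (cg n) (cf n)).
Qed.

Lemma smooth_inv V (U : set V) (f : V -> R^o) : open U ->
  (forall p, U p -> f p != 0) ->
  smooth_on U f -> smooth_on U (fun q => (f q)^-1 : R^o).
Proof.
move=> oU f0 sf; apply: (@smooth_comp _ _ _ _ [set x : R^o | x != 0] (fun x => x^-1)) => //.
  exact: findim_scalar.
apply/smooth_Ck => n; apply: Ck_inv => //.
Qed.

Lemma smooth_exp V (U : set V) (f : V -> R^o) : open U ->
  smooth_on U f -> smooth_on U (fun q => expR (f q) : R^o).
Proof.
move=> oU sf; apply: (@smooth_comp _ _ _ _ setT (expR : R^o -> R^o)) => //.
  exact: findim_scalar.
by apply/smooth_Ck => n; apply: Ck_exp; exact: openT.
Qed.

Lemma smooth_cont V W (U : set V) (f : V -> W) p : smooth_on U f -> U p ->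
  {for p, continuous f}.
Proof. by move=> sf Up; apply: differentiable_continuous; exact: smooth_diff sf Up. Qed.

Lemma mvt_line V (f : V -> R^o) (p v : V) (h : R) : 0 < h ->
  (forall s, 0 <= s <= h -> differentiable f (p + s *: v)) ->
  exists2 s, 0 < s < h & f (p + h *: v) - f p = 'D_v f (p + s *: v) * h.
Proof.
move=> h0 df.
have [||s] := @MVT R (fun t => f (p + t *: v)) (fun s => 'D_v f (p + s *: v)) 0 h h0.
- move=> s; rewrite in_itv/= => /andP[/ltW s0 /ltW sh].
  by apply/is_derive_line/diff_derivable/df; rewrite s0 sh.
- apply: continuous_in_subspaceT => s; rewrite inE/= in_itv/= => sh.
  apply: differentiable_continuous; apply/derivable1_diffP.
  by have [] := is_derive_line (diff_derivable (df _ sh)).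
by rewrite in_itv/= scale0r addr0 subr0 => sh e; exists s.
Qed.

Lemma ball_line2 V (P : V -> Prop) (p u v : V) : (\near p, P p) ->
  exists2 h : R, 0 < h & forall s t, 0 <= s <= h -> 0 <= t <= h -> P (p + s *: u + t *: v).
Proof.
(* The added 1 keeps the denominator positive when [u] and [v] are zero. *)
move=> /nbhs_normP[d /= d0 H]; exists (d / (`|u| + `|v| + 1)) => [|s t /andP[s0 sh] /andP[t0 th]].
  by rewrite divr_gt0// ltr_wpDl// addr_ge0.
apply: H => /=; rewrite -addrA opprD addrA subrr add0r normrN.
apply: le_lt_trans (ler_normD _ _) _; rewrite !normrZ (ger0_norm s0) (ger0_norm t0).
have k0 : 0 < `|u| + `|v| + 1 by rewrite ltr_wpDl// addr_ge0.
have -> : d = d / (`|u| + `|v| + 1) * (`|u| + `|v| + 1) by rewrite mulfVK// gt_eqF.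
have := ler_wpM2r (normr_ge0 u) sh; have := ler_wpM2r (normr_ge0 v) th.
have : 0 < d / (`|u| + `|v| + 1) by rewrite divr_gt0.
by move: (d / _) => k; lra.
Qed.

(** Limit step for the symmetry of second derivatives: the mean value theorem yields the two mixed
    derivatives at different points of a small parallelogram, and these points tend to [p] with its
    size. *)
Lemma eq_near_square V (U : set V) (a b : V -> R^o) (p u v : V) : open U -> U p ->
  {for p, continuous a} -> {for p, continuous b} ->
  (forall h : R, 0 < h ->
    (forall s t, 0 <= s <= h -> 0 <= t <= h -> U (p + s *: u + t *: v)) ->
    exists s t s' t' : R, [/\ 0 <= s <= h, 0 <= t <= h, 0 <= s' <= h, 0 <= t' <= h &
      a (p + s *: u + t *: v) = b (p + s' *: u + t' *: v)]) ->
  a p = b p.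
Proof.
move=> oU Up ca cb H.
apply/eqP; rewrite -subr_eq0 -normr_le0; apply/ler_addgt0Pr => e e0; rewrite add0r.
have e20 : 0 < e / 2 by rewrite divr_gt0.
have Na : \forall q \near p, `|a p - a q| < e / 2 by move/cvgrPdist_lt : ca; exact.
have Nb : \forall q \near p, `|b p - b q| < e / 2 by move/cvgrPdist_lt : cb; exact.
have N : \forall q \near p, [/\ U q, `|a p - a q| < e / 2 & `|b p - b q| < e / 2].
  by near=> q; split; near: q => //; exact: open_nbhs_nbhs.
have [h h0 Hh] := ball_line2 u v N.
have [s [t [s' [t' [sh th sh' th' E]]]]] := H h h0 (fun s t sh th => let: And3 x _ _ := Hh s t sh th in x).
have [_ A _] := Hh _ _ sh th; have [_ _ B] := Hh _ _ sh' th'.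
rewrite (_ : _ - _ = (a p - a (p + s *: u + t *: v)) - (b p - b (p + s' *: u + t' *: v))); last by rewrite E; ring.
rewrite (splitr e); apply: le_trans (ler_normB _ _) _.
by rewrite lerD// ltW.
Unshelve. all: by end_near. Qed.

(** The second difference of [f] over a parallelogram of size [h] is symmetric in the two
    directions; two uses of the mean value theorem write it as [h * h] times either mixed derivative
    at some intermediate point. *)
Lemma schwarz V (U : set V) (f : V -> R^o) (p u v : V) : open U -> U p ->
  smooth_on U f -> 'D_u ('D_v f) p = 'D_v ('D_u f) p.
Proof.
move=> oU Up sf.
have key (w w' : V) (h : R) : 0 < h ->
    (forall s t, 0 <= s <= h -> 0 <= t <= h -> U (p + s *: w + t *: w')) ->
    exists s t : R, [/\ 0 <= s <= h, 0 <= t <= h &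
      f (p + h *: w + h *: w') - f (p + h *: w) - f (p + h *: w') + f p =
      'D_w' ('D_w f) (p + s *: w + t *: w') * h * h].
  move=> h0 HU.
  have HU0 s : 0 <= s <= h -> U (p + s *: w).
    by move=> sh; have := HU s 0 sh; rewrite scale0r addr0; apply; rewrite lexx ltW.
  pose F q : R^o := f (h *: w' + q) - f q.
  have dsh q : differentiable (fun q : V => h *: w' + q) q by exact: differentiableD.
  have dfs s : 0 <= s <= h -> differentiable (fun q => f (h *: w' + q)) (p + s *: w).
    move=> sh; apply: (@differentiable_comp _ _ _ _ _ f) => //.
    by apply: smooth_diff sf _; rewrite addrC; apply: HU => //; rewrite lexx ltW.
  have [s sh e1] : exists2 s, 0 < s < h & F (p + h *: w) - F p = 'D_w F (p + s *: w) * h.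
    apply: mvt_line => // s sh; apply: differentiableB; first exact: dfs.
    by apply: smooth_diff sf _; exact: HU0.
  have sh' : 0 <= s <= h by case/andP: sh => a b; rewrite !ltW.
  have E1 : 'D_w F (p + s *: w) = 'D_w f (p + s *: w + h *: w') - 'D_w f (p + s *: w).
    rewrite [LHS]deriveB; last 2 first.
    - by apply: diff_derivable; exact: dfs.
    - by apply: diff_derivable; apply: smooth_diff sf _; exact: HU0.
    congr (_ - _); rewrite derive_comp//; last first.
      by apply: smooth_diff sf _; rewrite addrC; apply: HU => //; rewrite lexx ltW.
    by rewrite deriveD// derive_cst add0r derive_id addrC.
  have [t th e2] : exists2 t, 0 < t < h & 'D_w f (p + s *: w + h *: w') - 'D_w f (p + s *: w) =
      'D_w' ('D_w f) (p + s *: w + t *: w') * h.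
    apply: (@mvt_line V ('D_w f)) => // t th.
    by apply: (smooth_diff (smooth_derive w sf)); exact: HU.
  exists s, t; split=> //; first by case/andP: th => a b; rewrite !ltW.
  by rewrite -e2 -E1 -e1 /F ![h *: w' + _]addrC; ring.
apply: (@eq_near_square V U ('D_u ('D_v f)) ('D_v ('D_u f)) p u v) => //.
- exact: smooth_cont (smooth_derive u (smooth_derive v sf)) Up.
- exact: smooth_cont (smooth_derive v (smooth_derive u sf)) Up.
move=> h h0 HU.
have [s [t [sh th Eb]]] := key u v h h0 HU.
have [t' [s' [th' sh' Ea]]] := key v u h h0
  (fun t s th sh => eq_ind _ U (HU s t sh th) _ (addrAC _ _ _)).
exists s', t', s, t; split; [exact: sh'|exact: th'|exact: sh|exact: th|].
have fin (x y z w a b : R) : x - y - z + w = a * h * h -> x - z - y + w = b * h * h -> b = a.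
  have h2 : h * h != 0 by rewrite mulf_neq0// gt_eqF.
  by move=> e1 e2; apply: (mulIf h2); rewrite !mulrA -e1 -e2; ring.
rewrite [p + h *: v + _]addrAC [p + t' *: v + _]addrAC in Ea.
exact: (fin _ _ _ _ _ _ Eb Ea).
Qed.
End Smooth.

(** * Boxes in the plane and differentiability from partial derivatives *)

Section Primitive.
Variable R : realType.
Implicit Types V W : normedModType R.

(** Unlike in [mvt_line], only derivability along the line is assumed and [h] may have any sign:
    this serves functions whose differentiability is still to be proved. *)
Lemma mvt_line_derivable V (f : V -> R^o) (p v : V) (h : R) :
  (forall s : R, `|s| <= `|h| -> derivable f (p + s *: v) v) ->
  exists2 s : R, `|s| <= `|h| & f (p + h *: v) - f p = 'D_v f (p + s *: v) * h.
Proof.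
move=> df.
pose g (t : R) : R := f (p + t *: v); pose dg (s : R) : R := 'D_v f (p + s *: v).
have dgP (s : R) : `|s| <= `|h| -> is_derive s 1 g (dg s) by move=> /df; exact: is_derive_line.
have mvt (a b : R) : a <= b -> `|a| <= `|h| -> `|b| <= `|h| ->
    exists2 c : R, `|c| <= `|h| & g b - g a = dg c * (b - a).
  move=> ab; rewrite !ler_norml => /andP[a1 a2] /andP[b1 b2].
  have inab (s : R) : s \in `[a, b] -> `|s| <= `|h|.
    by rewrite in_itv/= => /andP[sa sb]; rewrite ler_norml; lra.
  have [s sab||s sab E] := @MVT_segment R g dg a b ab.
  - by apply: dgP; apply: inab; exact: subset_itv_oo_cc.
  - apply: continuous_in_subspaceT => s; rewrite inE/= => sab.
    apply: differentiable_continuous; apply/derivable1_diffP.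
    by have [] := dgP s (inab _ sab).
  by exists s => //; exact: inab.
have g0 : g 0 = f p by rewrite /g scale0r addr0.
rewrite -g0 -[f (p + h *: v)]/(g h).
have [h0|h0] := leP 0 h.
  by have [|||s sh E] := mvt 0 h => //; rewrite ?normr0//; exists s => //; rewrite E subr0.
have [|||s sh E] := mvt h 0 => //; rewrite ?normr0//; first exact: ltW.
by exists s => //; rewrite -[LHS]opprB E sub0r mulrN opprK.
Qed.

Definition box (p : plane R) (r : R) : set (plane R) :=
  [set q | `|q.1 - p.1| < r /\ `|q.2 - p.2| < r].

Lemma box_ball p (r : R) : box p r = ball p r.
Proof.
apply/seteqP; split=> q /=; rewrite /ball /= /prod_ball /ball /= => -[a b];
  by split; rewrite distrC.
Qed.

Lemma open_box p r : open (box p r).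
Proof.
rewrite openE => q [q1 q2] /=.
apply/nbhs_ballP; exists (Num.min (r - `|q.1 - p.1|) (r - `|q.2 - p.2|)) => /=.
  by rewrite lt_min !subr_gt0 q1 q2.
rewrite -box_ball => z [/=]; rewrite !lt_min => /andP[z1 _] /andP[_ z2]; split.
  by rewrite -(subrKA q.1) (le_lt_trans (ler_normD _ _))// -ltrBrDr.
by rewrite -(subrKA q.2) (le_lt_trans (ler_normD _ _))// -ltrBrDr.
Qed.

Lemma box_center p r : 0 < r -> box p r p.
Proof. by move=> r0; split; rewrite subrr normr0. Qed.

Lemma open_box_sub (U : set (plane R)) p : open U -> U p ->
  exists2 r, 0 < r & box p r `<=` U.
Proof.
move=> oU Up; have /nbhs_ballP[r /= r0 H] := open_nbhs_nbhs (conj oU Up).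
by exists r => //; rewrite box_ball.
Qed.

Lemma box_sub p r s : s <= r -> box p s `<=` box p r.
Proof. by move=> sr q [a b]; split; exact: lt_le_trans sr. Qed.

Let et : plane R := (1, 0).
Let ex : plane R := (0, 1).

Lemma findim_plane : findim (plane R).
Proof. by apply: findim_prod; exact: findim_scalar. Qed.

Lemma planeE (v : plane R) : v = v.1 *: et + v.2 *: ex.
Proof.
by case: v => a b; apply/pair_equal_spec; split=> /=; rewrite [_ *: 1]mulr1 scaler0 ?addr0 ?add0r.
Qed.

Lemma derive_plane W (f : plane R -> W) p v : differentiable f p ->
  'D_v f p = v.1 *: Dt f p + v.2 *: Dx f p.
Proof. by move=> df; rewrite {1}(planeE v) derive_dirD// !derive_dirZ. Qed.

Lemma fst_linear V W : linear (fst : V * W -> V). Proof. by []. Qed.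
Lemma snd_linear V W : linear (snd : V * W -> W). Proof. by []. Qed.
Lemma fst_continuous V W : continuous (fst : V * W -> V). Proof. by move=> x; exact: cvg_fst. Qed.
Lemma snd_continuous V W : continuous (snd : V * W -> W). Proof. by move=> x; exact: cvg_snd. Qed.

Lemma differentiable_fst V W p : differentiable (fst : V * W -> V) p.
Proof. by have [] := linear_diff p (@fst_linear V W) (@fst_continuous V W). Qed.

Lemma differentiable_snd V W p : differentiable (snd : V * W -> W) p.
Proof. by have [] := linear_diff p (@snd_linear V W) (@snd_continuous V W). Qed.

Lemma derive_fst V W p v : 'D_v (fst : V * W -> V) p = v.1.
Proof. by have [_ ->] := linear_diff p (@fst_linear V W) (@fst_continuous V W). Qed.

Lemma derive_snd V W p v : 'D_v (snd : V * W -> W) p = v.2.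
Proof. by have [_ ->] := linear_diff p (@snd_linear V W) (@snd_continuous V W). Qed.

(** Move in [t] first, then in [x]. The first step uses the t-derivative at [p] alone; the second
    uses the mean value theorem and the continuity of the x-derivative at [p]. *)
Lemma differentiable_partials (U : set (plane R)) (f fx : plane R -> R^o) p :
  open U -> U p -> derivable f p et ->
  (forall q, U q -> derivable f q ex /\ Dx f q = fx q) -> {for p, continuous fx} ->
  differentiable f p.
Proof.
move=> oU Up dft dfx cfx.
pose df (v : plane R) : R^o := v.1 * Dt f p + v.2 * fx p.
suff [] : differentiable f p /\ 'd f p = df :> (plane R -> R^o) by [].
apply: differentiable_approx.
- move=> a u v; rewrite /df.
  have -> : (a *: u + v).1 = a * u.1 + v.1 by [].
  have -> : (a *: u + v).2 = a * u.2 + v.2 by [].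
  by rewrite !mulrDl addrACA -!mulrA -mulrDr.
- move=> v; apply: differentiable_continuous.
  apply: (@differentiableD _ _ _ (fun v : plane R => v.1 * Dt f p : R^o) (fun v : plane R => v.2 * fx p : R^o)).
    by apply: (@differentiable_scale _ _ _ _ (fun=> Dt f p)); [exact: differentiable_fst|exact: differentiable_cst].
  by apply: (@differentiable_scale _ _ _ _ (fun=> fx p)); [exact: differentiable_snd|exact: differentiable_cst].
move=> e e0.
have e2 : 0 < e / 2 by rewrite divr_gt0.
have Nt : \forall h \near (0 : R), `|f (h *: et + p) - f p - h * Dt f p| <= e / 2 * `|h|.
  have /derivable_nbhs/eqaddoP/(_ _ e2) := dft.
  apply: filterS => h; rewrite /= !fctE /=.
  by rewrite opprD addrA.
have Nx : \forall q \near p, U q /\ `|fx p - fx q| < e / 2.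
  have na : \forall q \near p, `|fx p - fx q| < e / 2 by move/cvgrPdist_lt : cfx; exact.
  by near=> q; split; near: q => //; exact: open_nbhs_nbhs.
have [r r0 Hr] : exists2 r, 0 < r & forall q, box p r q -> U q /\ `|fx p - fx q| < e / 2.
  by have /nbhs_ballP[r /= r0 H] := Nx; exists r => //; move=> q; rewrite box_ball; exact: H.
have /nbhs_ballP[r' /= r'0 Ht] := Nt.
have H0 : \forall h \near (0 : plane R), box 0 (Num.min r r') h.
  by apply: open_nbhs_nbhs; split; [exact: open_box|apply: box_center; rewrite lt_min r0 r'0].
apply: filterS H0 => h [/=]; rewrite !subr0 !lt_min => /andP[h1r h1r'] /andP[h2r _].
have B : `|f (h.1 *: et + p) - f p - h.1 * Dt f p| <= e / 2 * `|h.1|.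
  by apply: Ht; rewrite /ball /= sub0r normrN.
have bx (s : R) : `|s| <= `|h.2| -> box p r (h.1 *: et + p + s *: ex).
  move=> sh; split=> /=.
    by rewrite [_ *: 1]mulr1 scaler0 addr0 addrK.
  by rewrite scaler0 add0r [_ *: 1]mulr1 addrAC subrr add0r; apply: le_lt_trans sh _.
have [s sh E] : exists2 s : R, `|s| <= `|h.2| &
    f (h.1 *: et + p + h.2 *: ex) - f (h.1 *: et + p) = 'D_ex f (h.1 *: et + p + s *: ex) * h.2.
  by apply: mvt_line_derivable => s sh; have [] := dfx _ (Hr _ (bx _ sh)).1.
have [Us fxs] := Hr _ (bx _ sh).
have E' := (dfx _ Us).2; rewrite /Dx in E'; rewrite {}E' in E.
have -> : h + p = h.1 *: et + p + h.2 *: ex by rewrite {1}(planeE h) addrAC.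
rewrite /df (_ : _ - _ = (f (h.1 *: et + p) - f p - h.1 * Dt f p) -
   (fx p - fx (h.1 *: et + p + s *: ex)) * h.2); last by rewrite mulrBl; move: E; lra.
apply: le_trans (ler_normB _ _) _; rewrite normrM.
have n1 : `|h.1| <= `|h| by rewrite /Num.norm /= le_max lexx.
have n2 : `|h.2| <= `|h| by rewrite /Num.norm /= le_max lexx orbT.
have := ler_wpM2l (ltW e2) n1; have := ler_pM (normr_ge0 _) (normr_ge0 _) (ltW fxs) n2.
move: B; lra.
Unshelve. all: by end_near. Qed.

End Primitive.

(** * Primitives and implicit functions in the plane *)

Section ParametricPrimitive.
Variable R : realType.
Let et : plane R := (1, 0).
Let ex : plane R := (0, 1).

Lemma primitive_exists (f : R -> R) (c s : R) : 0 < s ->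
  (forall x, `|x - c| <= s -> {for x, continuous f}) ->
  exists F : R -> R, F c = 0 /\ forall x, `|x - c| < s -> is_derive x 1 F (f x).
Proof.
move=> s0 cf.
(* Starting at the left end makes every point closer than [s] to [c] an interior one; subtracting
   [G c] later moves the zero to [c]. *)
pose G x := (\int[@lebesgue_measure R]_(y in `[c - s, x]) f y)%R.
have intf : (@lebesgue_measure R).-integrable `[c - s, c + s] (EFin \o f).
  apply: continuous_compact_integrable; first exact: segment_compact.
  apply: continuous_in_subspaceT => x; rewrite inE/= in_itv/= => xcs.
  by apply: cf; rewrite ler_norml; lra.
have dG x : `|x - c| < s -> is_derive x 1 G (f x).
  move=> xs; have : - s < x - c < s by rewrite -ltr_norml.
  move=> /andP[x1 x2].
  have xu : x < c + s by lra.
  have xa : c - s < x by lra.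
  have [dG <-] := continuous_FTC1_closed xu intf xa (cf _ (ltW xs)).
  by split; [exact: dG|exact/esym/derive1E].
exists (fun x => G x - G c); split=> [|x xs]; first by rewrite subrr.
have := dG _ xs => dGx.
have -> : f x = f x - 0 by rewrite subr0.
exact: is_deriveB.
Qed.

(** Nothing is asked about the dependence of [P] on [t]. The normalization on the line [x = p.2]
    determines [P] on the box, and this is what later allows differentiation in [t] under the
    integral. *)
Definition prim (p : plane R) (s : R) (f P : plane R -> R^o) : Prop :=
  (forall q, box p s q -> is_derive q ex P (f q)) /\
  (forall t, `|t - p.1| < s -> P (t, p.2) = 0).

Lemma prim_exists p (r s : R) f : 0 < s -> s < r -> smooth_on (box p r) f ->
  exists P, prim p s f P.
Proof.
move=> s0 sr sf.
have H t : exists F : R -> R, `|t - p.1| < s ->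
    F p.2 = 0 /\ forall x, `|x - p.2| < s -> is_derive x 1 F (f (t, x)).
  have [ts|//] := pselect (`|t - p.1| < s); last by exists id.
  have [x xs|F [F0 FD]] := @primitive_exists (fun x => f (t, x)) p.2 s s0; last by exists F.
  have bx : box p r (t, x) by split => /=; [exact: lt_trans sr|exact: le_lt_trans sr].
  apply: (@continuous_comp _ _ _ (fun x : R => (t, x) : plane R) f).
    by apply: differentiable_continuous; apply: differentiable_pair.
  exact: smooth_cont sf bx.
have [F FP] := choice H.
exists (fun q => F q.1 q.2); split=> [[t x] [ts xs]|t ts]; last by have [] := FP t ts.
apply: is_derive_at_line => /=.
have [_ /(_ x xs) D] := FP t ts.
have -> : (fun h : R => F ((t, x) + h *: ex : plane R).1 ((t, x) + h *: ex : plane R).2) = (fun h : R => F t (x + h *: (1 : R))).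
  by apply/funext => h /=; rewrite scaler0 addr0.
have := @is_derive_line R R R^o (F t) x 1 0; rewrite scale0r addr0 => K.
case: D => D <-; exact: K.
Qed.

Lemma smooth_bounded p (r s : R) (f : plane R -> R^o) : s < r -> smooth_on (box p r) f ->
  exists M : R, 0 <= M /\ forall q, `|q.1 - p.1| <= s -> `|q.2 - p.2| <= s -> `|f q| <= M.
Proof.
move=> sr sf.
pose K := `[p.1 - s, p.1 + s]%classic `*` `[p.2 - s, p.2 + s]%classic.
have cK : compact K by apply: compact_setX; exact: segment_compact.
have KP (q : plane R) : K q <-> `|q.1 - p.1| <= s /\ `|q.2 - p.2| <= s.
  by rewrite /K /= !in_itv /= !ler_norml; split=> -[/andP[? ?] /andP[? ?]]; split; apply/andP; split; lra.
have : {within K, continuous (f : R * R -> R)}.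
  apply: continuous_in_subspaceT => q; rewrite inE => /KP[q1 q2].
  by apply: (smooth_cont sf); split; exact: le_lt_trans sr.
move=> /continuous_compact/(_ cK)/compact_bounded [M [_ HM]].
exists (`|M| + 1); split; first by rewrite addr_ge0.
move=> q q1 q2; apply: (HM (`|M| + 1)); first by rewrite (le_lt_trans (ler_norm _)) ?ltrDl.
by exists q => //; apply/KP.
Qed.

(* The second difference of [P] in [t] has an [x]-derivative of order [h ^ 2],
   and vanishes on the line [x = p.2]. *)
Lemma prim_derive_t p (r s : R) f P S : 0 < s -> s < r -> smooth_on (box p r) f ->
  prim p s f P -> prim p s (Dt f) S -> forall q, box p s q -> is_derive q et P (S q).
Proof.
move=> s0 sr sf [Pf P0] [Sf S0] [t x] [ts xs]; rewrite /= in ts xs.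
have [M [M0 HM]] := smooth_bounded sr (smooth_derive et (smooth_derive et sf)).
apply: is_derive_approx => e e0.
(* The remainder will be bounded by [M * s * |h|^2], so [|h| <= e / (M * s + 1)] suffices; the added
   1 makes the denominator positive. *)
have e' : 0 < e / (M * s + 1) by rewrite divr_gt0// ltr_wpDl// mulr_ge0// ltW.
have d0 : 0 < Num.min (e / (M * s + 1)) (s - `|t - p.1|) by rewrite lt_min e' subr_gt0.
have : \forall h \near (0 : R), `|h| < Num.min (e / (M * s + 1)) (s - `|t - p.1|).
  by apply/nbhs_ballP; exists (Num.min (e / (M * s + 1)) (s - `|t - p.1|)) => //= h; rewrite /ball /= sub0r normrN.
apply: filterS => h; rewrite lt_min => /andP[he hs].
pose Phi (z : plane R) : R^o := P (z + h *: et) - P z - h * S z.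
have th (k : R) : `|k| <= `|h| -> `|t + k - p.1| < s.
  move=> kh; have -> : t + k - p.1 = t - p.1 + k by ring.
  by apply: le_lt_trans (ler_normD _ _) _; move: kh hs; lra.
have bz (k y : R) : `|k| <= `|h| -> `|y| <= `|x - p.2| -> box p s ((t, p.2) + y *: ex + k *: et).
  move=> kh yx; split => /=.
    by rewrite scaler0 addr0 [_ *: 1]mulr1; exact: th.
  by rewrite scaler0 addr0 [_ *: 1]mulr1 addrAC subrr add0r; exact: le_lt_trans xs.
have bz0 (y : R) : `|y| <= `|x - p.2| -> box p s ((t, p.2) + y *: ex).
  by move=> yx; have := @bz 0 y; rewrite scale0r addr0 normr0; exact.
pose dPhi (z : plane R) : R^o := f (z + h *: et) - f z - h * Dt f z.
have dPhiP (y : R) : `|y| <= `|x - p.2| -> is_derive ((t, p.2) + y *: ex) ex Phi (dPhi ((t, p.2) + y *: ex)).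
  move=> yx; have dS := Sf _ (bz0 _ yx).
  have dP := Pf _ (bz0 _ yx); have dPh := is_derive_translate (Pf _ (bz h y (lexx _) yx)).
  exact: (is_deriveB (is_deriveB dPh dP) (is_deriveZ h dS)).
have bPhi (y : R) : `|y| <= `|x - p.2| -> `|dPhi ((t, p.2) + y *: ex)| <= M * `|h| * `|h|.
  move=> yx; set z := _ + _.
  have bxz (k : R) : `|k| <= `|h| -> box p s (z + k *: et) by move=> kh; exact: bz.
  have bxr (k : R) : `|k| <= `|h| -> box p r (z + k *: et).
    by move/bxz; apply: box_sub; exact: ltW.
  (* Two uses of the mean value theorem bound the first order remainder of [f] in [t] by
     [M * |h|^2]. *)
  have [k kh E] := @mvt_line_derivable _ _ f z et h (fun k kh => diff_derivable (smooth_diff sf (bxr k kh))).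
  have [k' k'k E'] := @mvt_line_derivable _ _ ('D_et f) z et k
    (fun k' k'k => diff_derivable (smooth_diff (smooth_derive et sf) (bxr k' (le_trans k'k kh)))).
  rewrite /dPhi E (_ : _ - _ = 'D_et ('D_et f) (z + k' *: et) * k * h); last first.
    by rewrite -E' /Dt; ring.
  rewrite !normrM ler_wpM2r//; apply: ler_pM => //.
  by have [/ltW ? /ltW ?] := bxz k' (le_trans k'k kh); exact: HM.
have [y yx E] := @mvt_line_derivable _ _ Phi (t, p.2) ex (x - p.2) (fun y yx => let: DeriveDef d _ := dPhiP y yx in d).
have Phi0 : Phi (t, p.2) = 0.
  rewrite /Phi P0// S0// mulr0 !subr0.
  have -> : ((t, p.2) : plane R) + h *: et = (t + h, p.2).
    by apply/pair_equal_spec; split=> /=; rewrite ?scaler0 ?addr0// [_ *: 1]mulr1.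
  by rewrite P0// th.
have ztx : ((t, p.2) : plane R) + (x - p.2) *: ex = (t, x).
  by apply/pair_equal_spec; split=> /=; rewrite ?scaler0 ?addr0// [_ *: 1]mulr1 addrC subrK.
rewrite ztx Phi0 subr0 in E.
have -> : P (h *: et + (t, x)) - P (t, x) - h *: S (t, x) = Phi (t, x) by rewrite [h *: et + _]addrC.
have D : 'D_ex Phi ((t, p.2) + y *: ex) = dPhi ((t, p.2) + y *: ex) by have [] := dPhiP _ yx.
rewrite E D normrM.
have h1 : `|h| * (M * s + 1) <= e by rewrite -ler_pdivlMr ?ltW// ltr_wpDl// mulr_ge0// ltW.
apply: (@le_trans _ _ (M * `|h| * `|h| * s)).
  by apply: ler_pM => //; [exact: bPhi|exact: ltW].
rewrite (_ : M * `|h| * `|h| * s = (`|h| * (M * s)) * `|h|); last by ring.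
by rewrite ler_wpM2r//; apply: le_trans h1; rewrite ler_wpM2l// lerDl.
Qed.

(** The t-derivative of a primitive of [f] is the primitive of [Dt f], and its x-derivative is [f].
    The induction is on the order of differentiability, for all [f] and [P] at once. *)
Lemma prim_smooth p (r s : R) f P : 0 < s -> s < r -> smooth_on (box p r) f ->
  prim p s f P -> smooth_on (box p s) P.
Proof.
move=> s0 sr sf pP; apply/smooth_Ck => n.
have ob := @open_box R p s.
have dif f' P' : smooth_on (box p r) f' -> prim p s f' P' ->
    exists S, prim p s (Dt f') S /\ forall q, box p s q -> differentiable P' q /\
      forall v, 'D_v P' q = v.1 *: S q + v.2 *: f' q.
  move=> sf' pP'; have [S pS] := prim_exists s0 sr (smooth_derive et sf').
  exists S; split=> // q bq.
  have dt z bz := prim_derive_t s0 sr sf' pP' pS (q := z) bz.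
  have dP : differentiable P' q.
    apply: (@differentiable_partials _ (box p s) P' f') => //.
    - by have [] := dt q bq.
    - by move=> z bz; have [] := pP'.1 z bz.
    - by apply: (smooth_cont sf'); apply: box_sub bq; exact: ltW.
  split=> // v; rewrite derive_plane// /Dt /Dx.
  by have [_ ->] := dt q bq; have [_ ->] := pP'.1 q bq.
elim: n f P sf pP => [|n IH] f P sf pP; have [S [pS D]] := dif f P sf pP;
  split=> //; try by move=> q /D[].
move=> v; apply: (@Ck_on _ _ _ _ _ (fun q => v.1 *: S q + v.2 *: f q)) => //.
  by move=> q /D[_ ->].
apply: CkD => //.
  apply: (@CkZ _ _ _ _ _ (cst v.1)) => //; first exact: Ck_cst.
  by apply: (IH (Dt f)) => //; exact: smooth_derive.
apply: (@CkZ _ _ _ _ _ (cst v.2)) => //; first exact: Ck_cst.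
by move/smooth_Ck : sf => /(_ n); apply: Ck_sub; apply: box_sub; exact: ltW.
Qed.

Lemma primitive_x p (r s : R) (f : plane R -> R^o) : 0 < s -> s < r -> smooth_on (box p r) f ->
  exists P : plane R -> R^o, [/\ smooth_on (box p s) P,
    forall q, box p s q -> Dx P q = f q &
    forall t, `|t - p.1| < s -> P (t, p.2) = 0].
Proof.
move=> s0 sr sf; have [P pP] := prim_exists s0 sr sf.
exists P; split; [exact: prim_smooth s0 sr sf pP| |by case: pP].
by move=> q bq; have [_ <-] := pP.1 q bq.
Qed.
End ParametricPrimitive.

(** * Implicit functions of one unknown with a parameter *)

Section Implicit.
Variable R : realType.
Implicit Types V W : normedModType R.

Lemma diff_approx V W (f : V -> W) p (e : R) : differentiable f p -> 0 < e ->
  \forall h \near (0 : V), `|f (h + p) - f p - 'D_h f p| <= e * `|h|.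
Proof.
move=> df e0; have /diff_locally/eqaddoP/(_ e e0) := df.
apply: filterS => h; rewrite /= !fctE opprD addrA /=.
by rewrite deriveE.
Qed.

Lemma smooth_fst_plane (U : set (plane R)) : open U -> smooth_on U (fun q : plane R => q.1 : R^o).
Proof.
by move=> oU; apply: smooth_linear => //; exact: fst_continuous.
Qed.

Lemma smooth_snd_plane (U : set (plane R)) : open U -> smooth_on U (fun q : plane R => q.2 : R^o).
Proof.
by move=> oU; apply: smooth_linear => //; exact: snd_continuous.
Qed.

(** Absorption argument: the error [e * (a + y)] contains the unknown increment [y], and
    [e <= k / 2] lets half of the left side swallow it. The result is a Lipschitz bound on the
    increment of the implicit function. *)
Fact implicit_bound (k e N a y z w : R) : 0 < k -> 0 <= a -> 0 <= y -> e <= k / 2 ->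
  k * z <= e * (a + y) -> k * w <= N * a -> y <= z + w -> y <= (2 * N + k) / k * a.
Proof.
move=> k0 a0 y0 ek H2 H3 H4; rewrite mulrAC ler_pdivlMr//.
have := ler_wpM2l (ltW k0) H4; have := ler_wpM2r (addr_ge0 a0 y0) ek.
by move: H2 H3; lra.
Qed.

Section ImplicitFun.
Variables (p : plane R) (r : R) (F : plane R -> R^o).
Hypothesis r0 : 0 < r.
Hypothesis sF : smooth_on (box p r) F.
Hypothesis Fx_gt0 : forall q, box p r q -> 0 < (Dx F q : R).
Let ex : plane R := (0, 1).

Lemma implicit_mono (t x y : R) : box p r (t, x) -> box p r (t, y) -> x < y ->
  F (t, x) < F (t, y).
Proof.
move=> [/= tr xr] [/= _ yr] xy.
have yx0 : 0 < y - x by rewrite subr_gt0.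
have b (s : R) : 0 <= s <= y - x -> box p r ((t, x) + s *: ex).
  move=> /andP[s0 s1]; split => /=; rewrite ?scaler0 ?addr0// [_ *: 1]mulr1.
  by move: xr yr; rewrite !ltr_norml => /andP[? ?] /andP[? ?]; lra.
have [s /andP[s0 s1] E] := @mvt_line _ _ F (t, x) ex (y - x) yx0 (fun s sb => smooth_diff sF (b s sb)).
have e : ((t, x) : plane R) + (y - x) *: ex = (t, y).
  by apply/pair_equal_spec; split=> /=; rewrite ?scaler0 ?addr0// [_ *: 1]mulr1 addrC subrK.
rewrite e in E; rewrite -subr_gt0 E; apply: mulr_gt0 => //; apply: Fx_gt0; apply: b.
by rewrite !ltW.
Qed.

Variables (q0 : plane R) (d : R) (X : plane R -> R^o).
Hypothesis XP : forall q, box q0 d q -> box p r (q.1, X q) /\ F (q.1, X q) = q.2.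

(** Strict inequalities [F (t, X q - m) < y < F (t, X q + m)] persist for [(t, y)] near [q], and
    monotonicity of [F] in [x] then squeezes [X] between [X q - m] and [X q + m]. *)
Lemma implicit_continuous q (e : R) : box q0 d q -> 0 < e ->
  \forall z \near q, box q0 d z /\ `|X z - X q| < e.
Proof.
move=> bq e0; have [[/= q1 q2] Fq] := XP bq.
(* At most [e], and small enough for [X q + m] and [X q - m] to stay in the box. *)
pose m := Num.min e ((r - `|X q - p.2|) / 2).
have m0 : 0 < m by rewrite lt_min e0 divr_gt0// subr_gt0.
have me : m <= e by rewrite ge_min lexx.
have mr : m + `|X q - p.2| < r.
  have : m <= (r - `|X q - p.2|) / 2 by rewrite ge_min lexx orbT.
  lra.
have bm (k t : R) : `|k| <= m -> `|t - p.1| < r -> box p r (t, X q + k).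
  move=> km tr; split => //=; rewrite addrAC.
  by apply: le_lt_trans (ler_normD _ _) _; apply: le_lt_trans mr; rewrite [leRHS]addrC lerD2l.
have mm : `|m| <= m by rewrite gtr0_norm.
have mmN : `|- m| <= m by rewrite normrN gtr0_norm.
have z1 : \forall z \near q, `|z.1 - p.1| < r.
  have sub : 0 < r - `|q.1 - p.1| by rewrite subr_gt0.
  apply: (@filterS _ _ _ (box q (r - `|q.1 - p.1|))).
    move=> z [/= zq _]; rewrite -(subrKA q.1) (le_lt_trans (ler_normD _ _))//.
    by rewrite -ltrBrDr.
  by apply: open_nbhs_nbhs; split; [exact: open_box|exact: box_center].
have cF (k : R) : `|k| <= m -> {for q, continuous (fun z : plane R => F (z.1, X q + k) - z.2)}.
  move=> km; apply: differentiable_continuous; apply: differentiableB; last exact: differentiable_snd.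
  apply: (@differentiable_comp _ _ _ _ (fun z : plane R => (z.1, X q + k) : plane R) F).
    by apply: differentiable_pair; [exact: differentiable_fst|exact: differentiable_cst].
  by apply: (smooth_diff sF); exact: bm.
have zp : \forall z \near q, 0 < F (z.1, X q + m) - z.2.
  move/cvgr_gt : (cF m mm); apply; rewrite /= -Fq subr_gt0.
  by apply: implicit_mono; [exact: (XP bq).1|exact: bm|rewrite ltrDl].
have zm : \forall z \near q, F (z.1, X q - m) - z.2 < 0.
  move/cvgr_lt : (cF (- m) mmN); apply; rewrite /= -Fq subr_lt0.
  by apply: implicit_mono; [exact: bm|exact: (XP bq).1|rewrite gtrDl oppr_lt0].
have zb : \forall z \near q, box q0 d z by apply: open_nbhs_nbhs; split=> //; exact: open_box.
near=> z.
have bz : box q0 d z by near: z.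
have tz : `|z.1 - p.1| < r by near: z.
have [Xz FXz] := XP bz.
split=> //; apply: lt_le_trans me.
have A : X z < X q + m.
  rewrite ltNge le_eqVlt; apply/negP => /orP[/eqP E|lt].
    have : 0 < F (z.1, X q + m) - z.2 by near: z.
    by rewrite E FXz subrr ltxx.
  have := implicit_mono (bm m z.1 mm tz) Xz lt; rewrite FXz ltNge => /negP; apply.
  by rewrite ltW// -subr_gt0; near: z.
have B : X q - m < X z.
  rewrite ltNge le_eqVlt; apply/negP => /orP[/eqP E|lt].
    have : F (z.1, X q - m) - z.2 < 0 by near: z.
    by rewrite -E FXz subrr ltxx.
  have := implicit_mono Xz (bm (- m) z.1 mmN tz) lt; rewrite FXz ltNge => /negP; apply.
  by rewrite ltW// -subr_lt0; near: z.
by rewrite ltr_norml; move: A B; lra.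
Unshelve. all: by end_near. Qed.

(** The formula comes from differentiating [F (t, X (t, y)) = y]. Continuity makes the expansion of
    [F] applicable to the increment of [X], and the Lipschitz bound turns its error into one in
    [|h|] alone. *)
Lemma implicit_diff q : box q0 d q -> differentiable X q /\
  forall v, 'D_v X q = (v.2 - v.1 * Dt F (q.1, X q)) * (Dx F (q.1, X q))^-1.
Proof.
move=> bq; have [bX FX] := XP bq.
pose a := Dt F (q.1, X q) : R; pose k := Dx F (q.1, X q) : R.
have k0 : 0 < k by exact: Fx_gt0.
pose df (v : plane R) : R^o := (v.2 - v.1 * a) * k^-1.
suff [dX dXE] : differentiable X q /\ 'd X q = df :> (plane R -> R^o).
  by split=> // v; rewrite deriveE// dXE.
apply: differentiable_approx.
- move=> c u v; rewrite /df.
  have -> : (c *: u + v).1 = c * u.1 + v.1 by [].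
  have -> : (c *: u + v).2 = c * u.2 + v.2 by [].
  rewrite -[RHS]/(c * ((u.2 - u.1 * a) * k^-1) + (v.2 - v.1 * a) * k^-1).
  by rewrite !mulrBl !mulrDl; move: (u.1) (u.2) (v.1) (v.2) => u1 u2 v1 v2; ring.
- move=> v; apply: differentiable_continuous.
  apply: (@differentiable_scale _ _ _ (fun v : plane R => v.2 - v.1 * a : R^o) (fun=> k^-1 : R^o)).
    apply: differentiableB; first exact: differentiable_snd.
    by apply: (@differentiable_scale _ _ _ _ (fun=> a : R^o)); [exact: differentiable_fst|exact: differentiable_cst].
  exact: differentiable_cst.
move=> e e0.
pose N := `|a| + 1; pose L := (2 * N + k) / k.
have N0 : 0 < N by rewrite /N ltr_wpDl.
have L0 : 0 < L by rewrite divr_gt0// addr_gt0// mulr_gt0.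
(* The bound [k / 2] gives the Lipschitz constant [L]; the other one turns the error [e' * (1 + L)]
   into at most [e * k]. *)
pose e' := Num.min (k / 2) (e * k / (1 + L)).
have e'0 : 0 < e' by rewrite lt_min !divr_gt0// ?mulr_gt0// addr_gt0.
have e'k : e' <= k / 2 by rewrite ge_min lexx.
have e'L : e' * (1 + L) <= e * k by rewrite -ler_pdivlMr ?addr_gt0// ge_min lexx orbT.
have /nbhs_ballP[s /= s0 Hs] := diff_approx (smooth_diff sF bX) e'0.
have N1 : \forall z \near q, box q s z /\ (box q0 d z /\ `|X z - X q| < s).
  near=> z; split; near: z; last exact: implicit_continuous.
  by apply: open_nbhs_nbhs; split; [exact: open_box|exact: box_center].
have N2 : \forall h \near (0 : plane R), box q s (h + q) /\ (box q0 d (h + q) /\ `|X (h + q) - X q| < s).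
  by have := N1; rewrite (near_shift 0) /= subr0.
apply: filterS N2 => h [[/= h1 _] [bh Xh]].
rewrite addrK in h1.
set y := X (h + q) - X q in Xh *.
have Ey : X (h + q) = y + X q by rewrite /y subrK.
have bs : ball (0 : plane R) s ((h.1, y) : plane R) by rewrite -box_ball; split; rewrite /= subr0.
have := Hs _ bs.
have -> : ((h.1, y) : plane R) + (q.1, X q) = ((h + q).1, X (h + q)) by rewrite Ey.
have [_ ->] := XP bh.
rewrite FX derive_plane; last exact: smooth_diff sF bX.
rewrite /= -/a -/k.
have -> : (h.1 *: (a : R^o)) + (y *: (k : R^o)) = h.1 * a + y * k by [].
have -> : h.2 + q.2 - q.2 - (h.1 * a + y * k) = - (k * (y - df h)).
  rewrite /df mulrBr mulrCA divff ?gt_eqF// mulr1; move: (h.1) (h.2) (q.2) => u1 u2 u3; ring.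
have nh1 : `|h.1| <= `|h| by rewrite /Num.norm /= le_max lexx.
have nh2 : `|h.2| <= `|h| by rewrite /Num.norm /= le_max lexx orbT.
rewrite normrN normrM (gtr0_norm k0) => H1.
have nm : `|((h.1, y) : plane R)| <= `|h| + `|y|.
  by rewrite {1}/Num.norm /= ge_max ler_wpDr//= ler_wpDl.
have H2 : k * `|y - df h| <= e' * (`|h| + `|y|).
  by apply: le_trans H1 _; rewrite ler_wpM2l// ltW.
have H3 : k * `|df h| <= N * `|h|.
  rewrite /df normrM normfV (gtr0_norm k0) mulrCA divff ?gt_eqF// mulr1 /N mulrDl mul1r [leRHS]addrC.
  apply: le_trans (ler_normB _ _) _; rewrite lerD// normrM mulrC.
  by rewrite ler_wpM2l.
have H4 : `|y| <= `|y - df h| + `|df h| by rewrite -{1}(subrK (df h) y) ler_normD.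
have H5 : `|y| <= L * `|h|.
  exact: (implicit_bound k0 (normr_ge0 h) (normr_ge0 y) e'k H2 H3 H4).
have H6 : k * `|y - df h| <= e' * ((1 + L) * `|h|).
  by apply: le_trans H2 _; rewrite ler_wpM2l ?(ltW e'0)// mulrDl mul1r lerD2l.
rewrite -(ler_pM2l k0) (le_trans H6)//.
by rewrite mulrA (mulrA k) (mulrC k) ler_wpM2r.
Unshelve. all: by end_near. Qed.

(** Bootstrap: a derivative of [X] is a smooth function [G] of [(t, X)], so each order of regularity
    of [X] gives the next one. *)
Lemma implicit_smooth : smooth_on (box q0 d) X.
Proof.
apply/smooth_Ck => n.
have ob : open (box q0 d) by exact: open_box.
have obp : open (box p r) by exact: open_box.
elim: n => [|n IH]; split=> //; try by move=> q /implicit_diff[].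
move=> v; pose G z : R^o := (v.2 - v.1 * Dt F z) * (Dx F z)^-1.
apply: (@Ck_on _ _ _ _ _ (fun q => G (q.1, X q))) => //.
  by move=> q /implicit_diff[_ ->].
apply: (@Ck_comp _ _ _ _ _ _ (box p r) G (fun q => (q.1, X q))) => //.
- exact: findim_plane.
- by move=> q /XP[].
- suff : smooth_on (box p r) G by move/smooth_Ck.
  apply: smooth_mul => //.
    apply: (@smooth_add _ _ _ _ (fun=> v.2) (fun z => - (v.1 * Dt F z))) => //; first exact: smooth_cst.
    apply: smooth_opp => //; apply: smooth_mul => //; first exact: smooth_cst.
    exact: smooth_derive.
  apply: smooth_inv => //; last exact: smooth_derive.
  by move=> z bz; rewrite gt_eqF// Fx_gt0.
- apply: Ck_pair => //; suff : smooth_on (box q0 d) (fun q : plane R => q.1 : R^o) by move/smooth_Ck.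
  exact: smooth_fst_plane.
Qed.

End ImplicitFun.

(** Existence of the solution [x] of [F (t, x) = y] is the intermediate value theorem on
    [[p.2 - s, p.2 + s]]; uniqueness is strict monotonicity in [x]. *)
Theorem implicit_function (p : plane R) (r : R) (F : plane R -> R^o) :
  0 < r -> smooth_on (box p r) F -> (forall q, box p r q -> 0 < (Dx F q : R)) ->
  exists (d : R) (X : plane R -> R^o),
    [/\ 0 < d, smooth_on (box (p.1, F p) d) X,
      forall q, box (p.1, F p) d q -> box p r (q.1, X q) /\ F (q.1, X q) = q.2 &
      forall q, box p r q -> box (p.1, F p) d (q.1, F q) -> X (q.1, F q) = q.2].
Proof.
move=> r0 sF F0; pose s := r / 2.
have s0 : 0 < s by rewrite divr_gt0.
have sr : s < r by rewrite /s; lra.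
have bs (t x : R) : `|t - p.1| < r -> `|x - p.2| <= s -> box p r (t, x).
  by move=> tr xs; split => //=; exact: le_lt_trans sr.
have bp : box p r (p.1, p.2) by apply: bs; rewrite subrr normr0// ltW.
have pE : F (p.1, p.2) = F p by case: (p).
have cmp (k : R) : `|k| <= s -> {for (p.1, p.2 + k), continuous F}.
  by move=> ks; apply: (smooth_cont sF); apply: bs; rewrite ?subrr ?normr0// addrAC subrr add0r.
have ss : `|s| <= s by rewrite gtr0_norm.
have ssN : `|- s| <= s by rewrite normrN gtr0_norm.
have bk (k t : R) : `|k| <= s -> `|t - p.1| < r -> box p r (t, p.2 + k).
  by move=> ks tr; apply: bs => //; rewrite addrAC subrr add0r.
have p1 : `|p.1 - p.1| < r by rewrite subrr normr0.
have g0 : 0 < F (p.1, p.2 + s) - F p.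
  by rewrite subr_gt0 -pE; apply: (implicit_mono sF F0) => //; [exact: bk|rewrite ltrDl].
have g1 : 0 < F p - F (p.1, p.2 - s).
  by rewrite subr_gt0 -pE; apply: (implicit_mono sF F0) => //; [exact: bk|rewrite gtrDl oppr_lt0].
(* Half of the smaller margin: the values at the two ends still differ from [F p] by more than [g]
   after a small change of [t]. *)
pose g := Num.min (F (p.1, p.2 + s) - F p) (F p - F (p.1, p.2 - s)) / 2.
have gg : 0 < g by rewrite divr_gt0// lt_min g0 g1.
have gs : 2 * g <= F (p.1, p.2 + s) - F p by rewrite /g mulrC divfK// ge_min lexx.
have gsN : 2 * g <= F p - F (p.1, p.2 - s) by rewrite /g mulrC divfK// ge_min lexx orbT.
have [d1 d10 H1] : exists2 d : R, 0 < d & forall z, box (p.1, p.2 + s) d z -> F p + g < F z.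
  have : \forall z \near ((p.1, p.2 + s) : plane R), F p + g < F z.
    by move/cvgr_gt : (cmp s ss); apply; move: gs gg; lra.
  by move=> /nbhs_ballP[d /= d0 H]; exists d => // z; rewrite box_ball; exact: H.
have [d2 d20 H2] : exists2 d : R, 0 < d & forall z, box (p.1, p.2 - s) d z -> F z < F p - g.
  have : \forall z \near ((p.1, p.2 - s) : plane R), F z < F p - g.
    by move/cvgr_lt : (cmp (- s) ssN); apply; move: gsN gg; lra.
  by move=> /nbhs_ballP[d /= d0 H]; exists d => // z; rewrite box_ball; exact: H.
pose d := Num.min r (Num.min g (Num.min d1 d2)).
have d0 : 0 < d by rewrite !lt_min r0 gg d10 d20.
have HX (q : plane R) : exists x : R^o, box (p.1, F p) d q -> box p r (q.1, x) /\ F (q.1, x) = q.2.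
  have [[/= b1 b2]|nb] := pselect (box (p.1, F p) d q); last by exists 0.
  move: b1 b2; rewrite !lt_min => /and4P[t1 _ t2 t3] /and4P[_ w1 _ _].
  have F1 : F p + g < F (q.1, p.2 + s) by apply: H1; split; rewrite /= ?subrr ?normr0.
  have F2 : F (q.1, p.2 - s) < F p - g by apply: H2; split; rewrite /= ?subrr ?normr0.
  have ab : p.2 - s <= p.2 + s by lra.
  have [||x xs Fx] := @IVT R (fun x => F (q.1, x)) (p.2 - s) (p.2 + s) q.2 ab.
  - apply: continuous_in_subspaceT => x; rewrite inE/= in_itv/= => xs.
    apply: (@continuous_comp _ _ _ (fun x : R => (q.1, x) : plane R) F).
      by apply: differentiable_continuous; apply: differentiable_pair.
    by apply: (smooth_cont sF); apply: bs => //; rewrite ler_norml; lra.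
  - have [/andP[w2 w3]] : - g < q.2 - F p < g by rewrite -ltr_norml.
    rewrite ge_min le_max; apply/andP; split; apply/orP; [left|right].
      by apply: ltW; apply: lt_trans F2 _; lra.
    by apply: ltW; apply: lt_trans F1; lra.
  exists x => _; split=> //; apply: bs => //.
  by move: xs; rewrite in_itv/= ler_norml; lra.
have [X XP] := choice HX.
exists d, X; split=> //; first exact: (implicit_smooth sF F0 XP).
move=> q bq bFq; have [/= bX FX] := XP _ bFq.
have bq' : box p r (q.1, q.2) by case: (q) bq.
have Fq : F (q.1, q.2) = F q by case: (q).
apply/eqP; rewrite eq_le !leNgt; apply/andP; split; apply/negP => lt.
- by have := implicit_mono sF F0 bq' bX lt; rewrite FX Fq ltxx.
- by have := implicit_mono sF F0 bX bq' lt; rewrite FX Fq ltxx.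
Qed.
End Implicit.

(** * Rules and tactics that compute derivatives *)

Section HasD.
Variable R : realType.
Implicit Types V W : normedModType R.

(** Smoothness is bundled with the value of the derivative because the product and chain rules need
    both. The tactic [hasD] composes the rules, and unification computes [f']. *)
Definition hasD V (U : set V) (v : V) (f f' : V -> R^o) : Prop :=
  smooth_on U f /\ forall p, U p -> 'D_v f p = f' p.

Lemma hasD_leaf V (U : set V) (v : V) (f : V -> R^o) : smooth_on U f -> hasD U v f ('D_v f).
Proof. by []. Qed.

Lemma hasD_cst V (U : set V) (v : V) (c : R^o) : hasD U v (fun=> c) (fun=> 0).
Proof. by split=> [|p _]; [exact: smooth_cst|rewrite derive_cst]. Qed.

Lemma hasD_add V (U : set V) (v : V) (f g f' g' : V -> R^o) : open U ->
  hasD U v f f' -> hasD U v g g' -> hasD U v (fun q => f q + g q) (fun q => f' q + g' q).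
Proof.
move=> oU [sf ef] [sg eg]; split=> [|p Up]; first exact: smooth_add.
rewrite -ef// -eg//; apply: deriveD; apply: diff_derivable; exact: smooth_diff Up.
Qed.

Lemma hasD_opp V (U : set V) (v : V) (f f' : V -> R^o) : open U ->
  hasD U v f f' -> hasD U v (fun q => - f q) (fun q => - f' q).
Proof.
move=> oU [sf ef]; split=> [|p Up]; first exact: smooth_opp.
rewrite -ef//; apply: deriveN; apply: diff_derivable; exact: smooth_diff Up.
Qed.

Lemma hasD_mul V (U : set V) (v : V) (f g f' g' : V -> R^o) : open U ->
  hasD U v f f' -> hasD U v g g' ->
  hasD U v (fun q => f q * g q) (fun q => f' q * g q + f q * g' q).
Proof.
move=> oU [sf ef] [sg eg]; split=> [|p Up]; first exact: smooth_mul.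
rewrite -ef// -eg// addrC.
exact: (derive_scale v (smooth_diff sf Up) (smooth_diff sg Up)).
Qed.

Lemma hasD_inv V (U : set V) (v : V) (f f' : V -> R^o) : open U ->
  (forall p, U p -> f p != 0) ->
  hasD U v f f' -> hasD U v (fun q => (f q)^-1) (fun q => - f' q * (f q)^-1 * (f q)^-1).
Proof.
move=> oU f0 [sf ef]; split=> [|p Up]; first exact: smooth_inv.
rewrite [LHS]deriveV//; last by apply: diff_derivable; exact: smooth_diff Up.
  by rewrite ef// /GRing.scale /=; field; exact: f0.
exact: f0.
Qed.

Lemma hasD_exp V (U : set V) (v : V) (f f' : V -> R^o) : open U ->
  hasD U v f f' -> hasD U v (fun q => expR (f q)) (fun q => expR (f q) * f' q).
Proof.
move=> oU [sf ef]; split=> [|p Up]; first exact: smooth_exp.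
have dE : differentiable (expR : R^o -> R^o) (f p) by apply/derivable1_diffP.
rewrite (derive_comp v (smooth_diff sf Up) dE) ef//.
have E : f' p = (f' p : R) *: (1 : R^o) by rewrite [RHS]mulr1.
rewrite [in LHS]E derive_dirZ// derive_val mulrC.
by [].
Qed.

Lemma hasD_comp V1 V2 (U1 : set V1) (U2 : set V2) (v : V1) (g : V2 -> R^o) (f : V1 -> V2) :
  findim V2 -> open U1 -> (forall p, U1 p -> U2 (f p)) ->
  smooth_on U2 g -> smooth_on U1 f ->
  hasD U1 v (fun q => g (f q)) (fun q => 'D_('D_v f q) g (f q)).
Proof.
move=> fV oU1 Uf sg sf; split; first exact: smooth_comp fV oU1 Uf sg sf.
by move=> p Up; apply: derive_comp; [exact: smooth_diff Up|exact: smooth_diff (Uf _ Up)].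
Qed.

Lemma smooth_Dx (U : set (plane R)) (f : plane R -> R^o) : smooth_on U f -> smooth_on U (Dx f).
Proof. exact: smooth_derive. Qed.

Lemma smooth_Dt (U : set (plane R)) (f : plane R -> R^o) : smooth_on U f -> smooth_on U (Dt f).
Proof. exact: smooth_derive. Qed.

Lemma hasD_leafx (U : set (plane R)) (f : plane R -> R^o) : smooth_on U f ->
  hasD U ((0, 1) : plane R) f (Dx f).
Proof. by []. Qed.

Lemma hasD_leaft (U : set (plane R)) (f : plane R -> R^o) : smooth_on U f ->
  hasD U ((1, 0) : plane R) f (Dt f).
Proof. by []. Qed.

Lemma hasD_fst (U : set (plane R)) (v : plane R) : open U ->
  hasD U v (fun q : plane R => q.1 : R^o) (fun=> v.1).
Proof.
move=> oU; split=> [|p _]; first exact: smooth_fst_plane.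
by rewrite derive_fst.
Qed.

Lemma hasD_snd (U : set (plane R)) (v : plane R) : open U ->
  hasD U v (fun q : plane R => q.2 : R^o) (fun=> v.2).
Proof.
move=> oU; split=> [|p _]; first exact: smooth_snd_plane.
by rewrite derive_snd.
Qed.

Lemma Dt_hasD (U : set (plane R)) (f f' : plane R -> R^o) p :
  hasD U ((1, 0) : plane R) f f' -> U p -> Dt f p = f' p.
Proof. by case=> _; exact. Qed.

Lemma Dx_hasD (U : set (plane R)) (f f' : plane R -> R^o) p :
  hasD U ((0, 1) : plane R) f f' -> U p -> Dx f p = f' p.
Proof. by case=> _; exact. Qed.

Lemma DtDx_comm (U : set (plane R)) (f : plane R -> R^o) p : open U -> smooth_on U f -> U p ->
  Dx (Dt f) p = Dt (Dx f) p.
Proof. by move=> oU sf Up; exact: schwarz oU Up sf. Qed.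

Lemma DtE W (f : plane R -> W) p : Dt f p = 'D_((1, 0) : plane R) f p.
Proof. by []. Qed.

Lemma DxE W (f : plane R -> W) p : Dx f p = 'D_((0, 1) : plane R) f p.
Proof. by []. Qed.

Lemma Dx_on (U : set (plane R)) (f g : plane R -> R^o) p : open U -> U p ->
  (forall q, U q -> f q = g q) -> Dx f p = Dx g p.
Proof. exact: derive_on. Qed.

Lemma Dt_on (U : set (plane R)) (f g : plane R -> R^o) p : open U -> U p ->
  (forall q, U q -> f q = g q) -> Dt f p = Dt g p.
Proof. exact: derive_on. Qed.
End HasD.

Ltac smooth :=
  lazymatch goal with
  | |- open _ => assumption
  | |- smooth_on _ _ =>
    first
      [ lazymatch goal with
        | H : smooth_on ?U ?f |- smooth_on ?U ?f => exact H
        | H : smooth_on ?U ?f |- smooth_on ?U (fun q => ?f q) => exact H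
        end
      | lazymatch goal with
        | |- smooth_on _ (fun=> ?c) => refine (@smooth_cst _ _ _ _ c)
        | |- smooth_on _ (@fst _ _) => apply: smooth_fst_plane; smooth
        | |- smooth_on _ (@snd _ _) => apply: smooth_snd_plane; smooth
        | |- smooth_on _ (Dx _) => apply: smooth_Dx; smooth
        | |- smooth_on _ (Dt _) => apply: smooth_Dt; smooth
        | |- smooth_on _ (fun q => Dx ?f q) => refine (@smooth_Dx _ _ f _); smooth
        | |- smooth_on _ (fun q => Dt ?f q) => refine (@smooth_Dt _ _ f _); smooth
        | |- smooth_on _ (fun q => (fst q)) => apply: smooth_fst_plane; smooth
        | |- smooth_on _ (fun q => (snd q)) => apply: smooth_snd_plane; smooth
        | |- smooth_on _ (fun q => @?f q + @?g q) => refine (@smooth_add _ _ _ _ f g _ _ _); smooth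
        | |- smooth_on _ (fun q => - (@?f q)) => refine (@smooth_opp _ _ _ f _ _); smooth
        | |- smooth_on _ (fun q => @?f q * @?g q) => refine (@smooth_mul _ _ _ f g _ _ _); smooth
        | |- smooth_on _ (fun q => (@?f q)^-1) => refine (@smooth_inv _ _ _ f _ _ _); smooth
        | |- smooth_on _ (fun q => expR (@?f q)) => refine (@smooth_exp _ _ _ f _ _); smooth
        | _ => idtac
        end ]
  | _ => try assumption
  end.

Ltac eta_reduce f := lazymatch f with (fun x => ?h x) => h | _ => f end.

Ltac hasD :=
  lazymatch goal with
  | |- hasD _ _ (fun=> ?c) _ => refine (hasD_cst _ _ c)
  | |- hasD _ _ (@fst _ _) _ => refine (hasD_fst _ _); assumption
  | |- hasD _ _ (@snd _ _) _ => refine (hasD_snd _ _); assumption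
  | |- hasD _ _ (fun q => @?f q + @?g q) _ => let f := eta_reduce f in let g := eta_reduce g in
    refine (@hasD_add _ _ _ _ f g _ _ _ _ _); hasD
  | |- hasD _ _ (fun q => - (@?f q)) _ => let f := eta_reduce f in refine (@hasD_opp _ _ _ _ f _ _ _); hasD
  | |- hasD _ _ (fun q => @?f q * @?g q) _ => let f := eta_reduce f in let g := eta_reduce g in
    refine (@hasD_mul _ _ _ _ f g _ _ _ _ _); hasD
  | |- hasD _ _ (fun q => (@?f q)^-1) _ => let f := eta_reduce f in refine (@hasD_inv _ _ _ _ f _ _ _ _); hasD
  | |- hasD _ _ (fun q => expR (@?f q)) _ => let f := eta_reduce f in refine (@hasD_exp _ _ _ _ f _ _ _); hasD
  | |- hasD _ _ (fun q => (fst q)) _ => refine (hasD_fst _ _); assumption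
  | |- hasD _ _ (fun q => (snd q)) _ => refine (hasD_snd _ _); assumption
  | H : hasD ?U ?v ?f _ |- hasD ?U ?v ?f _ => exact H
  | |- hasD _ ((0, 1) : plane _) _ _ => refine (hasD_leafx _); smooth
  | |- hasD _ ((1, 0) : plane _) _ _ => refine (hasD_leaft _); smooth
  | |- hasD _ _ _ _ => refine (hasD_leaf _ _); smooth
  | |- _ => smooth
  end.

(** The right side of the equation is left open and is filled in by the rules that [hasD]
    applies. *)
Ltac derive_at H e Up :=
  eassert (H : e = _) by (lazymatch e with
     | Dx _ _ => refine (Dx_hasD _ Up)
     | Dt _ _ => refine (Dt_hasD _ Up)
     end; hasD);
  cbv beta in H.

(** * Straightening two commuting fields *)

Section Straighten.
Variable R : realType.
Implicit Types V W : normedModType R.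

Lemma const_line V (U : set V) (f : V -> R^o) (p v : V) (h : R) : smooth_on U f ->
  (forall q, U q -> 'D_v f q = 0) -> (forall s : R, `|s| <= `|h| -> U (p + s *: v)) ->
  f (p + h *: v) = f p.
Proof.
move=> sf f0 Us.
have [s sh] := @mvt_line_derivable _ _ f p v h (fun s sh => diff_derivable (smooth_diff sf (Us s sh))).
by rewrite f0 ?mul0r; [move/eqP; rewrite subr_eq0 => /eqP|exact: Us].
Qed.

Lemma const_x (p q : plane R) (r : R) (f : plane R -> R^o) : smooth_on (box p r) f ->
  (forall q, box p r q -> Dx f q = 0) -> box p r q -> f q = f (q.1, p.2).
Proof.
move=> sf f0; case: q => t x [/= tr xr].
have e : ((t, p.2) : plane R) + (x - p.2) *: ((0, 1) : plane R) = (t, x).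
  by apply/pair_equal_spec; split=> /=; rewrite ?scaler0 ?addr0// [_ *: 1]mulr1 addrC subrK.
rewrite -e; apply: (const_line sf f0) => s sx; split => /=; rewrite ?scaler0 ?addr0//.
by rewrite [_ *: 1]mulr1 addrAC subrr add0r; exact: le_lt_trans xr.
Qed.

Lemma smooth_swap (U : set (plane R)) : open U -> smooth_on U (fun q : plane R => (q.2, q.1) : plane R).
Proof. by move=> oU; apply: smooth_pair => //; [exact: smooth_snd_plane|exact: smooth_fst_plane]. Qed.

Lemma derive_swap (q v : plane R) : 'D_v (fun q : plane R => (q.2, q.1) : plane R) q = (v.2, v.1).
Proof.
rewrite derive_pair; [|exact: differentiable_snd|exact: differentiable_fst].
rewrite derive_snd.
by rewrite derive_fst.
Qed.

Lemma primitive_t p (r s : R) (f : plane R -> R^o) : 0 < s -> s < r -> smooth_on (box p r) f ->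
  exists P : plane R -> R^o, smooth_on (box p s) P /\ forall q, box p s q -> Dt P q = f q.
Proof.
move=> s0 sr sf; pose p' : plane R := (p.2, p.1).
have sw r' q : box p' r' q -> box p r' (q.2, q.1) by move=> -[/= a b]; split.
have sw' r' q : box p r' q -> box p' r' (q.2, q.1) by move=> -[/= a b]; split.
have ob := @open_box R.
have [P [sP Px _]] := @primitive_x R p' r s (fun q => f (q.2, q.1)) s0 sr
  (smooth_comp (findim_plane R) (ob p' r) (sw r) sf (smooth_swap (ob p' r))).
have sP' := smooth_comp (findim_plane R) (ob p s) (sw' s) sP (smooth_swap (ob p s)).
exists (fun q => P (q.2, q.1)); split=> // q bq.
rewrite /Dt derive_comp; last 2 first.
- exact: smooth_diff (smooth_swap (ob p s)) bq.
- exact: smooth_diff sP (sw' _ _ bq).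
rewrite derive_swap /= -[LHS]/(Dx P (q.2, q.1)) Px; last exact: sw'.
by case: (q).
Qed.

(** The Poincare lemma on a box. If [P] is an x-primitive of [b], closedness makes [a - Dt P]
    independent of [x], so a t-primitive of it corrects [P]. *)
Lemma potential p (r s : R) (a b : plane R -> R^o) : 0 < s -> s < r ->
  smooth_on (box p r) a -> smooth_on (box p r) b ->
  (forall q, box p r q -> Dx a q = Dt b q) ->
  exists W : plane R -> R^o, [/\ smooth_on (box p s) W,
    forall q, box p s q -> Dt W q = a q & forall q, box p s q -> Dx W q = b q].
Proof.
move=> s0 sr sa sb ab.
(* Each of the two quadratures costs part of the radius. *)
pose m := (s + r) / 2.
have sm : s < m by rewrite /m; lra.
have mr : m < r by rewrite /m; lra.
have m0 : 0 < m by exact: lt_trans sm.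
have [P [sP Px _]] := primitive_x m0 mr sb.
have ob := @open_box R p.
have obm := ob m; have obs := ob s.
have bmr : box p m `<=` box p r by apply: box_sub; exact: ltW.
have bsm : box p s `<=` box p m by apply: box_sub; exact: ltW.
have sam := smooth_sub bmr sa.
pose h q : R^o := a q - Dt P q.
have sh : smooth_on (box p m) h by rewrite /h; smooth.
have hx q : box p m q -> Dx h q = 0.
  move=> bq; derive_at H (Dx (fun q => a q - Dt P q) q) bq.
  by rewrite [LHS]H (DtDx_comm obm sP bq) (Dt_on obm bq Px) ab ?subrr//; exact: bmr.
have [c [sc ct]] := primitive_t s0 sm sh.
(* Freezing [x] at [p.2] makes the correction a function of [t] alone, so that it leaves the
   x-derivative of [P] unchanged. *)
pose pr (q : plane R) : plane R := (q.1, p.2).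
have prP q : box p s q -> box p s (pr q) by move=> [q1 _]; split=> //=; rewrite subrr normr0.
have spr : smooth_on (box p s) pr.
  by apply: smooth_pair => //; [exact: smooth_fst_plane|exact: smooth_cst].
have dpr v q : 'D_v pr q = (v.1, 0).
  rewrite derive_pair; [|exact: differentiable_fst|exact: differentiable_cst].
  rewrite derive_fst.
  by rewrite derive_cst.
have Hcp v := hasD_comp v (findim_plane R) obs prP sc spr.
have scp := (Hcp 0).1; have Dcp v := (Hcp v).2.
have sP' := smooth_sub bsm sP.
exists (fun q => P q + c (pr q)); split=> [|q bq|q bq]; first by smooth; exact: scp.
- have Hc : hasD (box p s) ((1, 0) : plane R) (fun q => c (pr q)) h.
    split=> [|z bz]; first exact: scp.
    rewrite Dcp// dpr -[LHS]/(Dt c (pr z)) ct; last exact: prP.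
    by rewrite [RHS](const_x sh hx)//; exact: bsm.
  derive_at H (Dt (fun q => P q + c (pr q)) q) bq.
  by rewrite H /h addrC subrK.
- have Hc : hasD (box p s) ((0, 1) : plane R) (fun q => c (pr q)) (fun=> 0).
    split=> [|z bz]; first exact: scp.
    by rewrite Dcp// dpr derive0.
  derive_at H (Dx (fun q => P q + c (pr q)) q) bq.
  by rewrite H addr0 Px//; exact: bsm.
Qed.

Lemma open_preimage_on V W (U : set V) (S : set W) (f : V -> W) : open U -> open S ->
  (forall q, U q -> {for q, continuous f}) -> open [set q | U q /\ S (f q)].
Proof.
move=> oU oS cf; rewrite openE => q [Uq Sq].
have NS : \forall z \near q, S (f z) by apply: (cf q Uq); exact: open_nbhs_nbhs.
have NU : \forall z \near q, U z by exact: open_nbhs_nbhs.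
by near=> z; split; near: z.
Unshelve. all: by end_near. Qed.

Definition chart (V : set (plane R)) (T W : plane R -> R^o) (z0 : plane R) (d : R)
    (Z : plane R -> plane R) : Prop :=
  [/\ smooth_on (box z0 d) Z,
    forall q, V q -> box z0 d (T q, W q) /\ Z (T q, W q) = q &
    forall z, box z0 d z -> V (Z z) /\ (T (Z z), W (Z z)) = z].

(** As [T] depends on [t] only, the map [(T, W)] is triangular: solve [T] for [t], then [W] at that
    [t] for [x]. Two implicit functions of one unknown give the inverse. *)
Lemma chart_exists (p : plane R) (r : R) (T W : plane R -> R^o) : 0 < r ->
  smooth_on (box p r) T -> smooth_on (box p r) W ->
  (forall q, box p r q -> [/\ 0 < (Dt T q : R), Dx T q = 0 & 0 < (Dx W q : R)]) ->
  exists (d : R) (V : set (plane R)) (Z : plane R -> plane R),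
    [/\ 0 < d, open V, V p, V `<=` box p r & chart V T W (T p, W p) d Z].
Proof.
move=> r0 sT sW TW.
have ob := @open_box R.
have hTx q : box p r q -> Dx T q = 0 by move=> /TW[].
have [d1 [X [d10 sX XP Xinv]]] := implicit_function r0 sW (fun q bq => let: And3 _ _ x := TW q bq in x).
pose r2 := Num.min r d1.
have r20 : 0 < r2 by rewrite lt_min r0 d10.
have r2r : r2 <= r by rewrite ge_min lexx.
have r2d : r2 <= d1 by rewrite ge_min lexx orbT.
(* [implicit_function] solves for the second coordinate, so [TT] carries [t] there; its first
   coordinate is a dummy centred at [p.1]. *)
pose pc : plane R := (p.1, p.1).
pose sw (q : plane R) : plane R := (q.2, p.2).
have swP q : box pc r2 q -> box p r (sw q).
  by move=> [_ q2]; split; [exact: lt_le_trans r2r|rewrite /= subrr normr0].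
have ssw : smooth_on (box pc r2) sw.
  by apply: smooth_pair => //; [exact: smooth_snd_plane|exact: smooth_cst].
pose TT q : R^o := T (sw q).
have HTT v := hasD_comp v (findim_plane R) (ob pc r2) swP sT ssw.
have sTT := (HTT 0).1; have DTT v := (HTT v).2.
have TT0 q : box pc r2 q -> 0 < (Dx TT q : R).
  move=> bq; have := DTT (0, 1) q bq; rewrite -[X in X = _]/(Dx TT q) => ->.
  have -> : 'D_((0, 1) : plane R) sw q = (1, 0).
    rewrite derive_pair; [|exact: differentiable_snd|exact: differentiable_cst].
    rewrite derive_snd.
    by rewrite derive_cst.
  by have [] := TW _ (swP _ bq).
have [d2 [Th [d20 sTh ThP Thinv]]] := implicit_function r20 sTT TT0.
have pcE : (pc.1, TT pc) = (p.1, T p) by rewrite /TT /sw /pc /=; case: (p).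
rewrite pcE in sTh ThP Thinv.
pose d := Num.min d1 d2.
have d0 : 0 < d by rewrite lt_min d10 d20.
have dd1 : d <= d1 by rewrite ge_min lexx.
have dd2 : d <= d2 by rewrite ge_min lexx orbT.
have p11 : `|p.1 - p.1| < d2 by rewrite subrr normr0.
pose th (z : plane R) : R^o := Th (p.1, z.1).
pose z0 : plane R := (T p, W p).
have b2 z : box z0 d z -> box (p.1, T p) d2 (p.1, z.1).
  by move=> [z1 _]; split=> //=; exact: lt_le_trans dd2.
have sth : smooth_on (box z0 d) th.
  apply: (smooth_comp (findim_plane R) (ob z0 d) b2 sTh).
  by apply: smooth_pair => //; [exact: smooth_cst|exact: smooth_fst_plane].
have thP z : box z0 d z -> `|th z - p.1| < r2 /\ T (th z, p.2) = z.1.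
  by move=> /b2/ThP[[_ b] e]; split.
have b1 z : box z0 d z -> box (p.1, W p) d1 (th z, z.2).
  by move=> bz; have [t1 _] := thP z bz; split; [exact: lt_le_trans r2d|exact: lt_le_trans bz.2 dd1].
pose Z z : plane R := (th z, X (th z, z.2)).
have sZ : smooth_on (box z0 d) Z.
  apply: smooth_pair => //; apply: (smooth_comp (findim_plane R) (ob z0 d) b1 sX).
  by apply: smooth_pair => //; exact: smooth_snd_plane.
(* The second condition is [|q.1 - p.1| < r2], written as a box with a dummy second coordinate. *)
pose B2 : set (plane R) := [set q | box p r q /\ box (p.1, 0) r2 (q.1, 0)].
pose V : set (plane R) := [set q | B2 q /\ box z0 d (T q, W q)].
have oB2 : open B2.
  apply: (@open_preimage_on _ _ _ _ (fun q : plane R => (q.1, 0) : plane R)) => // q _.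
  by apply: differentiable_continuous; apply: differentiable_pair; [exact: differentiable_fst|exact: differentiable_cst].
have oV : open V.
  apply: (@open_preimage_on _ _ _ _ (fun q : plane R => (T q, W q) : plane R)) => // q [bq _].
  by apply: differentiable_continuous; apply: differentiable_pair; [exact: smooth_diff sT bq|exact: smooth_diff sW bq].
exists d, V, Z; split=> //.
- split; last exact: box_center.
  by split; [exact: box_center|split; rewrite /= subrr normr0].
- by move=> q [[]].
split=> // [q [[bq bq1] bz]|z bz].
- split=> //; have Tq : T q = T (q.1, p.2) by exact: (const_x sT hTx bq).
  have E : th (T q, W q) = q.1.
    rewrite /th /= Tq; apply: (Thinv (p.1, q.1)).
      by split; [rewrite /= subrr normr0|exact: bq1.1].
    by split; [exact: p11|rewrite /= /TT /sw -Tq; exact: lt_le_trans bz.1 dd2].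
  rewrite /Z E /= Xinv//; first by case: (q).
  by split; [exact: lt_le_trans bq1.1 r2d|exact: lt_le_trans bz.2 dd1].
- have [t1 Tt] := thP z bz; have [bX WX] := XP _ (b1 z bz).
  have TE : T (Z z) = z.1.
    by rewrite -Tt (const_x sT hTx bX).
  have ZE : (T (Z z), W (Z z)) = z by rewrite TE WX /=; case: (z).
  split=> //; split; last by rewrite ZE.
  by split=> //; split=> //=; rewrite subrr normr0.
Qed.

End Straighten.

(** * The straightened fields in their chart *)

Section StraightenedField.
Variable R : realType.

(* [T] and [W] straighten the commuting vector fields [tau (d_t + g1 d_x)] and
   [xi d_x] to the coordinate fields. *)
Record straightened (tau xi g1 : plane R -> R^o) (V : set (plane R))
    (T W : plane R -> R^o) (z0 : plane R) (d : R) (Z : plane R -> plane R) : Prop := Straightened {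
  st_open : open V;
  st_tau : smooth_on V tau;
  st_xi : smooth_on V xi;
  st_g1 : smooth_on V g1;
  st_T : smooth_on V T;
  st_W : smooth_on V W;
  st_tau0 : forall q, V q -> tau q != 0;
  st_xi0 : forall q, V q -> xi q != 0;
  st_Tt : forall q, V q -> Dt T q = (tau q)^-1;
  st_Tx : forall q, V q -> Dx T q = 0;
  st_Wt : forall q, V q -> Dt W q = - g1 q * (xi q)^-1;
  st_Wx : forall q, V q -> Dx W q = (xi q)^-1;
  st_chart : chart V T W z0 d Z }.

(** Potentials of the two forms dual to the fields: [dt / tau] is closed because [tau] is
    independent of [x], and [(dx - g1 dt) / xi] is closed by the commutation identity
    [xi g1_x = xi_t + xi_x g1]. *)
Lemma straightened_exists (p : plane R) (U : set (plane R)) (tau xi g1 : plane R -> R^o) :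
  open U -> U p -> smooth_on U tau -> smooth_on U xi -> smooth_on U g1 ->
  (forall q, U q -> 0 < (tau q : R)) -> (forall q, U q -> 0 < (xi q : R)) ->
  (forall q, U q -> Dx tau q = 0) ->
  (forall q, U q -> xi q * Dx g1 q = Dt xi q + Dx xi q * g1 q) ->
  exists (V : set (plane R)) (T W : plane R -> R^o) (d : R) (Z : plane R -> plane R),
    [/\ 0 < d, V p, V `<=` U & straightened tau xi g1 V T W (T p, W p) d Z].
Proof.
move=> oU Up stau sxi sg1 tau0 xi0 taux comm.
have [r r0 brU] := open_box_sub oU Up.
have obr : open (box p r) by exact: open_box.
pose s := r / 2.
have s0 : 0 < s by rewrite divr_gt0.
have sr : s < r by rewrite /s; lra.
have bsr : box p s `<=` box p r by apply: box_sub; exact: ltW.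
have {}stau := smooth_sub brU stau.
have {}sxi := smooth_sub brU sxi.
have {}sg1 := smooth_sub brU sg1.
have ntau q : box p r q -> tau q != 0 by move=> /brU/tau0; exact: lt0r_neq0.
have nxi q : box p r q -> xi q != 0 by move=> /brU/xi0; exact: lt0r_neq0.
have [T [sT Tt Tx]] : exists T : plane R -> R^o, [/\ smooth_on (box p s) T,
    forall q, box p s q -> Dt T q = (tau q)^-1 & forall q, box p s q -> Dx T q = 0].
  apply: (potential s0 sr (a := fun q => (tau q)^-1) (b := fun=> 0)); try by smooth.
  move=> q bq; derive_at H (Dx (fun q => (tau q)^-1) q) bq.
  by rewrite H taux ?oppr0 ?mul0r; [rewrite [RHS]derive_cst|exact: brU].
have [W [sW Wt Wx]] : exists W : plane R -> R^o, [/\ smooth_on (box p s) W,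
    forall q, box p s q -> Dt W q = - g1 q * (xi q)^-1 &
    forall q, box p s q -> Dx W q = (xi q)^-1].
  apply: (potential s0 sr (a := fun q => - g1 q * (xi q)^-1) (b := fun q => (xi q)^-1)); try by smooth.
  move=> q bq; derive_at H (Dx (fun q => - g1 q * (xi q)^-1) q) bq.
  derive_at H0 (Dt (fun q : plane R => (xi q)^-1) q) bq.
  have E : Dt xi q = xi q * Dx g1 q - Dx xi q * g1 q by rewrite comm ?addrK//; exact: brU.
  by rewrite H H0 E; field; exact: nxi.
have [q bq|d [V [Z [d0 oV Vp VB ch]]]] := chart_exists s0 sT sW.
  rewrite Tt// Tx// Wx//; split=> //; rewrite invr_gt0; [apply: tau0|apply: xi0]; exact/brU/bsr.
have VBr : V `<=` box p r := subset_trans VB bsr.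
exists V, T, W, d, Z; split=> //; first exact: subset_trans VBr brU.
split=> //; try by [apply: smooth_sub sT|apply: smooth_sub sW|apply: smooth_sub stau|
  apply: smooth_sub sxi|apply: smooth_sub sg1|move=> q /VBr; exact: ntau|
  move=> q /VBr; exact: nxi|move=> q /VB; exact: Tt|move=> q /VB; exact: Tx|
  move=> q /VB; exact: Wt|move=> q /VB; exact: Wx].
Qed.

Section Field.
Variables (tau xi g1 : plane R -> R^o) (V : set (plane R)) (T W : plane R -> R^o).
Variables (z0 : plane R) (d : R) (Z : plane R -> plane R).
Hypothesis st : straightened tau xi g1 V T W z0 d Z.

(** A primitive taken in the chart exists only over a smaller box; this is the matching part of [V],
    over which the chart is still bijective. *)
Definition chart_part (d' : R) : set (plane R) := [set q | V q /\ box z0 d' (T q, W q)].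

Lemma smooth_TW : smooth_on V (fun q => (T q, W q) : plane R).
Proof. by case: st => *; exact: smooth_pair. Qed.

Lemma open_chart_part d' : open (chart_part d').
Proof.
apply: (@open_preimage_on R _ _ V (box z0 d') (fun q => (T q, W q) : plane R)); first exact: st_open st.
  exact: open_box.
by move=> q Vq; exact: (smooth_cont smooth_TW Vq).
Qed.

Lemma straightened_part (d' : R) : d' <= d ->
  straightened tau xi g1 (chart_part d') T W z0 d' Z.
Proof.
move=> dd; have sub : chart_part d' `<=` V by move=> q [].
have bd : box z0 d' `<=` box z0 d by exact: box_sub.
case: st => oV stau sxi sg1 sT sW tau0 xi0 Tt Tx Wt Wx [sZ ch1 ch2].
split; try by [exact: open_chart_part|apply: smooth_sub stau|apply: smooth_sub sxi|
  apply: smooth_sub sg1|apply: smooth_sub sT|apply: smooth_sub sW|move=> q /sub; exact: tau0|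
  move=> q /sub; exact: xi0|move=> q /sub; exact: Tt|move=> q /sub; exact: Tx|
  move=> q /sub; exact: Wt|move=> q /sub; exact: Wx].
split=> [|q [Vq bq]|z bz]; first exact: smooth_sub sZ.
- by split=> //; have [] := ch1 q Vq.
- by have [VZ ZE] := ch2 z (bd z bz); split=> //; split=> //; rewrite ZE.
Qed.

(** Differentiate [T (Z z) = z.1] and [W (Z z) = z.2] and solve the triangular system. The result
    says that [Z] carries the coordinate fields to [tau (d_t + g1 d_x)] and [xi d_x]. *)
Lemma straightened_dZ z v : box z0 d z ->
  'D_v Z z = (v.1 * tau (Z z), v.1 * tau (Z z) * g1 (Z z) + v.2 * xi (Z z)).
Proof.
case: st => oV stau sxi sg1 sT sW tau0 xi0 Tt Tx Wt Wx [sZ ch1 ch2] bz.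
have [VZ _] := ch2 z bz.
have ob : open (box z0 d) by exact: open_box.
have dZ := smooth_diff sZ bz.
have ET : 'D_('D_v Z z) T (Z z) = v.1.
  rewrite -(derive_comp v dZ (smooth_diff sT VZ)) -[RHS]((hasD_fst v ob).2 z bz).
  by apply: derive_on ob bz _ => q /ch2[_ E]; rewrite -[in RHS]E.
have EW : 'D_('D_v Z z) W (Z z) = v.2.
  rewrite -(derive_comp v dZ (smooth_diff sW VZ)) -[RHS]((hasD_snd v ob).2 z bz).
  by apply: derive_on ob bz _ => q /ch2[_ E]; rewrite -[in RHS]E.
have t0 := tau0 _ VZ; have x0 := xi0 _ VZ.
move: ET EW; rewrite (derive_plane _ (smooth_diff sT VZ)) (derive_plane _ (smooth_diff sW VZ)).
rewrite Tt// Tx// Wt// Wx//.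
case: ('D_v Z z) => a b /=; rewrite /GRing.scale /= mulr0 addr0 => Ea Eb.
have {}Ea : a = v.1 * tau (Z z) by rewrite -Ea mulfVK.
apply/pair_equal_spec; split=> //.
by rewrite -Eb -Ea; field.
Qed.

Lemma derive_chart (f : plane R -> R^o) z v : smooth_on V f -> box z0 d z ->
  'D_v (fun z => f (Z z)) z =
    v.1 * (tau (Z z) * (Dt f (Z z) + g1 (Z z) * Dx f (Z z))) + v.2 * (xi (Z z) * Dx f (Z z)).
Proof.
move=> sf bz; have [_ _ ch2] := st_chart st; have [VZ _] := ch2 z bz.
have [sZ _ _] := st_chart st.
rewrite (derive_comp v (smooth_diff sZ bz) (smooth_diff sf VZ)) straightened_dZ//.
rewrite derive_plane /=; last exact: smooth_diff sf VZ.
rewrite /GRing.scale /=; move: (v.1) (v.2) => a b; ring.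
Qed.

(** In the chart such an [f] has zero T-derivative. Both points are joined to the central value
    [z0.1] of T inside the box, so the common value depends on W only. *)
Lemma chart_const (f : plane R -> R^o) z z' : smooth_on V f ->
  (forall q, V q -> Dt f q + g1 q * Dx f q = 0) -> box z0 d z -> box z0 d z' -> z.2 = z'.2 ->
  f (Z z) = f (Z z').
Proof.
move=> sf f0 bz bz' zz'; have [sZ _ ch2] := st_chart st.
have ob : open (box z0 d) by exact: open_box.
have sfZ : smooth_on (box z0 d) (fun z => f (Z z)).
  by apply: (smooth_comp (findim_plane R) ob _ sf sZ) => q /ch2[].
suff base w : box z0 d w -> f (Z w) = f (Z (z0.1, w.2)) by rewrite base// [RHS]base// zz'.
move=> [w1 w2].
have e : ((z0.1, w.2) : plane R) + (w.1 - z0.1) *: ((1, 0) : plane R) = w.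
  rewrite [RHS](_ : w = (w.1, w.2)); last by case: (w).
  by apply/pair_equal_spec; split=> /=; rewrite ?scaler0 ?addr0// [_ *: 1]mulr1 addrC subrK.
rewrite -[in LHS]e; apply: (const_line sfZ) => [q bq|s sw].
  by rewrite derive_chart// f0 ?mulr0 ?mul0r ?addr0//; have [] := ch2 q bq.
split => /=; rewrite ?scaler0 ?addr0//.
by rewrite [_ *: 1]mulr1 addrAC subrr add0r; exact: le_lt_trans w1.
Qed.

(** In the chart [d_t + g1 d_x] is the T-derivative divided by [tau], so this transport equation is
    a quadrature of [tau f] in T. *)
Lemma chart_primitive (d' : R) (f : plane R -> R^o) : smooth_on V f -> 0 < d' -> d' < d ->
  exists n : plane R -> R^o, smooth_on (chart_part d') n /\
    forall q, chart_part d' q -> Dt n q + g1 q * Dx n q = f q.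
Proof.
move=> sf d'0 dd; have [sZ ch1 ch2] := st_chart st.
have ob : open (box z0 d) by exact: open_box.
have ob' : open (box z0 d') by exact: open_box.
have stau := st_tau st.
have oV := st_open st.
have sft : smooth_on V (fun q => tau q * f q) by smooth.
have sfZ : smooth_on (box z0 d) (fun z => tau (Z z) * f (Z z)).
  by apply: (smooth_comp (findim_plane R) ob _ sft sZ) => q /ch2[].
have [N [sN Nt]] := primitive_t d'0 dd sfZ.
have TWP q : chart_part d' q -> box z0 d' (T q, W q) by case.
have sub : chart_part d' `<=` V by move=> q [].
have sTW := smooth_sub sub smooth_TW.
have oc := @open_chart_part d'.
exists (fun q => N (T q, W q)); split.
  exact: (smooth_comp (findim_plane R) oc TWP sN sTW).
move=> q cq; have Vq := sub q cq; have [sT sW] := (st_T st, st_W st).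
have D v : 'D_v (fun q => N (T q, W q)) q = 'D_v T q * Dt N (T q, W q) + 'D_v W q * Dx N (T q, W q).
  rewrite (derive_comp v (smooth_diff sTW cq) (smooth_diff sN (TWP q cq))).
  rewrite derive_pair; [|exact: smooth_diff sT Vq|exact: smooth_diff sW Vq].
  by rewrite derive_plane//; exact: smooth_diff sN (TWP q cq).
rewrite /Dt /Dx !D -!/(Dt _ _) -!/(Dx _ _) (st_Tt st Vq) (st_Tx st Vq) (st_Wt st Vq) (st_Wx st Vq).
rewrite Nt; last exact: TWP.
have [_ ->] := ch1 q Vq.
have := st_tau0 st Vq; have := st_xi0 st Vq; move: (xi q) (tau q) (g1 q) (f q) (Dx N _) => x t g h n x0 t0.
by field; rewrite x0.
Qed.

End Field.
End StraightenedField.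

Local Opaque Dx Dt.

(** * Symmetries of the linear equation generated by the reduction operator *)

Section Parabolic.
Variable R : realType.

Definition Lop (A B C w : plane R -> R^o) : plane R -> R^o :=
  fun p => Dt w p - A p * Dx (Dx w) p - B p * Dx w p - C p * w p.

(** The factor common to the three equations of [DE1]. For the time change chosen later it is the
    logarithmic t-derivative of [tau]. *)
Definition Kcoef (A g1 : plane R -> R^o) : plane R -> R^o :=
  fun p => 2%:R * Dx g1 p - Dx A p / A p * g1 p - Dt A p / A p.

(** The difference of the two sides is a second order expression in [w]. Its coefficient at [wxx]
    vanishes by the definition of [K], and those at [wx] and [w] by the first two equations of
    [DE1]; the third order terms cancel. *)
Fact commutes_algebra (a at_ ax b bt bx c ct cx g gt gx gxx m mt mx mxx K
    w wt wx wxx wxxx wtt wxt wtx wxxt wtxx : R) :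
  gt - a * gxx - b * gx + K * (g + b) + bx * g + 2%:R * a * mx + bt = 0 ->
  mt - a * mxx - b * mx + K * (m - c) - cx * g - ct = 0 ->
  a * K = 2%:R * a * gx - ax * g - at_ ->
  wxt = wtx -> wxxt = wtxx ->
  wtt - (at_ * wxx + a * wtxx) - (bt * wx + b * wtx) - (ct * w + c * wt) +
  g * (wxt - (ax * wxx + a * wxxx) - (bx * wx + b * wxx) - (cx * w + c * wx)) +
  (K - m) * (wt - a * wxx - b * wx - c * w) =
  wtt + (gt * wx + g * wtx) - (mt * w + m * wt) -
  a * (wxxt + (gxx * wx + gx * wxx + (gx * wxx + g * wxxx)) -
       (mxx * w + mx * wx + (mx * wx + m * wxx))) -
  b * (wxt + (gx * wx + g * wxx) - (mx * w + m * wx)) -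
  c * (wt + g * wx - m * w) + K * (wt + g * wx - m * w).
Proof.
move=> e1 e2 eK -> ->; apply/eqP; rewrite -subr_eq0; apply/eqP.
transitivity ((2%:R * a * gx - ax * g - at_ - a * K) * wxx -
  (gt - a * gxx - b * gx + K * (g + b) + bx * g + 2%:R * a * mx + bt) * wx +
  (mt - a * mxx - b * mx + K * (m - c) - cx * g - ct) * w); first by ring.
by rewrite e1 e2 eK; ring.
Qed.

Section Commutation.
Variables (V : set (plane R)) (A B C g1 g2 : plane R -> R^o).
Hypothesis oV : open V.
Hypotheses (sA : smooth_on V A) (sB : smooth_on V B) (sC : smooth_on V C).
Hypotheses (sg1 : smooth_on V g1) (sg2 : smooth_on V g2).
Hypothesis A0 : forall p, V p -> A p != 0.
Hypothesis E1 : forall p, V p -> Dt g1 p - A p * Dx (Dx g1) p - B p * Dx g1 p +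
  Kcoef A g1 p * (g1 p + B p) + Dx B p * g1 p + 2%:R * A p * Dx g2 p + Dt B p = 0.
Hypothesis E2 : forall p, V p -> Dt g2 p - A p * Dx (Dx g2) p - B p * Dx g2 p +
  Kcoef A g1 p * (g2 p - C p) - Dx C p * g1 p - Dt C p = 0.

(* The first two equations of [DE1] say that [d_t + g1 d_x - g2] commutes with
   the parabolic operator modulo [K]. *)
Lemma Lop_commutes (w z : plane R -> R^o) p : smooth_on V w -> smooth_on V z ->
  (forall q, V q -> Dt w q + g1 q * Dx w q - g2 q * w q = z q) -> V p ->
  Dt (Lop A B C w) p + g1 p * Dx (Lop A B C w) p +
    (Kcoef A g1 p - g2 p) * Lop A B C w p = Lop A B C z p + Kcoef A g1 p * z p.
Proof.
move=> sw sz zE Vp.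
derive_at H1 (Dt (fun q => Dt w q - A q * Dx (Dx w) q - B q * Dx w q - C q * w q) p) Vp.
derive_at H2 (Dx (fun q => Dt w q - A q * Dx (Dx w) q - B q * Dx w q - C q * w q) p) Vp.
have swx := smooth_Dx sw.
have C1 q : V q -> Dx (Dt w) q = Dt (Dx w) q by move=> Vq; exact: (DtDx_comm oV sw Vq).
have C2 : Dx (Dx (Dt w)) p = Dt (Dx (Dx w)) p.
  by rewrite (Dx_on oV Vp C1) (DtDx_comm oV swx Vp).
have Zx q : V q -> Dx z q = Dx (Dt w) q + (Dx g1 q * Dx w q + g1 q * Dx (Dx w) q) -
    (Dx g2 q * w q + g2 q * Dx w q).
  move=> Vq; derive_at H (Dx (fun q => Dt w q + g1 q * Dx w q - g2 q * w q) q) Vq.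
  exact: etrans (esym (Dx_on oV Vq zE)) H.
derive_at Zt (Dt (fun q => Dt w q + g1 q * Dx w q - g2 q * w q) p) Vp.
have {}Zt := etrans (esym (Dt_on oV Vp zE)) Zt.
derive_at Zxx (Dx (fun q => Dx (Dt w) q + (Dx g1 q * Dx w q + g1 q * Dx (Dx w) q) -
    (Dx g2 q * w q + g2 q * Dx w q)) p) Vp.
have {}Zxx := etrans (Dx_on oV Vp Zx) Zxx.
have e1 := E1 Vp; have e2 := E2 Vp; have a0 := A0 Vp.
have eK : A p * Kcoef A g1 p = 2%:R * A p * Dx g1 p - Dx A p * g1 p - Dt A p.
  by rewrite /Kcoef; field.
rewrite -[Dt (Lop A B C w) p]/(Dt (fun q => Dt w q - A q * Dx (Dx w) q - B q * Dx w q - C q * w q) p).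
rewrite -[Dx (Lop A B C w) p]/(Dx (fun q => Dt w q - A q * Dx (Dx w) q - B q * Dx w q - C q * w q) p).
have {}Zx := Zx p Vp; have {}C1 := C1 p Vp; have {}zE := zE p Vp.
rewrite H1 H2 /Lop Zt Zxx Zx -zE.
exact: (commutes_algebra _ _ _ _ _ _ e1 e2 eK C1 C2).
Qed.
End Commutation.
End Parabolic.

(** * The linear equation in the straightened coordinates and the translation of T *)

Section FlowSymmetry.
Variable R : realType.

Lemma Lop_on (O : set (plane R)) (A B C w w' : plane R -> R^o) p : open O -> O p ->
  (forall q, O q -> w q = w' q) -> Lop A B C w p = Lop A B C w' p.
Proof.
move=> oO Op ww; have wx q : O q -> Dx w q = Dx w' q by move=> Oq; exact: Dx_on ww.
by rewrite /Lop (Dt_on oO Op ww) (Dx_on oO Op wx) (wx p Op) (ww p Op).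
Qed.

Lemma LopD (O : set (plane R)) (A B C w w' : plane R -> R^o) p : open O -> O p ->
  smooth_on O w -> smooth_on O w' ->
  Lop A B C (fun q => w q + w' q) p = Lop A B C w p + Lop A B C w' p.
Proof.
move=> oO Op sw sw'.
derive_at Ht (Dt (fun q => w q + w' q) p) Op.
have Hx q : O q -> Dx (fun q => w q + w' q) q = Dx w q + Dx w' q.
  by move=> Oq; derive_at H (Dx (fun q => w q + w' q) q) Oq.
derive_at Hxx (Dx (fun q => Dx w q + Dx w' q) p) Op.
rewrite /Lop Ht (Dx_on oO Op Hx) Hxx (Hx p Op).
move: (Dt w p) (Dt w' p) (Dx w p) (Dx w' p) (Dx (Dx w) p) (Dx (Dx w') p) => *; ring.
Qed.

Lemma Lop_exp (O : set (plane R)) (A B C n v : plane R -> R^o) p : open O -> O p ->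
  smooth_on O n -> smooth_on O v ->
  Lop A B C (fun q => expR (n q) * v q) p = expR (n p) *
    (Dt v p + Dt n p * v p -
     A p * (Dx (Dx v) p + 2%:R * Dx n p * Dx v p + (Dx (Dx n) p + Dx n p * Dx n p) * v p) -
     B p * (Dx v p + Dx n p * v p) - C p * v p).
Proof.
move=> oO Op sn sv.
derive_at Ht (Dt (fun q => expR (n q) * v q) p) Op.
have Hx q : O q -> Dx (fun q => expR (n q) * v q) q = expR (n q) * Dx n q * v q + expR (n q) * Dx v q.
  by move=> Oq; derive_at H (Dx (fun q => expR (n q) * v q) q) Oq.
derive_at Hxx (Dx (fun q => expR (n q) * Dx n q * v q + expR (n q) * Dx v q) p) Op.
rewrite /Lop Ht (Dx_on oO Op Hx) Hxx (Hx p Op).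
move: (Dt v p) (Dt n p) (Dx v p) (Dx n p) (Dx (Dx v) p) (Dx (Dx n) p) (expR _) => *; ring.
Qed.

(** Once its first order transport part and its second order part are known, the operator is
    determined by its values on the functions 1 and W; [c0] and [b0] come from these values. What
    remains is a multiple of [s * (x * x) - t * a]. *)
Fact expansion_algebra (t x s a b c g vt v vx vxx nt nx nxx xx w : R) :
  x != 0 -> t * a = s * (x * x) ->
  let c0 := t * (0 + nt * 1 - a * (0 + 2%:R * nx * 0 + (nxx + nx * nx) * 1) - b * (0 + nx * 1) - c * 1) in
  let wx := x^-1 in let wt := - g * x^-1 in let wxx := - xx * x^-1 * x^-1 in
  let b0 := c0 * w - t * (wt + nt * w - a * (wxx + 2%:R * nx * wx + (nxx + nx * nx) * w) - b * (wx + nx * w) - c * w) in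
  t * (vt + nt * v - a * (vxx + 2%:R * nx * vx + (nxx + nx * nx) * v) - b * (vx + nx * v) - c * v) =
  t * (vt + g * vx) - s * (x * (xx * vx + x * vxx)) - b0 * (x * vx) + c0 * v.
Proof.
move=> x0 ta /=; apply/eqP; rewrite -subr_eq0; apply/eqP.
transitivity ((s * (x * x) - t * a) * (vxx + xx * x^-1 * vx)); first by field.
by rewrite ta subrr mul0r.
Qed.

Section Flow.
Variables (A B C tau xi g1 g2 g3 n k : plane R -> R^o) (sg : R).
Variables (V : set (plane R)) (T W : plane R -> R^o).
Variables (z0 : plane R) (d : R) (Z : plane R -> plane R).
Hypothesis st : straightened tau xi g1 V T W z0 d Z.
Hypotheses (sA : smooth_on V A) (sB : smooth_on V B) (sC : smooth_on V C).
Hypotheses (sg2 : smooth_on V g2) (sg3 : smooth_on V g3).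
Hypotheses (sn : smooth_on V n) (sk : smooth_on V k).
Hypothesis A0 : forall p, V p -> A p != 0.
Hypothesis E1 : forall p, V p -> Dt g1 p - A p * Dx (Dx g1) p - B p * Dx g1 p +
  Kcoef A g1 p * (g1 p + B p) + Dx B p * g1 p + 2%:R * A p * Dx g2 p + Dt B p = 0.
Hypothesis E2 : forall p, V p -> Dt g2 p - A p * Dx (Dx g2) p - B p * Dx g2 p +
  Kcoef A g1 p * (g2 p - C p) - Dx C p * g1 p - Dt C p = 0.
Hypothesis E3 : forall p, V p -> Dt g3 p - A p * Dx (Dx g3) p - B p * Dx g3 p +
  Kcoef A g1 p * g3 p - C p * g3 p = 0.
Hypothesis Rn : forall p, V p -> Dt n p + g1 p * Dx n p = g2 p.
Hypothesis Rk : forall p, V p -> Dt k p + g1 p * Dx k p = expR (- n p) * g3 p.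
Hypothesis tauA : forall p, V p -> tau p * A p = sg * (xi p * xi p).
Hypothesis taut : forall p, V p -> Dt tau p = tau p * Kcoef A g1 p.
Hypothesis taux : forall p, V p -> Dx tau p = 0.

Let oV := st_open st.
Let stau := st_tau st.
Let sxi := st_xi st.
Let sg1 := st_g1 st.
Let sT := st_T st.
Let sW := st_W st.

(** The weight makes the commutation exact: along [d_t + g1 d_x] the logarithmic derivative of [tau]
    is K and that of [exp (- n)] is [- g2], which are the two terms that spoil invariance of
    [Lop]. *)
Let mop (w : plane R -> R^o) : plane R -> R^o :=
  fun q => tau q * expR (- n q) * Lop A B C w q.

Lemma smooth_Lop w : smooth_on V w -> smooth_on V (Lop A B C w).
Proof. by move: oV => oV' sw; rewrite /Lop; smooth. Qed.

Lemma smooth_mop w : smooth_on V w -> smooth_on V (mop w).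
Proof. by move: oV => oV' sw; have sL := smooth_Lop sw; rewrite /mop; smooth. Qed.

Lemma mop_transport w z p : smooth_on V w -> smooth_on V z ->
  (forall q, V q -> Dt w q + g1 q * Dx w q - g2 q * w q = z q) -> V p ->
  Dt (mop w) p + g1 p * Dx (mop w) p =
    tau p * expR (- n p) * (Lop A B C z p + Kcoef A g1 p * z p).
Proof.
move=> sw sz zE Vp; have oV' := oV; have stau' := stau; have sL := smooth_Lop sw.
have key := Lop_commutes oV' sA sB sC sg1 sg2 A0 E1 E2 sw sz zE Vp.
derive_at Ht (Dt (fun q => tau q * expR (- n q) * Lop A B C w q) p) Vp.
derive_at Hx (Dx (fun q => tau q * expR (- n q) * Lop A B C w q) p) Vp.
rewrite -[Dt (mop w) p]/(Dt (fun q => tau q * expR (- n q) * Lop A B C w q) p).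
rewrite -[Dx (mop w) p]/(Dx (fun q => tau q * expR (- n q) * Lop A B C w q) p).
rewrite Ht Hx -key taut// taux// -(Rn Vp).
move: (Dt (Lop A B C w) p) (Dx (Lop A B C w) p) (Lop A B C w p) (Kcoef A g1 p) (expR _) (Dt n p) (Dx n p) => *; ring.
Qed.

Lemma mop_exp_transport v y p : smooth_on V v -> smooth_on V y ->
  (forall q, V q -> expR (n q) * (Dt v q + g1 q * Dx v q) = y q) -> V p ->
  Dt (mop (fun q => expR (n q) * v q)) p + g1 p * Dx (mop (fun q => expR (n q) * v q)) p =
    tau p * expR (- n p) * (Lop A B C y p + Kcoef A g1 p * y p).
Proof.
move=> sv sy yE Vp; have oV' := oV; apply: mop_transport => //; first by smooth.
move=> q Vq; derive_at Ht (Dt (fun q => expR (n q) * v q) q) Vq.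
derive_at Hx (Dx (fun q => expR (n q) * v q) q) Vq.
rewrite Ht Hx -(yE q Vq) -(Rn Vq).
move: (Dt v q) (Dx v q) (expR _) (Dt n q) (Dx n q) => *; ring.
Qed.

(** If [v] is a first integral, [exp n * v] is annihilated by [d_t + g1 d_x - g2], so the right side
    of the commutation relation is zero. *)
Lemma mop_exp_invariant v p : smooth_on V v ->
  (forall q, V q -> Dt v q + g1 q * Dx v q = 0) -> V p ->
  Dt (mop (fun q => expR (n q) * v q)) p + g1 p * Dx (mop (fun q => expR (n q) * v q)) p = 0.
Proof.
move=> sv v0 Vp; have oV' := oV.
rewrite (@mop_exp_transport v (fun=> 0)) //; last first.
- by move=> q Vq; rewrite v0// mulr0.
- exact: smooth_cst.
have Dt0 q : V q -> Dt (fun=> 0 : R^o) q = 0 :> R by move=> Vq; exact: (Dt_hasD (hasD_cst _ _ 0) Vq).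
have Dx0 q : V q -> Dx (fun=> 0 : R^o) q = 0 :> R by move=> Vq; exact: (Dx_hasD (hasD_cst _ _ 0) Vq).
have Dxx0 : Dx (Dx (fun=> 0 : R^o)) p = 0 :> R by rewrite (Dx_on oV' Vp Dx0) Dx0.
by rewrite /Lop Dxx0 Dx0// Dt0// !mulr0 !subr0 addr0 mulr0.
Qed.

(** The coefficients of the equation in the coordinates T, W, v, where [u = exp n * (v + k)]. They
    are read off from [v = 1], from [v = W], for which [xi W_x = 1], and from the inhomogeneous part
    [k]. Independence of T means that all three are first integrals. *)
Let c0 := mop (fun q => expR (n q) * 1).
Let b0 q := c0 q * W q - mop (fun q => expR (n q) * W q) q.
Let f0 := mop (fun q => expR (n q) * k q).

Let sc0 : smooth_on V c0.
Proof. by move: oV => oV'; apply: smooth_mop; smooth. Qed.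

Let sb0 : smooth_on V b0.
Proof.
move: oV => oV'; have sW' := sW; have sc0' := sc0.
have sm : smooth_on V (mop (fun q => expR (n q) * W q)) by apply: smooth_mop; smooth.
by rewrite /b0; smooth.
Qed.

Let sf0 : smooth_on V f0.
Proof. by move: oV => oV'; apply: smooth_mop; smooth. Qed.

Let Rc0 p : V p -> Dt c0 p + g1 p * Dx c0 p = 0.
Proof.
move=> Vp; apply: (@mop_exp_invariant (fun=> 1)) => //; first exact: smooth_cst.
move=> q Vq; rewrite (Dt_hasD (hasD_cst _ _ 1) Vq) (Dx_hasD (hasD_cst _ _ 1) Vq).
by rewrite mulr0 addr0.
Qed.

Let RW p : V p -> Dt W p + g1 p * Dx W p = 0.
Proof. by move=> Vp; rewrite (st_Wt st Vp) (st_Wx st Vp) mulNr addNr. Qed.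

Let Rb0 p : V p -> Dt b0 p + g1 p * Dx b0 p = 0.
Proof.
move=> Vp; have oV' := oV; have sW' := sW; have sc0' := sc0.
have sm : smooth_on V (mop (fun q => expR (n q) * W q)) by apply: smooth_mop; smooth.
have := mop_exp_invariant sW RW Vp.
set m := mop _ in sm *; move=> Rm.
derive_at Ht (Dt (fun q => c0 q * W q - m q) p) Vp.
derive_at Hx (Dx (fun q => c0 q * W q - m q) p) Vp.
rewrite -[Dt b0 p]/(Dt (fun q => c0 q * W q - m q) p) -[Dx b0 p]/(Dx (fun q => c0 q * W q - m q) p).
rewrite Ht Hx; have := Rc0 Vp; have := RW Vp; move: Rm.
move: (Dt c0 p) (Dx c0 p) (Dt m p) (Dx m p) (Dt W p) (Dx W p) (c0 p) (g1 p) (W p).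
move=> a1 a2 a3 a4 a5 a6 a7 a8 a9 e1 e2 e3.
transitivity ((a1 + a8 * a2) * a9 + a7 * (a5 + a8 * a6) - (a3 + a8 * a4)); first by ring.
by rewrite e1 e2 e3 mul0r mulr0 subr0 addr0.
Qed.

(** The transport equation of [k] turns [exp n * k] into the source [g3], and the third equation of
    [DE1] is exactly [Lop g3 + K g3 = 0]. *)
Let Rf0 p : V p -> Dt f0 p + g1 p * Dx f0 p = 0.
Proof.
move=> Vp; rewrite (@mop_exp_transport k g3)//; last first.
  by move=> q Vq; rewrite Rk// mulrA -expRD subrr expR0 mul1r.
have := E3 Vp; rewrite /Lop.
move: (Dt g3 p) (Dx g3 p) (Dx (Dx g3) p) (g3 p) (Kcoef _ _ _) (A p) (B p) (C p) => a1 a2 a3 a4 a5 a6 a7 a8 e.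
by rewrite (_ : _ + _ = 0) ?mulr0// -e; ring.
Qed.

(** In the chart this is [d_T - sg d_W^2 - b0 d_W + c0], written with the two fields in place of the
    coordinates. *)
Definition Lam (v : plane R -> R^o) (p : plane R) : R^o :=
  tau p * (Dt v p + g1 p * Dx v p) - sg * (xi p * Dx (fun q => xi q * Dx v q) p) -
  b0 p * (xi p * Dx v p) + c0 p * v p.

Lemma mop_exp (O : set (plane R)) v p : open O -> O `<=` V -> O p -> smooth_on O v ->
  mop (fun q => expR (n q) * v q) p = Lam v p.
Proof.
move=> oO OV Op sv; have oV' := oV; have Vp := OV _ Op.
have sn' := smooth_sub OV sn; have sxi' := smooth_sub OV sxi.
have sW' := sW; have sxiV := sxi.
have ex : expR (- n p) * expR (n p) = 1 :> R by rewrite -expRD addNr expR0.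
have one : smooth_on V (fun=> 1 : R^o) by exact: smooth_cst.
have D1 q : V q -> Dx (fun=> 1 : R^o) q = 0 :> R by move=> Vq; exact: (Dx_hasD (hasD_cst _ _ 1) Vq).
have D1t : Dt (fun=> 1 : R^o) p = 0 :> R by exact: (Dt_hasD (hasD_cst _ _ 1) Vp).
have D11 : Dx (Dx (fun=> 1 : R^o)) p = 0 :> R by rewrite (Dx_on oV' Vp D1) (Dx_hasD (hasD_cst _ _ 0) Vp).
have xi0 q : V q -> xi q != 0 := st_xi0 st (q := q).
derive_at Wxx (Dx (fun q => (xi q)^-1) p) Vp.
have {}Wxx := etrans (Dx_on oV' Vp (st_Wx st)) Wxx.
derive_at Hx (Dx (fun q => xi q * Dx v q) p) Op.
rewrite /Lam /b0 /c0 /mop Hx (Lop_exp A B C oO Op sn' sv) (Lop_exp A B C oV' Vp sn sW') (Lop_exp A B C oV' Vp sn one).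
rewrite D1// D1t D11 Wxx (st_Wt st Vp) (st_Wx st Vp).
have x0 := xi0 p Vp.
have E (y : R) : tau p * expR (- n p) * (expR (n p) * y) = tau p * y.
  by rewrite mulrA -(mulrA (tau p)) ex mulr1.
rewrite !E.
exact: (expansion_algebra _ _ _ _ _ _ _ _ _ _ _ _ x0 (tauA Vp)).
Qed.

Definition flow (e : R) (q : plane R) : plane R := Z (T q + e, W q).

Definition flow_dom (e : R) : set (plane R) := [set q | V q /\ box z0 d (T q + e, W q)].

Let sTWe e : smooth_on V (fun q => (T q + e, W q) : plane R).
Proof.
have oV' := oV; have sT' := sT; have sW' := sW.
by apply: smooth_pair => //; smooth.
Qed.

Lemma open_flow_dom e : open (flow_dom e).
Proof.
apply: (@open_preimage_on R _ _ V (box z0 d) (fun q => (T q + e, W q) : plane R)) => //.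
- exact: open_box.
- by move=> q Vq; exact: smooth_cont (sTWe e) Vq.
Qed.

Lemma flow_V e q : flow_dom e q -> [/\ V (flow e q), T (flow e q) = T q + e & W (flow e q) = W q].
Proof.
by move=> [Vq bq]; have [_ _ ch] := st_chart st; have [VZ [-> ->]] := ch _ bq.
Qed.

Lemma smooth_flow e : smooth_on (flow_dom e) (flow e).
Proof.
have [sZ _ _] := st_chart st.
apply: (@smooth_comp _ _ _ _ _ (box z0 d) Z) => //.
- exact: findim_plane.
- exact: open_flow_dom.
- by move=> q [].
- by apply: smooth_sub (sTWe e) => q [].
Qed.

Lemma derive_flow e q v : flow_dom e q ->
  'D_v (flow e) q = ('D_v T q * tau (flow e q),
    'D_v T q * tau (flow e q) * g1 (flow e q) + 'D_v W q * xi (flow e q)).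
Proof.
move=> [Vq bq]; have [sZ _ _] := st_chart st; have oV' := oV; have sT' := sT.
rewrite (derive_comp v (smooth_diff (sTWe e) Vq) (smooth_diff sZ bq)) (straightened_dZ st)//.
rewrite derive_pair /=; [|by apply: smooth_diff Vq; smooth|exact: smooth_diff sW Vq].
have HT : hasD V v (fun q => T q + e) (fun q => 'D_v T q + 0) by hasD.
by have [_ ->] := HT; rewrite ?addr0.
Qed.

(** A translation of T preserves both coordinate fields, hence derivatives along them commute with
    composition with the flow. *)
Lemma flow_transport e (O : set (plane R)) v q : smooth_on O v -> flow_dom e q -> O (flow e q) ->
  xi q * Dx (fun q => v (flow e q)) q = xi (flow e q) * Dx v (flow e q) /\
  tau q * (Dt (fun q => v (flow e q)) q + g1 q * Dx (fun q => v (flow e q)) q) =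
    tau (flow e q) * (Dt v (flow e q) + g1 (flow e q) * Dx v (flow e q)).
Proof.
move=> sv fq Oq; have [Vq _] := fq.
have dv := smooth_diff sv Oq.
have Dv w : 'D_w (fun q => v (flow e q)) q = 'D_w T q * tau (flow e q) * Dt v (flow e q) +
    ('D_w T q * tau (flow e q) * g1 (flow e q) + 'D_w W q * xi (flow e q)) * Dx v (flow e q).
  rewrite (derive_comp w (smooth_diff (@smooth_flow e) fq) dv) (derive_plane _ dv).
  by rewrite derive_flow.
have Et := etrans (DtE _ _) (Dv (1, 0)); have Ex := etrans (DxE _ _) (Dv (0, 1)).
rewrite -!DtE (st_Tt st Vq) (st_Wt st Vq) in Et.
rewrite -!DxE (st_Tx st Vq) (st_Wx st Vq) in Ex.
rewrite Et Ex.
have t0 := st_tau0 st Vq; have x0 := st_xi0 st Vq.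
move: (Dt v _) (Dx v _) (tau (flow e q)) (xi (flow e q)) (g1 (flow e q)) => a1 a2 a3 a4 a5.
by split; field; rewrite ?t0 ?x0.
Qed.

Lemma flow_invariant e f q : smooth_on V f ->
  (forall q, V q -> Dt f q + g1 q * Dx f q = 0) -> flow_dom e q -> f (flow e q) = f q.
Proof.
move=> sf f0' [Vq bq]; have [_ ch1 _] := st_chart st; have [bq0 ZE] := ch1 q Vq.
by rewrite /flow (chart_const st sf f0' bq bq0)// ZE.
Qed.

(** [Lam] is built from the two fields, which the flow preserves, and from the first integrals [b0]
    and [c0], which are constant along it. *)
Lemma Lam_flow e (O : set (plane R)) v q : open O -> O `<=` V -> smooth_on O v ->
  flow_dom e q -> O (flow e q) -> Lam (fun q => v (flow e q)) q = Lam v (flow e q).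
Proof.
move=> oO OV sv fq Oq.
pose O' := [set q | flow_dom e q /\ O (flow e q)].
have oO' : open O'.
  apply: (@open_preimage_on R _ _ (flow_dom e) O (flow e)) => //; first exact: open_flow_dom.
  by move=> z fz; exact: smooth_cont (@smooth_flow e) fz.
have Oq' : O' q by [].
have sxi' := smooth_sub OV sxi.
have sxv : smooth_on O (fun q => xi q * Dx v q) by smooth.
have E z : O' z -> xi z * Dx (fun q => v (flow e q)) z = xi (flow e z) * Dx v (flow e z).
  by move=> [fz Oz]; have [] := flow_transport sv fz Oz.
have [Ex Et] := flow_transport sv fq Oq.
have [Exx _] := flow_transport sxv fq Oq.
rewrite /Lam Et Ex (Dx_on oO' Oq' E) Exx.
by rewrite (flow_invariant sb0 Rb0 fq) (flow_invariant sc0 Rc0 fq).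
Qed.

(** Only the derivatives that occur in the equation are compared. *)
Definition same_jet (u1 u2 : plane R -> R^o) p : Prop :=
  [/\ u1 p = u2 p, Dt u1 p = Dt u2 p, Dx u1 p = Dx u2 p & Dx (Dx u1) p = Dx (Dx u2) p].

Lemma same_jet_affine (O : set (plane R)) (m c u1 u2 : plane R -> R^o) p : open O -> O p ->
  smooth_on O m -> smooth_on O c -> smooth_on O u1 -> smooth_on O u2 ->
  same_jet u1 u2 p -> same_jet (fun q => m q * u1 q - c q) (fun q => m q * u2 q - c q) p.
Proof.
move=> oO Op sm sc su1 su2 [e0 et ex exx].
have jet u : smooth_on O u -> [/\ Dt (fun q => m q * u q - c q) p = Dt m p * u p + m p * Dt u p - Dt c p,
    Dx (fun q => m q * u q - c q) p = Dx m p * u p + m p * Dx u p - Dx c p &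
    Dx (Dx (fun q => m q * u q - c q)) p = Dx (Dx m) p * u p + Dx m p * Dx u p +
      (Dx m p * Dx u p + m p * Dx (Dx u) p) - Dx (Dx c) p].
  move=> su; derive_at Ht (Dt (fun q => m q * u q - c q) p) Op.
  have Hx q : O q -> Dx (fun q => m q * u q - c q) q = Dx m q * u q + m q * Dx u q - Dx c q.
    by move=> Oq; derive_at H (Dx (fun q => m q * u q - c q) q) Oq.
  derive_at Hxx (Dx (fun q => Dx m q * u q + m q * Dx u q - Dx c q) p) Op.
  by split; [exact: Ht|exact: Hx|rewrite (Dx_on oO Op Hx)].
have [a1 a2 a3] := jet u1 su1; have [b1 b2 b3] := jet u2 su2.
split; first by rewrite e0.
- exact: etrans a1 (etrans (congr2 (fun x y => Dt m p * x + m p * y - Dt c p) e0 et) (esym b1)).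
- exact: etrans a2 (etrans (congr2 (fun x y => Dx m p * x + m p * y - Dx c p) e0 ex) (esym b2)).
- have cg (x y z x' y' z' : R) : x = x' -> y = y' -> z = z' ->
      Dx (Dx m) p * x + Dx m p * y + (Dx m p * y + m p * z) - Dx (Dx c) p =
      Dx (Dx m) p * x' + Dx m p * y' + (Dx m p * y' + m p * z') - Dx (Dx c) p.
    by move=> -> -> ->.
  exact: etrans a3 (etrans (cg _ _ _ _ _ _ e0 ex exx) (esym b3)).
Qed.

Lemma Lam_same_jet (O : set (plane R)) u1 u2 p : open O -> O `<=` V -> O p ->
  smooth_on O u1 -> smooth_on O u2 -> same_jet u1 u2 p -> Lam u1 p = Lam u2 p.
Proof.
move=> oO OV Op s1 s2 [e0 et ex exx]; have sxi' := smooth_sub OV sxi.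
derive_at H1 (Dx (fun q => xi q * Dx u1 q) p) Op.
derive_at H2 (Dx (fun q => xi q * Dx u2 q) p) Op.
have cg (x y z w x' y' z' w' : R) : x = x' -> y = y' -> z = z' -> w = w' ->
    tau p * (y + g1 p * z) - sg * (xi p * (Dx xi p * z + xi p * w)) - b0 p * (xi p * z) + c0 p * x =
    tau p * (y' + g1 p * z') - sg * (xi p * (Dx xi p * z' + xi p * w')) - b0 p * (xi p * z') + c0 p * x'.
  by move=> -> -> -> ->.
by rewrite /Lam H1 H2; exact: cg.
Qed.

(** Solves [v = exp (- n) u - k] for the dependent variable at the end point of the flow, with the
    value of [v] at the starting point. *)
Definition flow_u (e : R) (q : plane R) (u : R) : R :=
  expR (n (flow e q)) * (expR (- n q) * u - k q + k (flow e q)).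

(* [v = exp (- n) u - k] is a first integral, so in the coordinates [T, W, v]
   the flow is the translation of [T]. *)
Lemma flow_symmetry e p (Og Oh : set (plane R)) g h : flow_dom e p ->
  open Og -> Og p -> smooth_on Og g -> open Oh -> Oh (flow e p) -> smooth_on Oh h ->
  same_jet (fun q => h (flow e q)) (fun q => flow_u e q (g q)) p ->
  Lop A B C g p = 0 -> Lop A B C h (flow e p) = 0.
Proof.
move=> fp oOg Ogp sg' oOh Ohp sh jet Lg; have oV' := oV.
have [Vp _] := fp; have [VF _ _] := flow_V fp.
have ex (y : R) : expR y * expR (- y) = 1 :> R by rewrite -expRD subrr expR0.
(* From [w = exp n * (v + k)]: the weighted equation is linear in [v] with source [f0]. *)
have aux (O : set (plane R)) w q : open O -> O q -> V q -> smooth_on O w ->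
    mop w q = Lam (fun q => expR (- n q) * w q - k q) q + f0 q.
  move=> oO Oq Vq sw; pose O1 := O `&` V.
  have oO1 : open O1 by exact: openI.
  have sub1 : O1 `<=` O by move=> ? [].
  have subV : O1 `<=` V by move=> ? [].
  have sn1 := smooth_sub subV sn; have sk1 := smooth_sub subV sk; have sw1 := smooth_sub sub1 sw.
  have Oq1 : O1 q by [].
  have sv : smooth_on O1 (fun q => expR (- n q) * w q - k q) by smooth.
  rewrite -(mop_exp oO1 subV Oq1 sv) /f0 /mop -mulrDr; congr (_ * _).
  have sa : smooth_on O1 (fun q => expR (n q) * (expR (- n q) * w q - k q)) by smooth.
  have sb : smooth_on O1 (fun q => expR (n q) * k q) by smooth.
  rewrite -(LopD A B C oO1 Oq1 sa sb); apply: (Lop_on _ _ _ oO1 Oq1) => z _ /=.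
  rewrite -mulrDr subrK mulrA.
  by rewrite ex mul1r.
have t0 := st_tau0 st VF.
suff : mop h (flow e p) = 0.
  by move/eqP; rewrite /mop !mulf_eq0 (negPf t0) (gt_eqF (expR_gt0 _)) /= => /eqP.
have <- : mop g p = 0 by rewrite /mop Lg mulr0.
rewrite (aux Oh h)// (aux Og g)// (flow_invariant sf0 Rf0 fp); congr (_ + _).
pose O1 := Oh `&` V.
have oO1 : open O1 by exact: openI.
have sub1 : O1 `<=` Oh by move=> ? [].
have subV : O1 `<=` V by move=> ? [].
have sn1 := smooth_sub subV sn; have sk1 := smooth_sub subV sk; have sh1 := smooth_sub sub1 sh.
have OF1 : O1 (flow e p) by [].
have sv : smooth_on O1 (fun q => expR (- n q) * h q - k q) by smooth.
rewrite -(Lam_flow oO1 subV sv fp OF1).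
pose O2 := [set q | flow_dom e q /\ O1 (flow e q)] `&` Og.
have oO2 : open O2.
  apply: openI => //; apply: (@open_preimage_on R _ _ (flow_dom e) O1 (flow e)) => //.
    exact: open_flow_dom.
  by move=> z fz; exact: smooth_cont (@smooth_flow e) fz.
have O2p : O2 p by [].
have subV2 : O2 `<=` V by move=> z [[[]]].
have sn2 := smooth_sub subV2 sn; have sk2 := smooth_sub subV2 sk.
have sg2' : smooth_on O2 g by apply: smooth_sub sg' => z [].
have sF2 : smooth_on O2 (flow e) by apply: smooth_sub (@smooth_flow e) => z [[]].
have sc (O : set (plane R)) (f : plane R -> R^o) : smooth_on O f -> O1 `<=` O -> smooth_on O2 (fun q => f (flow e q)).
  by move=> sf OO; apply: (smooth_comp (findim_plane R) oO2 _ sf sF2) => z [[_ /OO]].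
have snF := sc _ _ sn subV; have skF := sc _ _ sk subV; have shF := sc _ _ sh sub1.
have sgu : smooth_on O2 (fun q => flow_u e q (g q)) by rewrite /flow_u; smooth.
have sm : smooth_on O2 (fun q => expR (- n (flow e q))) by smooth.
(* The contact of [h] with the moved graph is passed to the variable [v] at the end point, where
   [exp (- n) * flow_u - k] gives back the initial value [exp (- n) * g - k]. *)
have := same_jet_affine oO2 O2p sm skF shF sgu jet.
have sv1 : smooth_on O2 (fun q => expR (- n (flow e q)) * h (flow e q) - k (flow e q)) by smooth.
have sv2 : smooth_on O2 (fun q => expR (- n (flow e q)) * flow_u e q (g q) - k (flow e q)) by smooth.
move=> J; rewrite (Lam_same_jet oO2 subV2 O2p sv1 sv2 J).
have sv3 : smooth_on O2 (fun q => expR (- n q) * g q - k q) by smooth.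
rewrite -(mop_exp oO2 subV2 O2p sv2) -(mop_exp oO2 subV2 O2p sv3) /mop; congr (_ * _).
apply: (Lop_on _ _ _ oO2 O2p) => z _ /=; congr (_ * _).
by rewrite /flow_u mulrA (mulrC (expR (- _))) ex mul1r addrK.
Qed.

(** * The translation of T as a local group, and its generator *)

Let E : normedModType R := (R^o * varspace (scalars R))%type.

Let dom : set E := [set ez : E | flow_dom ez.1 ez.2.1].

Definition flow_point (ez : E) : varspace (scalars R) :=
  (flow ez.1 ez.2.1, flow_u ez.1 ez.2.1 ez.2.2).

Let dom0 : set E := [set ez : E | V ez.2.1].

Let smooth_coord (U : set E) : open U -> [/\ smooth_on U (fun ez : E => ez.1 : R^o),
  smooth_on U (fun ez : E => ez.2.1 : plane R) & smooth_on U (fun ez : E => ez.2.2 : R^o)].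
Proof.
move=> oU; split; apply: smooth_linear => //.
- exact: fst_continuous.
- by move=> x; apply: continuous_comp; [exact: snd_continuous|exact: fst_continuous].
- by move=> x; apply: continuous_comp; [exact: snd_continuous|exact: snd_continuous].
Qed.

Let open_dom0 : open dom0.
Proof.
have [_ s _] := smooth_coord (@openT E).
rewrite (_ : dom0 = [set ez : E | setT ez /\ V ez.2.1]); last first.
  by apply/seteqP; split=> x /=; [move=> Vx; split|case].
exact: (open_preimage_on (@openT E) oV (fun q Tq => smooth_cont s Tq)).
Qed.

Let smooth_base (U : set E) (f : plane R -> R^o) : open U -> U `<=` dom0 -> smooth_on V f ->
  smooth_on U (fun ez : E => f ez.2.1).
Proof.
move=> oU UV sf; have [_ s _] := smooth_coord oU.
by apply: (smooth_comp (findim_plane R) oU _ sf s) => ez /UV.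
Qed.

Let smooth_TWe (U : set E) : open U -> U `<=` dom0 ->
  smooth_on U (fun ez : E => (T ez.2.1 + ez.1, W ez.2.1) : plane R).
Proof.
move=> oU UV; have [s1 _ _] := smooth_coord oU.
have s2 := smooth_base oU UV sT; have s3 := smooth_base oU UV sW.
apply: smooth_pair => //.
exact: (@smooth_add _ _ _ _ (fun ez : E => T ez.2.1) (fun ez : E => ez.1 : R^o)).
Qed.

Let open_dom : open dom.
Proof.
have sTW := smooth_TWe open_dom0 (fun z Vz => Vz).
have ob : open (box z0 d) by exact: open_box.
exact: (open_preimage_on open_dom0 ob (fun q dq => smooth_cont sTW dq)).
Qed.

Let smooth_flow_point : smooth_on dom flow_point.
Proof.
have od := open_dom; have sub : dom `<=` dom0 by move=> ez [].
have [_ _ su] := smooth_coord od.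
have sTW := smooth_TWe od sub.
have [sZ _ ch2] := st_chart st.
have sF : smooth_on dom (fun ez : E => flow ez.1 ez.2.1).
  by apply: (smooth_comp (findim_plane R) od _ sZ sTW) => ez [].
have FV (f : plane R -> R^o) : smooth_on V f -> smooth_on dom (fun ez : E => f (flow ez.1 ez.2.1)).
  by move=> sf; apply: (smooth_comp (findim_plane R) od _ sf sF) => ez fez; have [] := flow_V fez.
apply: smooth_pair => //.
have s1 := FV n sn; have s2 := FV k sk; have s3 := smooth_base od sub sn; have s4 := smooth_base od sub sk.
rewrite /flow_u.
smooth.
Qed.

Let flow_comp a b q : flow_dom a q -> flow_dom (b + a) q ->
  flow b (flow a q) = flow (b + a) q.
Proof.
move=> fa fb; have [_ Ta Wa] := flow_V fa.
by rewrite /flow Ta Wa addrAC -addrA.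
Qed.

Let flow0 q : V q -> flow 0 q = q.
Proof. by move=> Vq; have [_ /(_ q Vq)[_ ZE] _] := st_chart st; rewrite /flow addr0. Qed.

Let expNK (y : R) : expR y * expR (- y) = 1 :> R.
Proof. by rewrite -expRD subrr expR0. Qed.

Let flow_group : local_group [set z : varspace (scalars R) | V z.1] dom flow_point.
Proof.
have [_ ch1 _] := st_chart st.
have u0 q u : V q -> flow_u 0 q u = u.
  by move=> Vq; rewrite /flow_u flow0// subrK mulrA expNK mul1r.
split.
- exact: open_dom.
- by move=> e z [].
- by move=> z Vz; split=> //=; rewrite addr0; have [] := ch1 _ Vz.
- by move=> e z fz; have [] := flow_V fz.
- exact: smooth_flow_point.
- by move=> [q u] Vq; rewrite /flow_point /= flow0// u0.
- move=> b a [q u] fa0 _ fab0; have fa : flow_dom a q := fa0; have fab : flow_dom (b + a) q := fab0.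
  rewrite /flow_point /= (flow_comp fa fab).
  by rewrite /flow_u (flow_comp fa fab) mulrA (mulrC (expR (- _))) expNK mul1r addrK.
- move=> e [q u] fe0; have fe : flow_dom e q := fe0; have [Vq _] := fe; have [VF TF WF] := flow_V fe.
  have fN : flow_dom (- e) (flow e q).
    by split=> //; rewrite TF WF addrK; have [] := ch1 _ Vq.
  have fd0 : flow_dom (- e + e) q by rewrite addNr; split=> //; rewrite addr0; have [] := ch1 _ Vq.
  split; first exact: fN.
  rewrite /flow_point /= (flow_comp fe fd0).
  rewrite /flow_u (flow_comp fe fd0) mulrA (mulrC (expR (- _))) expNK mul1r addrK addNr (flow0 Vq) subrK.
  by rewrite mulrA expNK mul1r.
Qed.

Definition flow_generator (z : varspace (scalars R)) : varspace (scalars R) :=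
  (tau z.1 : R) *: reduction_op g1 g2 g3 z.

Let flow_derive z : V z.1 ->
  is_derive (0 : R^o) (1 : R^o) (fun e : R^o => flow_point (e, z)) (flow_generator z).
Proof.
case: z => q u /= Vq; have oV' := oV.
have [sZ ch1 ch2] := st_chart st; have [bq ZE] := ch1 q Vq.
(* The constant value of [v] along the orbit. The orbit is then the lift by [H] of the T-line
   through [q], and its velocity follows from the chain rule. *)
pose c := expR (- n q) * u - k q.
pose hu (y : plane R) : R^o := expR (n y) * (c + k y).
pose H (y : plane R) : varspace (scalars R) := (y, hu y).
have shu : smooth_on V hu by rewrite /hu; smooth.
have dhu := smooth_diff shu Vq.
have dH : differentiable H q by apply: differentiable_pair.
have dZ := smooth_diff sZ bq.
have dHZ : differentiable (fun z => H (Z z)) (T q, W q).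
  by apply: (@differentiable_comp _ _ _ _ Z H) => //; rewrite ZE.
have bq' : (T q, W q) + (0 : R) *: ((1, 0) : plane R) = (T q, W q) by rewrite scale0r addr0.
have K := @is_derive_line R (plane R) (varspace (scalars R)) (fun z => H (Z z)) (T q, W q) (1, 0) 0.
rewrite bq' in K.
have {}K := K (diff_derivable dHZ).
have Ef : (fun e : R^o => flow_point (e, (q, u))) = (fun t : R => H (Z ((T q, W q) + t *: ((1, 0) : plane R)))).
  apply/funext => e; rewrite /flow_point /flow /flow_u /flow /H /hu /c /=.
  by have -> : ((T q, W q) : plane R) + e *: ((1, 0) : plane R) = (T q + e, W q)
    by apply/pair_equal_spec; split=> /=; rewrite ?scaler0 ?addr0// [_ *: 1]mulr1.
rewrite Ef; suff <- : 'D_((1, 0) : plane R) (fun z => H (Z z)) (T q, W q) = flow_generator (q, u) by exact: K.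
rewrite (derive_comp _ dZ); last by rewrite ZE.
rewrite (straightened_dZ st)// ZE /= !mul1r mul0r addr0.
rewrite derive_pair// derive_id.
have Hd v : hasD V v hu (fun y => expR (n y) * 'D_v n y * (c + k y) + expR (n y) * (0 + 'D_v k y)).
  by rewrite /hu; hasD.
rewrite (Hd _).2//; apply/pair_equal_spec; split=> /=.
  by apply/pair_equal_spec; split=> //=; rewrite [_ *: 1]mulr1.
rewrite !derive_plane; [|exact: smooth_diff sk Vq|exact: smooth_diff sn Vq].
have En := Rn Vq; have Ek := Rk Vq; have Ee := expNK (n q).
rewrite /GRing.scale /= /c.
transitivity (expR (n q) * (tau q * (Dt n q + g1 q * Dx n q)) * (expR (- n q) * u - k q + k q) +
  expR (n q) * (tau q * (Dt k q + g1 q * Dx k q))).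
  move: (Dt n q) (Dx n q) (Dt k q) (Dx k q) => *; ring.
rewrite En Ek subrK.
transitivity (tau q * ((expR (n q) * expR (- n q)) * (g2 q * u + g3 q))); first by ring.
by rewrite Ee mul1r.
Qed.

Let flow_point_symmetry e : point_symmetry (eqL A B C) [set z | dom (e, z)] (fun z => flow_point (e, z)).
Proof.
move=> p g h /= fp [Og [oOg Ogp sg']] [Oh [oOh Ohp sh]] [_ contact] Lg.
suff : Lop A B C h (flow e p) = 0.
  rewrite /eqL /Lop => E0; apply/eqP; rewrite -subr_eq0 -E0; apply/eqP.
  move: (Dt h _) (Dx h _) (Dx (Dx h) _) => *; ring.
apply: (flow_symmetry fp oOg Ogp sg' oOh Ohp sh).
- split.
  + exact: (contact [::]).
  + by rewrite !DtE; exact: (contact [:: (1, 0)]).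
  + by rewrite !DxE; exact: (contact [:: (0, 1)]).
  + exact: (contact [:: (0, 1); (0, 1)]).
- rewrite /eqL in Lg; rewrite /Lop Lg.
  move: (Dx g _) (Dx (Dx g) _) => *; ring.
Qed.

Theorem flow_Lie : Lie_invariance_operator (eqL A B C) [set z : varspace (scalars R) | V z.1] flow_generator.
Proof. by exists dom, flow_point; split; [exact: flow_group|exact: flow_derive|exact: flow_point_symmetry]. Qed.

End Flow.
End FlowSymmetry.

(** * Transport of germs by a one-parameter group *)

Section Contact.
Variable R : realType.

(** Contact is stated for all directions; by linearity in the direction and symmetry of second
    derivatives it comes down to six partial derivatives. *)
Lemma iterD_le2 (O : set (plane R)) (u1 u2 : plane R -> R^o) p : open O -> O p ->
  smooth_on O u1 -> smooth_on O u2 ->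
  u1 p = u2 p -> Dt u1 p = Dt u2 p -> Dx u1 p = Dx u2 p -> Dt (Dt u1) p = Dt (Dt u2) p ->
  Dt (Dx u1) p = Dt (Dx u2) p -> Dx (Dx u1) p = Dx (Dx u2) p ->
  forall s : seq (plane R), (size s <= 2)%N -> Defs.iterD s u1 p = Defs.iterD s u2 p.
Proof.
move=> oO Op s1 s2 e0 et ex ett etx exx.
have D1 u (v : plane R) q : smooth_on O u -> O q -> 'D_v u q = v.1 * Dt u q + v.2 * Dx u q.
  by move=> su Oq; exact: (derive_plane v (smooth_diff su Oq)).
have D2 u (v v' : plane R) : smooth_on O u -> 'D_v' ('D_v u) p =
    v'.1 * (v.1 * Dt (Dt u) p + v.2 * Dt (Dx u) p) + v'.2 * (v.1 * Dt (Dx u) p + v.2 * Dx (Dx u) p).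
  move=> su; have sDu : smooth_on O (fun q => v.1 * Dt u q + v.2 * Dx u q) by smooth.
  rewrite (derive_on v' oO Op (fun q Oq => D1 u v q su Oq)) (D1 _ _ _ sDu Op).
  derive_at Ht (Dt (fun q => v.1 * Dt u q + v.2 * Dx u q) p) Op.
  derive_at Hx (Dx (fun q => v.1 * Dt u q + v.2 * Dx u q) p) Op.
  rewrite Ht Hx (DtDx_comm oO su Op).
  move: (Dt (Dt u) p) (Dt (Dx u) p) (Dx (Dx u) p) (Dt u p) (Dx u p) => *; ring.
have cg (v v' : plane R) (x y z x' y' z' : R) : x = x' -> y = y' -> z = z' ->
    v'.1 * (v.1 * x + v.2 * y) + v'.2 * (v.1 * y + v.2 * z) =
    v'.1 * (v.1 * x' + v.2 * y') + v'.2 * (v.1 * y' + v.2 * z') by move=> -> -> ->.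
case=> [_|v s]; first exact: e0.
case: s => [_|v' s].
  exact: etrans (D1 u1 v p s1 Op) (etrans (congr2 (fun x y => v.1 * x + v.2 * y) et ex) (esym (D1 u2 v p s2 Op))).
case: s => [_|v'' s lt]; last by exfalso; move: lt.
exact: etrans (D2 u1 v' v s1) (etrans (cg v' v _ _ _ _ _ _ ett etx exx) (esym (D2 u2 v' v s2))).
Qed.

(** The map [q -> (q.1, a q)] need not be inverted: contact concerns one 2-jet, and a quadratic
    polynomial with the right coefficients realizes it on the whole plane. The coefficients solve a
    triangular system because [Dx a p] is nonzero. *)
Lemma contact_exists (O : set (plane R)) (a G : plane R -> R^o) p : open O -> O p ->
  smooth_on O a -> smooth_on O G -> Dx a p != 0 ->
  exists h : plane R -> R^o, [/\ smooth_on setT h,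
    forall s : seq (plane R), (size s <= 2)%N ->
      Defs.iterD s (fun q => h (q.1, a q)) p = Defs.iterD s G p,
    h (p.1, a p) = G p /\ Dt h (p.1, a p) = Dt G p - Dx G p / Dx a p * Dt a p,
    Dx h (p.1, a p) = Dx G p / Dx a p &
    Dx (Dx h) (p.1, a p) = (Dx (Dx G) p - Dx G p / Dx a p * Dx (Dx a) p) / (Dx a p * Dx a p)].
Proof.
move=> oO Op sa sG k0.
set k := Dx a p in k0 *; set l := Dt a p.
(* The values of [h_x], [h_t], [h_xx], [h_tx], [h_tt] obtained in turn from the chain rule for
   [G = h (t, a)]. *)
set c1 := Dx G p / k; pose c2 : R^o := Dt G p - c1 * l.
set c11 := (Dx (Dx G) p - c1 * Dx (Dx a) p) / (k * k).
pose c12 : R^o := (Dt (Dx G) p - Dt (Dx a) p * c1 - k * l * c11) / k.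
pose c22 : R^o := Dt (Dt G) p - Dt (Dt a) p * c1 - l * l * c11 - 2%:R * l * c12.
pose t0 := p.1; pose a0 := a p; pose G0 := G p.
have oT := @openT (plane R).
pose h (q : plane R) : R^o := G0 + (q.2 - a0) * c1 + (q.1 - t0) * c2 +
  (q.2 - a0) * (q.2 - a0) * (c11 / 2%:R) + (q.2 - a0) * (q.1 - t0) * c12 +
  (q.1 - t0) * (q.1 - t0) * (c22 / 2%:R).
have sh : smooth_on setT h by rewrite /h; smooth.
pose P := (t0, a0) : plane R.
have TP : setT P by [].
exists h.
have hx q : setT q -> Dx h q = c1 + (q.2 - a0) * c11 + (q.1 - t0) * c12.
  move=> Tq; derive_at H (Dx (fun q : plane R => G0 + (q.2 - a0) * c1 + (q.1 - t0) * c2 +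
    (q.2 - a0) * (q.2 - a0) * (c11 / 2%:R) + (q.2 - a0) * (q.1 - t0) * c12 +
    (q.1 - t0) * (q.1 - t0) * (c22 / 2%:R)) q) Tq.
  by rewrite [LHS]H; move: (q.1) (q.2) => x y /=; field.
derive_at hxx (Dx (fun q : plane R => c1 + (q.2 - a0) * c11 + (q.1 - t0) * c12) P) TP.
derive_at ht (Dt (fun q : plane R => G0 + (q.2 - a0) * c1 + (q.1 - t0) * c2 +
    (q.2 - a0) * (q.2 - a0) * (c11 / 2%:R) + (q.2 - a0) * (q.1 - t0) * c12 +
    (q.1 - t0) * (q.1 - t0) * (c22 / 2%:R)) P) TP.
split=> //; last 1 first.
- by rewrite (Dx_on oT TP hx) hxx /=; ring.
- pose H (q : plane R) : R^o := G0 + (a q - a0) * c1 + (q.1 - t0) * c2 +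
    (a q - a0) * (a q - a0) * (c11 / 2%:R) + (a q - a0) * (q.1 - t0) * c12 +
    (q.1 - t0) * (q.1 - t0) * (c22 / 2%:R).
  have sH : smooth_on O H by rewrite /H; smooth.
  have Ht q : O q -> Dt H q = Dt a q * c1 + c2 + Dt a q * (a q - a0) * c11 +
      (Dt a q * (q.1 - t0) + (a q - a0)) * c12 + (q.1 - t0) * c22.
    move=> Oq; derive_at E (Dt (fun q : plane R => G0 + (a q - a0) * c1 + (q.1 - t0) * c2 +
      (a q - a0) * (a q - a0) * (c11 / 2%:R) + (a q - a0) * (q.1 - t0) * c12 +
      (q.1 - t0) * (q.1 - t0) * (c22 / 2%:R)) q) Oq.
    by rewrite [LHS]E; move: (q.1) (a q) (Dt a q) => x y z /=; field.
  have Hx q : O q -> Dx H q = Dx a q * c1 + Dx a q * (a q - a0) * c11 + Dx a q * (q.1 - t0) * c12.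
    move=> Oq; derive_at E (Dx (fun q : plane R => G0 + (a q - a0) * c1 + (q.1 - t0) * c2 +
      (a q - a0) * (a q - a0) * (c11 / 2%:R) + (a q - a0) * (q.1 - t0) * c12 +
      (q.1 - t0) * (q.1 - t0) * (c22 / 2%:R)) q) Oq.
    by rewrite [LHS]E; move: (q.1) (a q) (Dx a q) => x y z /=; field.
  derive_at Htt (Dt (fun q : plane R => Dt a q * c1 + c2 + Dt a q * (a q - a0) * c11 +
      (Dt a q * (q.1 - t0) + (a q - a0)) * c12 + (q.1 - t0) * c22) p) Op.
  derive_at Htx (Dt (fun q : plane R => Dx a q * c1 + Dx a q * (a q - a0) * c11 + Dx a q * (q.1 - t0) * c12) p) Op.
  derive_at Hxx (Dx (fun q : plane R => Dx a q * c1 + Dx a q * (a q - a0) * c11 + Dx a q * (q.1 - t0) * c12) p) Op.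
  apply: (iterD_le2 oO Op sH sG).
  + by rewrite /H /a0 /t0 /G0 !subrr !mul0r !addr0.
  + rewrite Ht// /a0 /t0 !subrr -/l !mulr0 !mul0r !addr0 /c2; ring.
  + by rewrite Hx// /a0 /t0 !subrr -/k !mulr0 !mul0r !addr0 /c1; field.
  + rewrite (Dt_on oO Op Ht) Htt /a0 /t0 !subrr -/l /c22 /=.
    generalize (Dt (Dt a) p) (Dt (Dt G) p) l c1 c11 c12 => *; ring.
  + rewrite (Dt_on oO Op Hx) Htx /a0 /t0 !subrr -/l -/k /c12 /=.
    by move: k0; generalize (Dt (Dx a) p) (Dt (Dx G) p) l k c1 c11 => ? ? ? ? ? ? ?; field.
  + rewrite (Dx_on oO Op Hx) Hxx /a0 /t0 !subrr -/k /c11 /=.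
    by move: k0; generalize (Dx (Dx a) p) (Dx (Dx G) p) k c1 c12 => ? ? ? ? ? ?; field.
- split; first by rewrite /h /= !subrr !mul0r !addr0.
  rewrite [LHS]ht /= -/l /c2; ring.
- by rewrite hx//= !subrr !mul0r !addr0.
Qed.
End Contact.

(** * Local groups and their generators *)

Section Generator.
Variable R : realType.
Variables (E : normedModType R) (M : set E) (D : set (R^o * E)) (Phi : R^o * E -> E) (Q : E -> E).
Hypothesis fE : findim E.
Hypothesis oM : open M.
Hypothesis lg : local_group M D Phi.
Hypothesis gen : forall z, M z -> is_derive (0 : R^o) (1 : R^o) (fun e : R^o => Phi (e, z)) (Q z).

Lemma near_line (S : set (R^o * E)) (e : R^o) (z : E) : open S -> S (e, z) ->
  \forall s \near (0 : R), S (s + e, z).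
Proof.
move=> oS Sez.
have c : {for (0 : R), continuous (fun s : R => (s + e, z) : R^o * E)}.
  apply: differentiable_continuous; apply: differentiable_pair; last exact: differentiable_cst.
  by apply: differentiableD; [exact: ex_diff|exact: differentiable_cst].
by apply: c; apply: open_nbhs_nbhs; rewrite add0r.
Qed.

(** The generator gives the velocity at parameter 0 only; the identity
    [Phi (s + e, z) = Phi (s, Phi (e, z))] for small [s] carries it to every parameter. *)
Lemma derive_group e z : D (e, z) -> 'D_((1, 0) : R^o * E) Phi (e, z) = Q (Phi (e, z)).
Proof.
move=> Dez; have My := lg_cod lg Dez; have D0 := lg_zero lg My.
have dPhi := smooth_diff (lg_smooth lg) Dez.
have K := @is_derive_line R (R^o * E)%type E Phi (e, z) (1, 0) 0.
have e0 : ((e, z) : R^o * E) + (0 : R) *: ((1, 0) : R^o * E) = (e, z) by rewrite scale0r addr0.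
rewrite e0 in K; have [_ <-] := K (diff_derivable dPhi).
have [_ <-] := gen My; apply: near_eq_derive.
have N1 := near_line (lg_open lg) D0; have N2 := near_line (lg_open lg) Dez.
near=> s.
have -> : ((e, z) : R^o * E) + s *: ((1, 0) : R^o * E) = (s + e, z).
  by apply/pair_equal_spec; split=> /=; rewrite ?scaler0 ?addr0// [_ *: 1]mulr1 addrC.
apply/esym; apply: (lg_comp lg) => //; first by rewrite -[s]addr0; near: s.
by near: s.
Unshelve. all: by end_near. Qed.

Lemma derive_group0 z : M z -> 'D_((1, 0) : R^o * E) Phi (0, z) = Q z.
Proof. by move=> Mz; rewrite derive_group ?(lg_id lg Mz)//; exact: lg_zero lg _ Mz. Qed.

(** [Q] is the parameter derivative of the smooth map [Phi] at parameter 0. *)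
Lemma smooth_generator : smooth_on M Q.
Proof.
apply: (smooth_eq_on oM derive_group0).
have sp : smooth_on M (fun z : E => (0, z) : R^o * E).
  apply: smooth_pair => //; first exact: smooth_cst.
  by apply: smooth_linear => // x; exact: cvg_id.
have fRE := findim_prod (findim_scalar R) fE.
apply: (@smooth_comp _ _ _ _ M D ('D_((1, 0) : R^o * E) Phi) (fun z : E => (0, z) : R^o * E) fRE oM _ _ sp).
  by move=> z Mz; exact: lg_zero lg _ Mz.
by apply: smooth_derive; exact: lg_smooth lg.
Qed.

(** Along orbits the derivative of [l] is [l (Q _)], which is zero. A ball in [D] is taken because
    it contains the parameter segment from 0, whereas the parameters allowed at a point need not
    form an interval. With [l] the t-coordinate, the group keeps [t]. *)
Lemma group_preserves (l : E -> R^o) z : linear l -> continuous l ->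
  (forall z, M z -> l (Q z) = 0) -> M z ->
  exists S : set (R^o * E), [/\ open S, S (0, z), S `<=` D & forall ez, S ez -> l (Phi ez) = l ez.2].
Proof.
move=> ll cl lQ Mz; have D0 := lg_zero lg Mz.
have /nbhs_ballP[r /= r0 Hr] := open_nbhs_nbhs (conj (lg_open lg) D0).
exists (ball (0, z) r); split=> //; first exact: ball_open.
  exact: ballxx.
move=> [e y] bey.
have oB : open (ball ((0, z) : R^o * E) r) by exact: ball_open.
have sl : smooth_on setT l by apply: smooth_linear => //; exact: openT.
have sf : smooth_on (ball ((0, z) : R^o * E) r) (fun ez => l (Phi ez)).
  by apply: (smooth_comp fE oB _ sl) => //; apply: smooth_sub (lg_smooth lg).
have seg (s : R) : `|s| <= `|e| -> ball ((0, z) : R^o * E) r ((0, y) + s *: ((1, 0) : R^o * E)).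
  move: bey; rewrite /ball /= /prod_ball /= scaler0 !addr0 add0r [_ *: 1]mulr1 => -[b1 b2] se.
  split=> //; move: b1; rewrite /ball /= !sub0r !normrN; exact: le_lt_trans.
have D1 ez : ball ((0, z) : R^o * E) r ez -> 'D_((1, 0) : R^o * E) (fun ez => l (Phi ez)) ez = 0.
  case: ez => e' y' b; have Dey := Hr _ b.
  rewrite (derive_comp _ (smooth_diff (lg_smooth lg) Dey)); last by have [] := linear_diff (Phi (e', y')) ll cl.
  by have [_ ->] := linear_diff (Phi (e', y')) ll cl; rewrite derive_group// lQ//; exact: lg_cod lg _ _ Dey.
have := const_line sf D1 seg.
have -> : ((0, y) : R^o * E) + e *: ((1, 0) : R^o * E) = (e, y).
  by apply/pair_equal_spec; split=> /=; rewrite ?scaler0 ?addr0// add0r [_ *: 1]mulr1.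
move=> ->; rewrite (lg_id lg)//; apply: (lg_dom lg (e := e)); exact: Hr.
Qed.
End Generator.

(** * Linearization of the first two equations in the group parameter *)

Section LinearizedEquations.
Variable R : realType.

(* [lin1] and [lin2] are the derivatives at [e = 0] of the first two equations
   of DE1 at the jet moved by a group of transformations fixing t. Here [u], [v]
   stand for g1, g2, and [X], [Y], [Z] for the coefficients of the generator at
   d_x, d_g1, d_g2; primes are derivatives in [e]. *)
Definition lin1 (a a' b b' al al' be be' bx bx' bt' Xx Xt Xxx u ux uxx Y Yx Yt Yxx vx Zx : R) : R :=
  (Yt - ux * Xt) - a * (Yxx - ux * Xxx - 2%:R * uxx * Xx) - a' * uxx -
    b * (Yx - ux * Xx) - b' * ux +
    (2%:R * (Yx - ux * Xx) - al' * u - al * Y - be') * (u + b) +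
    (2%:R * ux - al * u - be) * (Y + b') + bx' * u + bx * Y +
    2%:R * (a' * vx + a * (Zx - vx * Xx)) + bt'.

Definition lin2 (a a' b b' c c' al al' be be' cx cx' ct' Xx Xt Xxx u ux Y Yx v vx vxx Z Zx Zt Zxx : R) : R :=
  (Zt - vx * Xt) - a * (Zxx - vx * Xxx - 2%:R * vxx * Xx) - a' * vxx -
    b * (Zx - vx * Xx) - b' * vx +
    (2%:R * (Yx - ux * Xx) - al' * u - al * Y - be') * (v - c) +
    (2%:R * ux - al * u - be) * (Z - c') - cx' * u - cx * Y - ct'.

Lemma lin1_eq (a a' b b' al al' be be' bx bx' bt' Xx Xt Xxx u ux uxx Y Yx Yt Yxx vx Zx : R)
  (a_ a'_ b_ b'_ al_ al'_ be_ be'_ bx_ bx'_ bt'_ Xx_ Xt_ Xxx_ u_ ux_ uxx_ Y_ Yx_ Yt_ Yxx_ vx_ Zx_ : R) :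
  a = a_ -> a' = a'_ -> b = b_ -> b' = b'_ -> al = al_ -> al' = al'_ -> be = be_ -> be' = be'_ -> bx = bx_ -> bx' = bx'_ -> bt' = bt'_ -> Xx = Xx_ -> Xt = Xt_ -> Xxx = Xxx_ -> u = u_ -> ux = ux_ -> uxx = uxx_ -> Y = Y_ -> Yx = Yx_ -> Yt = Yt_ -> Yxx = Yxx_ -> vx = vx_ -> Zx = Zx_ ->
  lin1 a a' b b' al al' be be' bx bx' bt' Xx Xt Xxx u ux uxx Y Yx Yt Yxx vx Zx = 0 ->
  lin1 a_ a'_ b_ b'_ al_ al'_ be_ be'_ bx_ bx'_ bt'_ Xx_ Xt_ Xxx_ u_ ux_ uxx_ Y_ Yx_ Yt_ Yxx_ vx_ Zx_ = 0.
Proof. by move=> -> -> -> -> -> -> -> -> -> -> -> -> -> -> -> -> -> -> -> -> -> -> ->. Qed.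

Lemma lin2_eq (a a' b b' c c' al al' be be' cx cx' ct' Xx Xt Xxx u ux Y Yx v vx vxx Z Zx Zt Zxx : R)
  (a_ a'_ b_ b'_ c_ c'_ al_ al'_ be_ be'_ cx_ cx'_ ct'_ Xx_ Xt_ Xxx_ u_ ux_ Y_ Yx_ v_ vx_ vxx_ Z_ Zx_ Zt_ Zxx_ : R) :
  a = a_ -> a' = a'_ -> b = b_ -> b' = b'_ -> c = c_ -> c' = c'_ -> al = al_ -> al' = al'_ -> be = be_ -> be' = be'_ -> cx = cx_ -> cx' = cx'_ -> ct' = ct'_ -> Xx = Xx_ -> Xt = Xt_ -> Xxx = Xxx_ -> u = u_ -> ux = ux_ -> Y = Y_ -> Yx = Yx_ -> v = v_ -> vx = vx_ -> vxx = vxx_ -> Z = Z_ -> Zx = Zx_ -> Zt = Zt_ -> Zxx = Zxx_ ->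
  lin2 a a' b b' c c' al al' be be' cx cx' ct' Xx Xt Xxx u ux Y Yx v vx vxx Z Zx Zt Zxx = 0 ->
  lin2 a_ a'_ b_ b'_ c_ c'_ al_ al'_ be_ be'_ cx_ cx'_ ct'_ Xx_ Xt_ Xxx_ u_ ux_ Y_ Yx_ v_ vx_ vxx_ Z_ Zx_ Zt_ Zxx_ = 0.
Proof. by move=> -> -> -> -> -> -> -> -> -> -> -> -> -> -> -> -> -> -> -> -> -> -> -> -> -> -> ->. Qed.

Section Curve.
Variables (I : set R^o) (k l m k' l' m' : R^o -> R^o).
Hypotheses (oI : open I) (I0 : I 0).
Hypotheses (hk : hasD I (1 : R^o) k k') (hl : hasD I (1 : R^o) l l') (hm : hasD I (1 : R^o) m m').
Hypotheses (k0 : k 0 = 1) (l0 : l 0 = 0) (m0 : m 0 = 0).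
Hypothesis kn0 : forall e, I e -> k e != 0.

Lemma curve_zero (F F' : R^o -> R^o) : hasD I (1 : R^o) F F' -> (forall e, I e -> F e = 0) -> F' 0 = 0.
Proof.
move=> [_ <-//] FO; rewrite (derive_on _ oI I0 (g := cst 0))//.
exact: derive_cst.
Qed.

(** Here [k], [l], [m] stand for the x-, t- and xx-derivatives of the moved x-coordinate, with
    values 1, 0, 0 at the identity. The assumed equation is the first one of [DE1] for the moved
    germ, its derivatives being expressed through the chain rule. *)
Lemma linearize1 (u ux ut uxx zx a b al be bx bt u' ux' ut' uxx' zx' a' b' al' be' bx' bt' : R^o -> R^o) :
  hasD I (1 : R^o) u u' -> hasD I (1 : R^o) ux ux' -> hasD I (1 : R^o) ut ut' -> hasD I (1 : R^o) uxx uxx' ->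
  hasD I (1 : R^o) zx zx' -> hasD I (1 : R^o) a a' -> hasD I (1 : R^o) b b' ->
  hasD I (1 : R^o) al al' -> hasD I (1 : R^o) be be' -> hasD I (1 : R^o) bx bx' -> hasD I (1 : R^o) bt bt' ->
  (forall e, I e -> (ut e - ux e / k e * l e) - a e * ((uxx e - ux e / k e * m e) / (k e * k e)) -
     b e * (ux e / k e) + (2%:R * (ux e / k e) - al e * u e - be e) * (u e + b e) + bx e * u e +
     2%:R * a e * (zx e / k e) + bt e = 0) ->
  lin1 (a 0) (a' 0) (b 0) (b' 0) (al 0) (al' 0) (be 0) (be' 0) (bx 0) (bx' 0) (bt' 0)
    (k' 0) (l' 0) (m' 0) (u 0) (ux 0) (uxx 0) (u' 0) (ux' 0) (ut' 0) (uxx' 0) (zx 0) (zx' 0) = 0.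
Proof.
move=> hu hux hut huxx hzx ha hb hal hbe hbx hbt eq0.
have kk0 e : I e -> k e * k e != 0 by move=> /kn0 ke; rewrite mulf_neq0.
eassert (H : hasD I (1 : R^o) (fun e => (ut e - ux e / k e * l e) - a e * ((uxx e - ux e / k e * m e) / (k e * k e)) -
     b e * (ux e / k e) + (2%:R * (ux e / k e) - al e * u e - be e) * (u e + b e) + bx e * u e +
     2%:R * a e * (zx e / k e) + bt e) _) by hasD.
have E := curve_zero H eq0; cbv beta in E; rewrite k0 l0 m0 in E; apply: etrans E; rewrite /lin1; by field.
Qed.

Lemma linearize2 (u z ux zt zx zxx a b c al be cx ct u' z' ux' zt' zx' zxx' a' b' c' al' be' cx' ct' : R^o -> R^o) :
  hasD I (1 : R^o) u u' -> hasD I (1 : R^o) z z' -> hasD I (1 : R^o) ux ux' -> hasD I (1 : R^o) zt zt' ->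
  hasD I (1 : R^o) zx zx' -> hasD I (1 : R^o) zxx zxx' -> hasD I (1 : R^o) a a' -> hasD I (1 : R^o) b b' ->
  hasD I (1 : R^o) c c' ->
  hasD I (1 : R^o) al al' -> hasD I (1 : R^o) be be' -> hasD I (1 : R^o) cx cx' -> hasD I (1 : R^o) ct ct' ->
  (forall e, I e -> (zt e - zx e / k e * l e) - a e * ((zxx e - zx e / k e * m e) / (k e * k e)) -
     b e * (zx e / k e) + (2%:R * (ux e / k e) - al e * u e - be e) * (z e - c e) - cx e * u e - ct e = 0) ->
  lin2 (a 0) (a' 0) (b 0) (b' 0) (c 0) (c' 0) (al 0) (al' 0) (be 0) (be' 0) (cx 0) (cx' 0) (ct' 0)
    (k' 0) (l' 0) (m' 0) (u 0) (ux 0) (u' 0) (ux' 0) (z 0) (zx 0) (zxx 0) (z' 0) (zx' 0) (zt' 0) (zxx' 0) = 0.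
Proof.
move=> hu hz hux hzt hzx hzxx ha hb hc hal hbe hcx hct eq0.
have kk0 e : I e -> k e * k e != 0 by move=> /kn0 ke; rewrite mulf_neq0.
eassert (H : hasD I (1 : R^o) (fun e => (zt e - zx e / k e * l e) - a e * ((zxx e - zx e / k e * m e) / (k e * k e)) -
     b e * (zx e / k e) + (2%:R * (ux e / k e) - al e * u e - be e) * (z e - c e) - cx e * u e - ct e) _) by hasD.
have E := curve_zero H eq0; cbv beta in E; rewrite k0 l0 m0 in E; apply: etrans E; rewrite /lin2; by field.
Qed.
End Curve.

Section Slices.
Variables (O : set (R^o * plane R)) (F : R^o * plane R -> R^o).
Hypotheses (oO : open O) (sF : smooth_on O F).

Lemma smooth_inr (e : R^o) (U : set (plane R)) : open U -> smooth_on U (fun q : plane R => (e, q) : R^o * plane R).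
Proof.
move=> oU; apply: smooth_pair => //; first exact: smooth_cst.
by apply: smooth_linear => // x; exact: cvg_id.
Qed.

Lemma open_slice (e : R^o) : open [set q | O (e, q)].
Proof.
have oT := @openT (plane R).
rewrite (_ : [set q | _] = [set q | setT q /\ O (e, q)]); last first.
  by apply/seteqP; split=> q /=; [split|case].
exact: (open_preimage_on oT oO (fun q Tq => smooth_cont (smooth_inr e oT) Tq)).
Qed.

Lemma findim_Rplane : findim (R^o * plane R)%type.
Proof. exact: findim_prod (findim_scalar R) (findim_plane R). Qed.

Lemma smooth_slice (e : R^o) : smooth_on [set q | O (e, q)] (fun q => F (e, q)).
Proof.
have os := @open_slice e.
exact: (smooth_comp findim_Rplane os (fun q Oq => Oq) sF (smooth_inr e os)).
Qed.

Lemma derive_slice (e : R^o) q u : O (e, q) ->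
  'D_u (fun q => F (e, q)) q = 'D_((0, u) : R^o * plane R) F (e, q).
Proof.
move=> Oq; have os := @open_slice e.
rewrite (derive_comp u (smooth_diff (smooth_inr e os) Oq) (smooth_diff sF Oq)).
by rewrite derive_pair ?derive_cst ?derive_id//; exact: differentiable_cst.
Qed.

Lemma hasD_curve (I : set R^o) (p : plane R) : open I -> (forall e, I e -> O (e, p)) ->
  hasD I (1 : R^o) (fun e => F (e, p)) (fun e => 'D_((1, 0) : R^o * plane R) F (e, p)).
Proof.
move=> oI IO.
have si : smooth_on I (fun e : R^o => (e, p) : R^o * plane R).
  by apply: smooth_pair => //; [apply: smooth_linear => // x; exact: cvg_id|exact: smooth_cst].
have Dp e : 'D_(1 : R^o) (fun e : R^o => (e, p) : R^o * plane R) e = (1, 0).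
  by rewrite derive_pair ?derive_cst ?derive_id//; exact: differentiable_cst.
have [s E] := hasD_comp (1 : R^o) findim_Rplane oI IO sF si; split; first exact: s.
by move=> e Ie; apply: etrans (E e Ie) _; rewrite Dp.
Qed.
End Slices.
End LinearizedEquations.

(** * Moved germs: values and first variations at the identity *)

Section Pushforward.
Variable R : realType.
Variables (O : set (R^o * plane R)).
Hypothesis oO : open O.
Implicit Types (F : R^o * plane R -> R^o) (f X : plane R -> R^o) (p u v : plane R).

Lemma slice_value F f p u : smooth_on O F -> O (0, p) ->
  (forall q, O (0, q) -> F (0, q) = f q) -> 'D_((0, u) : R^o * plane R) F (0, p) = 'D_u f p.
Proof.
move=> sF Op F0; apply: etrans (esym (derive_slice oO sF u Op)) _.
exact: (@derive_on R (plane R) R^o [set q | O (0, q)] (fun q => F (0, q)) f u p (@open_slice _ _ oO 0) Op F0).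
Qed.

Lemma slice_value2 F f p u v : smooth_on O F -> O (0, p) ->
  (forall q, O (0, q) -> F (0, q) = f q) ->
  'D_((0, u) : R^o * plane R) ('D_((0, v) : R^o * plane R) F) (0, p) = 'D_u ('D_v f) p.
Proof.
by move=> sF Op F0; apply: (@slice_value ('D_((0, v) : R^o * plane R) F) ('D_v f) p u (smooth_derive _ sF) Op) => q Oq; exact: slice_value.
Qed.

(** Symmetry of second derivatives exchanges the parameter with the plane variables. This turns the
    prolongation of the group into derivatives of the coefficients of its generator. *)
Lemma slice_mixed F X p u : smooth_on O F -> O (0, p) ->
  (forall q, O (0, q) -> 'D_((1, 0) : R^o * plane R) F (0, q) = X q) ->
  'D_((1, 0) : R^o * plane R) ('D_((0, u) : R^o * plane R) F) (0, p) = 'D_u X p.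
Proof.
move=> sF Op FX; apply: etrans (@schwarz R (R^o * plane R)%type O F (0, p) (1, 0) (0, u) oO Op sF) _.
exact: (@slice_value ('D_((1, 0) : R^o * plane R) F) X p u (smooth_derive _ sF) Op FX).
Qed.

Lemma slice_mixed2 F X p u v : smooth_on O F -> O (0, p) ->
  (forall q, O (0, q) -> 'D_((1, 0) : R^o * plane R) F (0, q) = X q) ->
  'D_((1, 0) : R^o * plane R) ('D_((0, u) : R^o * plane R) ('D_((0, v) : R^o * plane R) F)) (0, p) = 'D_u ('D_v X) p.
Proof.
by move=> sF Op FX; apply: (@slice_mixed ('D_((0, v) : R^o * plane R) F) ('D_v X) p u (smooth_derive _ sF) Op) => q Oq; exact: slice_mixed.
Qed.

Lemma hasD_along (Om : set (plane R)) (a : plane R -> R^o) (I : set R^o) (p : plane R)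
  (y y' : R^o -> R^o) : smooth_on Om a -> open I -> (forall e, I e -> Om (p.1, y e)) ->
  hasD I (1 : R^o) y y' -> hasD I (1 : R^o) (fun e => a (p.1, y e)) (fun e => Dx a (p.1, y e) * y' e).
Proof.
move=> sa oI IO [sy ey].
have sc : smooth_on I (fun e => (p.1, y e) : plane R) by apply: smooth_pair => //; exact: smooth_cst.
have [s E] := hasD_comp (1 : R^o) (findim_plane R) oI IO sa sc; split; first exact: s.
move=> e Ie; apply: etrans (E e Ie) _.
have -> : 'D_(1 : R^o) (fun e => (p.1, y e) : plane R) e = (0, y' e).
  rewrite -(ey e Ie) derive_pair ?derive_cst//; exact: smooth_diff Ie.
apply: etrans (derive_plane _ (smooth_diff sa (IO e Ie))) _.
by rewrite /= scale0r add0r [RHS]mulrC.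
Qed.

Local Notation ddx := ((0, ((0, 1) : plane R)) : R^o * plane R).
Local Notation ddt := ((0, ((1, 0) : plane R)) : R^o * plane R).

Lemma slice_contact F (G : R^o * plane R -> R^o) e p : smooth_on O F -> smooth_on O G ->
  O (e, p) -> 'D_ddx F (e, p) != 0 ->
  exists h : plane R -> R^o, [/\ smooth_on setT h,
    forall s : seq (plane R), (size s <= 2)%N ->
      Defs.iterD s (fun q => h (q.1, F (e, q))) p = Defs.iterD s (fun q => G (e, q)) p,
    h (p.1, F (e, p)) = G (e, p) /\
    Dt h (p.1, F (e, p)) = 'D_ddt G (e, p) - 'D_ddx G (e, p) / 'D_ddx F (e, p) * 'D_ddt F (e, p),
    Dx h (p.1, F (e, p)) = 'D_ddx G (e, p) / 'D_ddx F (e, p) &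
    Dx (Dx h) (p.1, F (e, p)) =
      ('D_ddx ('D_ddx G) (e, p) - 'D_ddx G (e, p) / 'D_ddx F (e, p) * 'D_ddx ('D_ddx F) (e, p)) /
      ('D_ddx F (e, p) * 'D_ddx F (e, p))].
Proof.
move=> sF sG Op k0.
have Sx (H : R^o * plane R -> R^o) (q : plane R) : smooth_on O H -> O (e, q) -> Dx (fun q => H (e, q)) q = 'D_ddx H (e, q).
  by move=> sH Oq; rewrite DxE; exact: (@derive_slice R O H oO sH e q ((0, 1) : plane R) Oq).
have St (H : R^o * plane R -> R^o) (q : plane R) : smooth_on O H -> O (e, q) -> Dt (fun q => H (e, q)) q = 'D_ddt H (e, q).
  by move=> sH Oq; rewrite DtE; exact: (@derive_slice R O H oO sH e q ((1, 0) : plane R) Oq).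
have Sxx (H : R^o * plane R -> R^o) : smooth_on O H -> Dx (Dx (fun q => H (e, q))) p = 'D_ddx ('D_ddx H) (e, p).
  move=> sH; apply: etrans (@Dx_on R [set q | O (e, q)] _ ('D_ddx H \o pair e) p (@open_slice _ _ oO e) Op (fun q Oq => Sx H q sH Oq)) _.
  exact: Sx (smooth_derive _ sH) Op.
have k1 : Dx (fun q => F (e, q)) p != 0 by rewrite (Sx F p sF Op).
have [h [sh ct [hv ht] hx hxx]] := @contact_exists R [set q | O (e, q)] _ _ p (@open_slice _ _ oO e) Op
  (@smooth_slice _ _ F oO sF e) (@smooth_slice _ _ G oO sG e) k1.
exists h; rewrite -(Sx F p sF Op) -(Sx G p sG Op) -(St F p sF Op) -(St G p sG Op).
by rewrite -(Sxx F sF) -(Sxx G sG); split=> //; split.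
Qed.

Section Equations.
Variables (Om : set (plane R)) (A B C : plane R -> R^o).
Hypothesis oOm : open Om.
Hypotheses (sA : smooth_on Om A) (sB : smooth_on Om B) (sC : smooth_on Om C).
Hypothesis A0 : forall q, Om q -> A q != 0.
Variables (F G1 G2 G3 : R^o * plane R -> R^o) (p : plane R).
Hypotheses (sF : smooth_on O F) (sG1 : smooth_on O G1) (sG2 : smooth_on O G2) (sG3 : smooth_on O G3).
Hypothesis Op : O (0, p).
Hypothesis OOm : forall e, O (e, p) -> Om (p.1, F (e, p)).
Hypothesis Fx0 : forall e, O (e, p) -> 'D_ddx F (e, p) != 0.
Hypothesis sym : forall e (h1 h2 h3 : plane R -> R^o), O (e, p) ->
  smooth_on setT h1 -> smooth_on setT h2 -> smooth_on setT h3 ->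
  (forall s : seq (plane R), (size s <= 2)%N -> [/\
      Defs.iterD s (fun q => h1 (q.1, F (e, q))) p = Defs.iterD s (fun q => G1 (e, q)) p,
      Defs.iterD s (fun q => h2 (q.1, F (e, q))) p = Defs.iterD s (fun q => G2 (e, q)) p &
      Defs.iterD s (fun q => h3 (q.1, F (e, q))) p = Defs.iterD s (fun q => G3 (e, q)) p]) ->
  DE1 A B C (fun q => (h1 q, h2 q, h3 q)) (p.1, F (e, p)).

Lemma pushed_equations e : O (e, p) ->
  ('D_ddt G1 (e, p) - 'D_ddx G1 (e, p) / 'D_ddx F (e, p) * 'D_ddt F (e, p)) -
    A (p.1, F (e, p)) * (('D_ddx ('D_ddx G1) (e, p) - 'D_ddx G1 (e, p) / 'D_ddx F (e, p) * 'D_ddx ('D_ddx F) (e, p)) /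
      ('D_ddx F (e, p) * 'D_ddx F (e, p))) -
    B (p.1, F (e, p)) * ('D_ddx G1 (e, p) / 'D_ddx F (e, p)) +
    (2%:R * ('D_ddx G1 (e, p) / 'D_ddx F (e, p)) - Dx A (p.1, F (e, p)) / A (p.1, F (e, p)) * G1 (e, p) -
      Dt A (p.1, F (e, p)) / A (p.1, F (e, p))) * (G1 (e, p) + B (p.1, F (e, p))) +
    Dx B (p.1, F (e, p)) * G1 (e, p) + 2%:R * A (p.1, F (e, p)) * ('D_ddx G2 (e, p) / 'D_ddx F (e, p)) +
    Dt B (p.1, F (e, p)) = 0 /\
  ('D_ddt G2 (e, p) - 'D_ddx G2 (e, p) / 'D_ddx F (e, p) * 'D_ddt F (e, p)) -
    A (p.1, F (e, p)) * (('D_ddx ('D_ddx G2) (e, p) - 'D_ddx G2 (e, p) / 'D_ddx F (e, p) * 'D_ddx ('D_ddx F) (e, p)) /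
      ('D_ddx F (e, p) * 'D_ddx F (e, p))) -
    B (p.1, F (e, p)) * ('D_ddx G2 (e, p) / 'D_ddx F (e, p)) +
    (2%:R * ('D_ddx G1 (e, p) / 'D_ddx F (e, p)) - Dx A (p.1, F (e, p)) / A (p.1, F (e, p)) * G1 (e, p) -
      Dt A (p.1, F (e, p)) / A (p.1, F (e, p))) * (G2 (e, p) - C (p.1, F (e, p))) -
    Dx C (p.1, F (e, p)) * G1 (e, p) - Dt C (p.1, F (e, p)) = 0.
Proof.
move=> Oe; have k0 := Fx0 Oe.
have [h1 [sh1 ct1 [v1 t1] x1 xx1]] := slice_contact sF sG1 Oe k0.
have [h2 [sh2 ct2 [v2 t2] x2 xx2]] := slice_contact sF sG2 Oe k0.
have [h3 [sh3 ct3 _ _ _]] := slice_contact sF sG3 Oe k0.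
have [] := sym Oe sh1 sh2 sh3 (fun s ss => And3 (ct1 s ss) (ct2 s ss) (ct3 s ss)).
move=> E1 E2 _; split.
  by rewrite -t1 -xx1 -x1 -x2 -v1; exact: E1.
by rewrite -t2 -xx2 -x2 -x1 -v1 -v2; exact: E2.
Qed.

Variables (g1 g2 X Y1 Y2 : plane R -> R^o).
Hypotheses (F0 : forall q, O (0, q) -> F (0, q) = q.2)
  (G10 : forall q, O (0, q) -> G1 (0, q) = g1 q) (G20 : forall q, O (0, q) -> G2 (0, q) = g2 q).
Local Notation dde := ((1, 0) : R^o * plane R).
Hypotheses (FX : forall q, O (0, q) -> 'D_dde F (0, q) = X q)
  (GY1 : forall q, O (0, q) -> 'D_dde G1 (0, q) = Y1 q)
  (GY2 : forall q, O (0, q) -> 'D_dde G2 (0, q) = Y2 q).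

Local Notation al := (fun q : plane R => Dx A q / A q).
Local Notation be := (fun q : plane R => Dt A q / A q).
Local Notation I := [set e : R^o | O (e, p)].

Lemma open_transversal : open I.
Proof.
have oT := @openT R^o.
have st : smooth_on setT (fun e : R^o => (e, p) : R^o * plane R).
  by apply: smooth_pair => //; [apply: smooth_linear => // x; exact: cvg_id|exact: smooth_cst].
rewrite (_ : [set q | _] = [set e | setT e /\ O (e, p)]); last first.
  by apply/seteqP; split=> q /=; [split|case].
exact: (open_preimage_on oT oO (fun e Te => smooth_cont st Te)).
Qed.

Lemma slice_point : (p.1, F (0, p)) = p :> plane R.
Proof. by rewrite F0//; case: (p). Qed.

Lemma hasD_coef (a : plane R -> R^o) : smooth_on Om a ->
  hasD I (1 : R^o) (fun e => a (p.1, F (e, p))) (fun e => Dx a (p.1, F (e, p)) * 'D_dde F (e, p)).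
Proof.
move=> sa; apply: (@hasD_along Om a I p (fun e => F (e, p))) => //; first exact: open_transversal.
exact: (@hasD_curve R O F sF I p open_transversal (fun e Oe => Oe)).
Qed.

Lemma hasD_fiber (H : R^o * plane R -> R^o) : smooth_on O H -> hasD I (1 : R^o) (fun e => H (e, p)) (fun e => 'D_dde H (e, p)).
Proof. by move=> sH; exact: (@hasD_curve R O H sH I p open_transversal (fun e Oe => Oe)). Qed.

Lemma coef_derivative (a : plane R -> R^o) :
  Dx a (p.1, F (0, p)) * 'D_dde F (0, p) = Dx a p * X p.
Proof. by rewrite FX// slice_point. Qed.

Let k0 : 'D_ddx F (0, p) = 1.
Proof.
apply: etrans (@slice_value F (fun q => q.2) p (0, 1) sF Op F0) _.
by rewrite derive_snd.
Qed.

Let l0 : 'D_ddt F (0, p) = 0.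
Proof.
apply: etrans (@slice_value F (fun q => q.2) p (1, 0) sF Op F0) _.
by rewrite derive_snd.
Qed.

Let m0 : 'D_ddx ('D_ddx F) (0, p) = 0.
Proof.
apply: etrans (@slice_value2 F (fun q => q.2) p (0, 1) (0, 1) sF Op F0) _.
have E (q : plane R) : 'D_((0, 1) : plane R) (fun q : plane R => q.2 : R^o) q = 1.
  by rewrite derive_snd.
apply: etrans (@derive_on R (plane R) R^o setT _ (fun=> 1) (0, 1) p openT Logic.I (fun q _ => E q)) _.
exact: derive_cst.
Qed.

(** The infinitesimal criterion at one jet: the equation of the moved germ is differentiated in the
    parameter, and each derivative is evaluated at the identity. *)
Lemma infinitesimal1 :
  lin1 (A p) (Dx A p * X p) (B p) (Dx B p * X p) (al p) (Dx al p * X p) (be p) (Dx be p * X p)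
    (Dx B p) (Dx (Dx B) p * X p) (Dx (Dt B) p * X p) (Dx X p) (Dt X p) (Dx (Dx X) p)
    (g1 p) (Dx g1 p) (Dx (Dx g1) p) (Y1 p) (Dx Y1 p) (Dt Y1 p) (Dx (Dx Y1) p) (Dx g2 p) (Dx Y2 p) = 0.
Proof.
have sal : smooth_on Om al by smooth.
have sbe : smooth_on Om be by smooth.
have D1 (H : R^o * plane R -> R^o) (v : R^o * plane R) : smooth_on O H -> smooth_on O ('D_v H) by exact: smooth_derive.
have E := linearize1 open_transversal Op
  (hasD_fiber (D1 _ ddx sF)) (hasD_fiber (D1 _ ddt sF)) (hasD_fiber (D1 _ ddx (D1 _ ddx sF)))
  k0 l0 m0 Fx0 (hasD_fiber sG1) (hasD_fiber (D1 _ ddx sG1)) (hasD_fiber (D1 _ ddt sG1))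
  (hasD_fiber (D1 _ ddx (D1 _ ddx sG1))) (hasD_fiber (D1 _ ddx sG2)) (hasD_coef sA) (hasD_coef sB)
  (hasD_coef sal) (hasD_coef sbe) (hasD_coef (smooth_Dx sB)) (hasD_coef (smooth_Dt sB))
  (fun e Oe => proj1 (pushed_equations Oe)).
exact: (lin1_eq (congr1 A slice_point) (coef_derivative A) (congr1 B slice_point) (coef_derivative B)
  (congr1 al slice_point) (coef_derivative al) (congr1 be slice_point) (coef_derivative be)
  (congr1 (Dx B) slice_point) (coef_derivative (Dx B)) (coef_derivative (Dt B))
  (slice_mixed _ sF Op FX) (slice_mixed _ sF Op FX) (slice_mixed2 _ _ sF Op FX)
  (G10 Op) (slice_value _ sG1 Op G10) (slice_value2 _ _ sG1 Op G10)
  (GY1 Op) (slice_mixed _ sG1 Op GY1) (slice_mixed _ sG1 Op GY1) (slice_mixed2 _ _ sG1 Op GY1)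
  (slice_value _ sG2 Op G20) (slice_mixed _ sG2 Op GY2) E).
Qed.

Lemma infinitesimal2 :
  lin2 (A p) (Dx A p * X p) (B p) (Dx B p * X p) (C p) (Dx C p * X p)
    (al p) (Dx al p * X p) (be p) (Dx be p * X p)
    (Dx C p) (Dx (Dx C) p * X p) (Dx (Dt C) p * X p) (Dx X p) (Dt X p) (Dx (Dx X) p)
    (g1 p) (Dx g1 p) (Y1 p) (Dx Y1 p) (g2 p) (Dx g2 p) (Dx (Dx g2) p)
    (Y2 p) (Dx Y2 p) (Dt Y2 p) (Dx (Dx Y2) p) = 0.
Proof.
have sal : smooth_on Om al by smooth.
have sbe : smooth_on Om be by smooth.
have D1 (H : R^o * plane R -> R^o) (v : R^o * plane R) : smooth_on O H -> smooth_on O ('D_v H) by exact: smooth_derive.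
have E := linearize2 open_transversal Op
  (hasD_fiber (D1 _ ddx sF)) (hasD_fiber (D1 _ ddt sF)) (hasD_fiber (D1 _ ddx (D1 _ ddx sF)))
  k0 l0 m0 Fx0 (hasD_fiber sG1) (hasD_fiber sG2) (hasD_fiber (D1 _ ddx sG1)) (hasD_fiber (D1 _ ddt sG2))
  (hasD_fiber (D1 _ ddx sG2)) (hasD_fiber (D1 _ ddx (D1 _ ddx sG2))) (hasD_coef sA) (hasD_coef sB)
  (hasD_coef sC) (hasD_coef sal) (hasD_coef sbe) (hasD_coef (smooth_Dx sC)) (hasD_coef (smooth_Dt sC))
  (fun e Oe => proj2 (pushed_equations Oe)).
exact: (lin2_eq
  (congr1 A slice_point) (coef_derivative A) (congr1 B slice_point) (coef_derivative B)
  (congr1 C slice_point) (coef_derivative C)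
  (congr1 al slice_point) (coef_derivative al) (congr1 be slice_point) (coef_derivative be)
  (congr1 (Dx C) slice_point) (coef_derivative (Dx C)) (coef_derivative (Dt C))
  (slice_mixed _ sF Op FX) (slice_mixed _ sF Op FX) (slice_mixed2 _ _ sF Op FX)
  (G10 Op) (slice_value _ sG1 Op G10) (GY1 Op) (slice_mixed _ sG1 Op GY1)
  (G20 Op) (slice_value _ sG2 Op G20) (slice_value2 _ _ sG2 Op G20)
  (GY2 Op) (slice_mixed _ sG2 Op GY2) (slice_mixed _ sG2 Op GY2) (slice_mixed2 _ _ sG2 Op GY2) E).
Qed.
End Equations.
End Pushforward.

(** * Determining equations for the symmetries of DE1 *)

Section Iterated.
Variable R : realType.
Implicit Types V W : normedModType R.

Lemma iterD_on V W (U : set V) (f g : V -> W) s p : open U -> U p ->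
  (forall q, U q -> f q = g q) -> Defs.iterD s f p = Defs.iterD s g p.
Proof.
move=> oU Up fg; elim: s p Up => [|v s IH] p Up; first exact: fg.
exact: (@derive_on R V W U (Defs.iterD s f) (Defs.iterD s g) v p oU Up IH).
Qed.

Lemma iterD_pair V W1 W2 (U : set V) (f : V -> W1) (g : V -> W2) s p : open U -> U p ->
  smooth_on U f -> smooth_on U g ->
  Defs.iterD s (fun q => (f q, g q)) p = (Defs.iterD s f p, Defs.iterD s g p).
Proof.
move=> oU Up sf sg; elim: s p Up => [//|v s IH] p Up.
apply: etrans (@derive_on R V _ U (Defs.iterD s (fun q => (f q, g q)))
  (fun q => (Defs.iterD s f q, Defs.iterD s g q)) v p oU Up IH) _.
by apply: derive_pair; [exact: sf|exact: sg].
Qed.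
End Iterated.

(** * Coordinates and axes of the space with coordinates t, x, g1, g2, g3 *)

Section LinearFunctions.
Variable R : realType.

Lemma findim_triples : findim (varspace (triples R)).
Proof. by do ?apply: findim_prod; exact: findim_scalar. Qed.

Definition lin_cont (V W : normedModType R) (l : V -> W) := linear l /\ continuous l.

Lemma lin_cont_comp (V1 V2 V3 : normedModType R) (f : V1 -> V2) (k : V2 -> V3) :
  lin_cont f -> lin_cont k -> lin_cont (fun z => k (f z)).
Proof.
move=> [lf cf] [lk ck]; split=> [a u v|z]; first by rewrite lf lk.
by apply: (@continuous_comp _ _ _ f k); [exact: cf|exact: ck].
Qed.

Lemma lin_cont_fst (V1 V2 : normedModType R) : lin_cont (fst : V1 * V2 -> V1).
Proof. by split; [exact: fst_linear|exact: fst_continuous]. Qed.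

Lemma lin_cont_snd (V1 V2 : normedModType R) : lin_cont (snd : V1 * V2 -> V2).
Proof. by split; [exact: snd_linear|exact: snd_continuous]. Qed.

Lemma lin_cont_t : lin_cont (fun z : varspace (triples R) => z.1.1 : R^o).
Proof. exact: lin_cont_comp (lin_cont_fst _ _) (lin_cont_fst R^o R^o). Qed.

Lemma lin_cont_x : lin_cont (fun z : varspace (triples R) => z.1.2 : R^o).
Proof. exact: lin_cont_comp (lin_cont_fst _ _) (lin_cont_snd R^o R^o). Qed.

Lemma lin_cont_g1 : lin_cont (fun z : varspace (triples R) => z.2.1.1 : R^o).
Proof.
exact: lin_cont_comp (lin_cont_comp (lin_cont_snd _ _) (lin_cont_fst (R^o * R^o)%type R^o)) (lin_cont_fst R^o R^o).
Qed.

Lemma lin_cont_g2 : lin_cont (fun z : varspace (triples R) => z.2.1.2 : R^o).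
Proof.
exact: lin_cont_comp (lin_cont_comp (lin_cont_snd _ _) (lin_cont_fst (R^o * R^o)%type R^o)) (lin_cont_snd R^o R^o).
Qed.

Lemma lin_cont_g3 : lin_cont (fun z : varspace (triples R) => z.2.2 : R^o).
Proof. exact: lin_cont_comp (lin_cont_snd _ _) (lin_cont_snd (R^o * R^o)%type R^o). Qed.
End LinearFunctions.

(** The axes are locked so that derivatives along them behave as atoms in unification and in the
    algebra that follows. *)
HB.lock Definition dir_t (R : realType) : varspace (triples R) := ((1, 0) : plane R, 0 : triples R).
HB.lock Definition dir_x (R : realType) : varspace (triples R) := ((0, 1) : plane R, 0 : triples R).
HB.lock Definition dir_1 (R : realType) : varspace (triples R) := (0 : plane R, (1, 0, 0) : triples R).
HB.lock Definition dir_2 (R : realType) : varspace (triples R) := (0 : plane R, (0, 1, 0) : triples R).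
HB.lock Definition dir_3 (R : realType) : varspace (triples R) := (0 : plane R, (0, 0, 1) : triples R).

Section JetDirections.
Variable R : realType.
Local Notation E := (varspace (triples R)).

Lemma dirE (v : E) : v = v.1.1 *: dir_t R + v.1.2 *: dir_x R + v.2.1.1 *: dir_1 R + v.2.1.2 *: dir_2 R + v.2.2 *: dir_3 R.
Proof.
rewrite dir_t.unlock dir_x.unlock dir_1.unlock dir_2.unlock dir_3.unlock; case: v => [[t x] [[a b] c]]; apply/pair_equal_spec; split.
  apply/pair_equal_spec; split=> /=; rewrite ?scaler0 ?addr0 ?add0r; exact: esym (mulr1 _).
apply/pair_equal_spec; split=> /=; last by rewrite !scaler0 ?addr0 ?add0r; exact: esym (mulr1 _).
apply/pair_equal_spec; split=> /=; rewrite ?scaler0 ?addr0 ?add0r; exact: esym (mulr1 _).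
Qed.

Lemma derive_dirE (F : E -> R^o) z v : differentiable F z ->
  'D_v F z = v.1.1 * 'D_(dir_t R) F z + v.1.2 * 'D_(dir_x R) F z +
    v.2.1.1 * 'D_(dir_1 R) F z + v.2.1.2 * 'D_(dir_2 R) F z + v.2.2 * 'D_(dir_3 R) F z.
Proof. by move=> dF; rewrite {1}(dirE v) !derive_dirD// !derive_dirZ. Qed.
End JetDirections.

(** * Polynomial germs with a prescribed jet *)

Section Germs.
Variable R : realType.
Local Notation E := (varspace (triples R)).

(** At [p] it has value [v], x-slope [w], second x-derivative [r] and t-slope [s]: the jet
    coordinates that enter [DE1], free before the equations are imposed. *)
Definition germ (p : plane R) (v w r s : R^o) (q : plane R) : R^o :=
  v + (q.2 - p.2) * w + (q.2 - p.2) * (q.2 - p.2) * (r / 2%:R) + (q.1 - p.1) * s.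

Lemma smooth_germ p v w r s : smooth_on setT (germ p v w r s).
Proof. have oT := @openT (plane R); rewrite /germ; smooth. Qed.

Lemma germ_at p v w r s : germ p v w r s p = v.
Proof. by rewrite /germ !subrr !mul0r !addr0. Qed.

Lemma Dx_germ p v w r s q : Dx (germ p v w r s) q = w + (q.2 - p.2) * r.
Proof.
have oT := @openT (plane R); have Tq : setT q by [].
derive_at H (Dx (fun q : plane R => v + (q.2 - p.2) * w + (q.2 - p.2) * (q.2 - p.2) * (r / 2%:R) + (q.1 - p.1) * s) q) Tq.
by apply: etrans H _; rewrite /=; move: (q.2) (p.2) (q.1) (p.1) => x x0 t t0; field.
Qed.

Lemma Dt_germ p v w r s q : Dt (germ p v w r s) q = s.
Proof.
have oT := @openT (plane R); have Tq : setT q by [].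
derive_at H (Dt (fun q : plane R => v + (q.2 - p.2) * w + (q.2 - p.2) * (q.2 - p.2) * (r / 2%:R) + (q.1 - p.1) * s) q) Tq.
by apply: etrans H _; rewrite /=; move: (q.2) (p.2) (q.1) (p.1) => x x0 t t0; ring.
Qed.

Lemma DxDx_germ p v w r s q : Dx (Dx (germ p v w r s)) q = r.
Proof.
have oT := @openT (plane R); have Tq : setT q by [].
rewrite (Dx_on oT Tq (fun q _ => Dx_germ p v w r s q)).
derive_at H (Dx (fun q : plane R => w + (q.2 - p.2) * r) q) Tq.
by apply: etrans H _; rewrite /=; ring.
Qed.

Lemma Dx_remainder (U : set (plane R)) (a b : plane R -> R^o) p (r : R^o) : open U -> U p ->
  smooth_on U a -> smooth_on U b ->
  Dx (fun q : plane R => a q + (q.2 - p.2) * (r * b q)) p = Dx a p + r * b p.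
Proof.
move=> oU Up sa sb.
derive_at H (Dx (fun q : plane R => a q + (q.2 - p.2) * (r * b q)) p) Up.
by apply: etrans H _; rewrite /= subrr addr0 mul0r addr0 mul1r.
Qed.

Variable M : set E.
Hypothesis oM : open M.

Section Graph.
Variables g1 g2 g3 : plane R -> R^o.
Hypotheses (sg1 : smooth_on setT g1) (sg2 : smooth_on setT g2) (sg3 : smooth_on setT g3).

Let g (q : plane R) : E := (q, (g1 q, g2 q, g3 q)).

Let sg (U : set (plane R)) : open U -> smooth_on U g.
Proof.
move=> oU; have sT (f : plane R -> R^o) : smooth_on setT f -> smooth_on U f by apply: smooth_sub.
apply: smooth_pair => //; first by apply: smooth_linear => //; move=> x; exact: cvg_id.
by do 2?apply: smooth_pair => //; exact: sT.
Qed.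

Lemma open_graph : open [set q | M (g q)].
Proof.
have oT := @openT (plane R).
rewrite (_ : [set q | _] = [set q | setT q /\ M (g q)]); last first.
  by apply/seteqP; split=> q /=; [split|case].
exact: (open_preimage_on oT oM (fun q Tq => smooth_cont (sg oT) Tq)).
Qed.

Lemma smooth_graph (F : E -> R^o) : smooth_on M F -> smooth_on [set q | M (g q)] (fun q => F (g q)).
Proof.
move=> sF; exact: smooth_comp (findim_triples R) open_graph (fun q Mq => Mq) sF (sg open_graph).
Qed.

Lemma derive_graph (F : E -> R^o) q (v : plane R) : smooth_on M F -> M (g q) ->
  'D_v (fun q => F (g q)) q = v.1 * 'D_(dir_t R) F (g q) + v.2 * 'D_(dir_x R) F (g q) +
    'D_v g1 q * 'D_(dir_1 R) F (g q) + 'D_v g2 q * 'D_(dir_2 R) F (g q) + 'D_v g3 q * 'D_(dir_3 R) F (g q).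
Proof.
move=> sF Mq.
rewrite (derive_comp v (smooth_diff (sg open_graph) Mq) (smooth_diff sF Mq)) (derive_dirE _ (smooth_diff sF Mq)).
have d1 := smooth_diff sg1 (Logic.I : setT q); have d2 := smooth_diff sg2 (Logic.I : setT q).
have d3 := smooth_diff sg3 (Logic.I : setT q).
have -> : 'D_v g q = (v, ('D_v g1 q, 'D_v g2 q, 'D_v g3 q)).
  rewrite derive_pair; [|exact: ex_diff|by do 2?apply: differentiable_pair].
  rewrite derive_id derive_pair; [|by apply: differentiable_pair|by []].
  by rewrite derive_pair.
by [].
Qed.
End Graph.

(* The total x-derivative at a jet with [(g1, g2, g3)_x = (w1, w2, w3)]. *)
Definition slope (w1 w2 w3 : R^o) (F : E -> R^o) (z : E) : R^o :=
  'D_(dir_x R) F z + w1 * 'D_(dir_1 R) F z + w2 * 'D_(dir_2 R) F z + w3 * 'D_(dir_3 R) F z.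

Lemma smooth_slope w1 w2 w3 F : smooth_on M F -> smooth_on M (slope w1 w2 w3 F).
Proof.
have comb (a b c d : E -> R^o) : smooth_on M a -> smooth_on M b -> smooth_on M c -> smooth_on M d ->
    smooth_on M (fun z => a z + w1 * b z + w2 * c z + w3 * d z) by move=> *; smooth.
by move=> sF; apply: comb; exact: smooth_derive.
Qed.

Section GermGraph.
Variables (p : plane R) (v1 v2 v3 w1 w2 w3 r s1 s2 s3 : R^o).
Let g1 := germ p v1 w1 r s1.
Let g2 := germ p v2 w2 0 s2.
Let g3 := germ p v3 w3 0 s3.
Let g (q : plane R) : E := (q, (g1 q, g2 q, g3 q)).
Let z : E := (p, (v1, v2, v3)).
Hypothesis Mz : M z.
Variable F : E -> R^o.
Hypothesis sF : smooth_on M F.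

Let gp : g p = z.
Proof. by rewrite /g /g1 /g2 /g3 !germ_at. Qed.

Let Mp : M (g p). Proof. by rewrite gp. Qed.

Let sg1 := @smooth_germ p v1 w1 r s1.
Let sg2 := @smooth_germ p v2 w2 0 s2.
Let sg3 := @smooth_germ p v3 w3 0 s3.

Lemma Dt_germ_graph : Dt (fun q => F (g q)) p =
  'D_(dir_t R) F z + s1 * 'D_(dir_1 R) F z + s2 * 'D_(dir_2 R) F z + s3 * 'D_(dir_3 R) F z.
Proof.
rewrite DtE (@derive_graph g1 g2 g3 sg1 sg2 sg3 F p (1, 0) sF Mp) -/(g p) gp -!DtE !Dt_germ.
by rewrite mul1r mul0r addr0.
Qed.

Let Dx_graph (H : E -> R^o) q : smooth_on M H -> M (g q) -> Dx (fun q => H (g q)) q =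
  slope w1 w2 w3 H (g q) + (q.2 - p.2) * (r * 'D_(dir_1 R) H (g q)).
Proof.
move=> sH Mq; rewrite DxE (@derive_graph g1 g2 g3 sg1 sg2 sg3 H q (0, 1) sH Mq) -!DxE !Dx_germ -/(g q) /slope.
rewrite mul0r add0r mul1r /=.
move: ('D__ _ _) ('D_(dir_1 R) _ _) ('D_(dir_2 R) _ _) ('D_(dir_3 R) _ _) => a b c d; ring.
Qed.

Lemma Dx_germ_graph : Dx (fun q => F (g q)) p = slope w1 w2 w3 F z.
Proof. by rewrite Dx_graph// gp subrr mul0r addr0. Qed.

Lemma DxDx_germ_graph : Dx (Dx (fun q => F (g q))) p =
  slope w1 w2 w3 (slope w1 w2 w3 F) z + r * 'D_(dir_1 R) F z.
Proof.
have oU := @open_graph g1 g2 g3 sg1 sg2 sg3.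
have sS := @smooth_slope w1 w2 w3 F sF; have s1F := smooth_derive (dir_1 R) sF.
rewrite (@Dx_on R _ (Dx (fun q => F (g q))) (fun q => slope w1 w2 w3 F (g q) + (q.2 - p.2) * (r * 'D_(dir_1 R) F (g q))) p oU Mp);
  last by move=> q Mq; exact: Dx_graph.
have sgS := @smooth_graph g1 g2 g3 sg1 sg2 sg3 _ sS.
have sg1F := @smooth_graph g1 g2 g3 sg1 sg2 sg3 _ s1F.
apply: etrans (Dx_remainder r oU Mp sgS sg1F) _.
apply: etrans (congr2 +%R (Dx_graph sS Mp) (congr1 (fun y => r * 'D_(dir_1 R) F y) gp)) _.
by rewrite gp subrr mul0r addr0.
Qed.
End GermGraph.
End Germs.

Section SecondSlope.
Variable R : realType.
Local Notation E := (varspace (triples R)).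
Local Notation dx := (dir_x R).
Local Notation d1 := (dir_1 R).
Local Notation d2 := (dir_2 R).
Local Notation d3 := (dir_3 R).
Variable M : set E.
Hypothesis oM : open M.

Lemma derive_comb (w1 w2 w3 : R^o) (a b c d : E -> R^o) z u : smooth_on M a -> smooth_on M b ->
  smooth_on M c -> smooth_on M d -> M z ->
  'D_u (fun z => a z + w1 * b z + w2 * c z + w3 * d z) z =
  'D_u a z + w1 * 'D_u b z + w2 * 'D_u c z + w3 * 'D_u d z.
Proof.
move=> sa sb sc sd Mz.
have K (k f : E -> R^o) (w : R^o) : smooth_on M k -> smooth_on M f ->
    hasD M u (fun z => k z + w * f z) (fun z => 'D_u k z + (0 * f z + w * 'D_u f z)).
  move=> sk sf; apply: (hasD_add oM (hasD_leaf u sk)).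
  exact: (hasD_mul oM (hasD_cst M u w) (hasD_leaf u sf)).
have [s1 e1] := K _ _ w1 sa sb; have [s2 e2] := K _ _ w2 s1 sc; have [s3 e3] := K _ _ w3 s2 sd.
by apply: etrans (e3 z Mz) _; rewrite (e2 z Mz) (e1 z Mz) !mul0r !add0r.
Qed.

Lemma derive_slope w1 w2 w3 (F : E -> R^o) z u : smooth_on M F -> M z ->
  'D_u (slope w1 w2 w3 F) z =
  'D_u ('D_dx F) z + w1 * 'D_u ('D_d1 F) z + w2 * 'D_u ('D_d2 F) z + w3 * 'D_u ('D_d3 F) z.
Proof.
move=> sF; have sD v := smooth_derive v sF.
exact: (derive_comb w1 w2 w3 u (sD dx) (sD d1) (sD d2) (sD d3)).
Qed.

(** As the slopes are constants, the iterated total derivative is a quadratic polynomial in them;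
    its coefficients are the second partial derivatives of [F]. *)
Lemma slope_slope w1 w2 w3 (F : E -> R^o) z : smooth_on M F -> M z ->
  slope w1 w2 w3 (slope w1 w2 w3 F) z =
  'D_dx ('D_dx F) z + 2%:R * (w1 * 'D_dx ('D_d1 F) z + w2 * 'D_dx ('D_d2 F) z + w3 * 'D_dx ('D_d3 F) z) +
  (w1 * w1 * 'D_d1 ('D_d1 F) z + w2 * w2 * 'D_d2 ('D_d2 F) z + w3 * w3 * 'D_d3 ('D_d3 F) z) +
  2%:R * (w1 * w2 * 'D_d1 ('D_d2 F) z + w1 * w3 * 'D_d1 ('D_d3 F) z + w2 * w3 * 'D_d2 ('D_d3 F) z).
Proof.
move=> sF Mz; have D u := derive_slope w1 w2 w3 u sF Mz.
have S u v := schwarz u v oM Mz sF.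
have fact (x1 x2 x3 x4 xx x1' x2' x3' x11 x12 x13 x21 x22 x23 x31 x32 x33 y1 y2 y3 : R) :
    x1 = xx + w1 * x1' + w2 * x2' + w3 * x3' -> x2 = y1 + w1 * x11 + w2 * x12 + w3 * x13 ->
    x3 = y2 + w1 * x21 + w2 * x22 + w3 * x23 -> x4 = y3 + w1 * x31 + w2 * x32 + w3 * x33 ->
    y1 = x1' -> y2 = x2' -> y3 = x3' -> x21 = x12 -> x31 = x13 -> x32 = x23 ->
    x1 + w1 * x2 + w2 * x3 + w3 * x4 =
    xx + 2%:R * (w1 * x1' + w2 * x2' + w3 * x3') + (w1 * w1 * x11 + w2 * w2 * x22 + w3 * w3 * x33) +
    2%:R * (w1 * w2 * x12 + w1 * w3 * x13 + w2 * w3 * x23).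
  by move=> -> -> -> -> -> -> -> -> -> ->; ring.
exact: (fact _ _ _ _ _ _ _ _ _ _ _ _ _ _ _ _ _ _ _ _ (D dx) (D d1) (D d2) (D d3)
  (S d1 dx) (S d2 dx) (S d3 dx) (S d2 d1) (S d3 d1) (S d3 d2)).
Qed.
End SecondSlope.

(** * Splitting the linearized equations by powers of the free slopes *)

Section Coefficients.
Variable R : realType.
Variables a ax b bx bxx btx bt c cx cxx ctx ct al alx be bex v1 v2 v3 : R.
Variables x xt xx xxx y yt yx y1 y2 y3 yxx yx1 yx2 yx3 y11 y12 y13 y22 y23 y33 : R.
Variables z zt zx z1 z2 z3 zxx zx1 zx2 zx3 z11 z12 z13 z22 z23 z33 : R.

Let K (w1 : R) := 2%:R * w1 - al * v1 - be.
(** The t-slopes that [DE1] imposes on germs with vanishing second x-derivatives. The zero term is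
    kept so that the shape agrees with the case [r = 0] of the general condition. *)
Let s1 (w1 w2 : R) := a * 0 + b * w1 - K w1 * (v1 + b) - bx * v1 - 2%:R * a * w2 - bt.
Let s2 (w1 w2 : R) := b * w2 - K w1 * (v2 - c) + cx * v1 + ct.
Let s3 (w1 w3 : R) := b * w3 - K w1 * v3 + c * v3.
Let quad (fxx fx1 fx2 fx3 f11 f12 f13 f22 f23 f33 w1 w2 w3 : R) :=
  fxx + 2%:R * (w1 * fx1 + w2 * fx2 + w3 * fx3) +
  (w1 * w1 * f11 + w2 * w2 * f22 + w3 * w3 * f33) +
  2%:R * (w1 * w2 * f12 + w1 * w3 * f13 + w2 * w3 * f23).

(** The condition is a quadratic polynomial in [w1], [w2], [w3] that vanishes everywhere. Its values
    at 0, 1 and -1 isolate the coefficients: differences of opposite values give the linear ones,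
    second differences those of [w1^2], [w1 w2], [w1 w3], which come from the second total
    derivative of [y] alone. *)
Fact coefficients1 : a != 0 ->
  (forall w1 w2 w3, lin1 a (ax * x) b (bx * x) al (alx * x) be (bex * x) bx (bxx * x) (btx * x) xx xt xxx
    v1 w1 0 y (yx + w1 * y1 + w2 * y2 + w3 * y3)
    (yt + s1 w1 w2 * y1 + s2 w1 w2 * y2 + s3 w1 w3 * y3)
    (quad yxx yx1 yx2 yx3 y11 y12 y13 y22 y23 y33 w1 w2 w3 + 0 * y1)
    w2 (zx + w1 * z1 + w2 * z2 + w3 * z3) = 0) ->
  [/\ [/\ y11 = 0, y12 = 0 & y13 = 0],
    - (a * yx3) + y3 * (v1 + b) + a * z3 = 0,
    - (a * y1) - a * yx2 + y2 * (v1 + b) + ax * x + a * (z2 - xx) = 0 &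
    - (2%:R * (v2 - c) * y2) - 2%:R * v3 * y3 - xt - 2%:R * a * yx1 + a * xxx - b * xx + bx * x -
      2%:R * xx * v1 + 2%:R * y + 2%:R * a * z1 = 0].
Proof.
move=> a0 H; rewrite /lin1 /quad /s1 /s2 /s3 /K in H.
have aux d : a * d = 0 -> d = 0 by move/eqP; rewrite mulf_eq0 (negbTE a0) => /eqP.
split; [split; apply: aux| | |].
- move: (H 0 0 0) (H 1 0 0) (H (-1) 0 0) => {a0 H} *; lra.
- move: (H 0 0 0) (H 1 0 0) (H 0 1 0) (H 1 1 0) => {a0 H} *; lra.
- move: (H 0 0 0) (H 1 0 0) (H 0 0 1) (H 1 0 1) => {a0 H} *; lra.
- move: (H 0 0 1) (H 0 0 (-1)) => {a0 H} *; lra.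
- move: (H 0 1 0) (H 0 (-1) 0) => {a0 H} *; lra.
- move: (H 1 0 0) (H (-1) 0 0) => {a0 H} *; lra.
Qed.

Fact coefficients2 : a != 0 ->
  (forall w1 w2 w3, lin2 a (ax * x) b (bx * x) c (cx * x) al (alx * x) be (bex * x)
    cx (cxx * x) (ctx * x) xx xt xxx
    v1 w1 y (yx + w1 * y1 + w2 * y2 + w3 * y3) v2 w2 0 z (zx + w1 * z1 + w2 * z2 + w3 * z3)
    (zt + s1 w1 w2 * z1 + s2 w1 w2 * z2 + s3 w1 w3 * z3)
    (quad zxx zx1 zx2 zx3 z11 z12 z13 z22 z23 z33 w1 w2 w3 + 0 * z1) = 0) ->
  [/\ z11 = 0, z12 = 0, z13 = 0 &
    - (2%:R * a * z1) - xt - 2%:R * a * zx2 + a * xxx + b * xx - bx * x + 2%:R * y2 * (v2 - c) = 0].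
Proof.
move=> a0 H; rewrite /lin2 /quad /s1 /s2 /s3 /K in H.
have aux d : a * d = 0 -> d = 0 by move/eqP; rewrite mulf_eq0 (negbTE a0) => /eqP.
split; [apply: aux..|].
- move: (H 0 0 0) (H 1 0 0) (H (-1) 0 0) => {a0 H} *; lra.
- move: (H 0 0 0) (H 1 0 0) (H 0 1 0) (H 1 1 0) => {a0 H} *; lra.
- move: (H 0 0 0) (H 1 0 0) (H 0 0 1) (H 1 0 1) => {a0 H} *; lra.
- move: (H 0 1 0) (H 0 (-1) 0) => {a0 H} *; lra.
Qed.
End Coefficients.

(** * The symmetry condition on germs *)

Section SymmetryCondition.
Variable R : realType.
Local Notation E := (varspace (triples R)).
Local Notation dt := (dir_t R).
Local Notation dx := (dir_x R).
Local Notation d1 := (dir_1 R).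
Local Notation d2 := (dir_2 R).
Local Notation d3 := (dir_3 R).
Variables (Om : set (plane R)) (A B C : plane R -> R^o).
Hypothesis oOm : open Om.
Hypotheses (sA : smooth_on Om A) (sB : smooth_on Om B) (sC : smooth_on Om C).
Hypothesis A0 : forall q, Om q -> A q != 0.
Variables (M : set (varspace (triples R))) (D : set (R^o * varspace (triples R))).
Variables (Phi : R^o * varspace (triples R) -> varspace (triples R)).
Variables (Q : varspace (triples R) -> varspace (triples R)).
Hypothesis oM : open M.
Hypothesis M_Om : forall z, M z -> Om z.1.
Hypothesis lg : local_group M D Phi.
Hypothesis gen : forall z, M z ->
  is_derive (0 : R^o) (1 : R^o) (fun e : R^o => Phi (e, z)) (Q z).
Hypothesis sym : forall e : R^o,
  point_symmetry (DE1 A B C) [set z | D (e, z)] (fun z => Phi (e, z)).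
Hypothesis Qt : forall z, M z -> (Q z).1.1 = 0.

Section Prolongation.
Variables g1 g2 g3 : plane R -> R^o.
Hypotheses (sg1 : smooth_on setT g1) (sg2 : smooth_on setT g2) (sg3 : smooth_on setT g3).

Let g (q : plane R) : varspace (triples R) := (q, (g1 q, g2 q, g3 q)).

Let sg : smooth_on setT g.
Proof.
apply: smooth_pair => //; first exact: openT.
  by apply: smooth_linear => //; [exact: openT|move=> x; exact: cvg_id].
by apply: smooth_pair; [exact: openT|apply: smooth_pair => //; exact: openT|].
Qed.

Let lift (eq : R^o * plane R) : R^o * varspace (triples R) := (eq.1, g eq.2).

Let slift O : open O -> smooth_on O lift.
Proof.
move=> oO; apply: smooth_pair => //.
  exact: smooth_linear oO (@fst_linear _ _ _) (@fst_continuous _ _ _).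
apply: (smooth_comp (findim_plane R) oO _ sg) => //.
exact: smooth_linear oO (@snd_linear _ _ _) (@snd_continuous _ _ _).
Qed.

Section Orbit.
Variable O : set (R^o * plane R).
Hypothesis oO : open O.
Hypothesis OD : forall eq, O eq -> D (eq.1, g eq.2).

Lemma smooth_orbit (l : varspace (triples R) -> R^o) : lin_cont l ->
  smooth_on O (fun eq => l (Phi (eq.1, g eq.2))).
Proof.
move=> [ll cl].
have sPhi : smooth_on O (fun eq => Phi (lift eq)).
  exact: smooth_comp (findim_prod (findim_scalar R) (findim_triples R)) oO OD (lg_smooth lg) (slift oO).
apply: (smooth_comp (findim_triples R) oO _ _ sPhi (U2 := setT)) => //.
by apply: smooth_linear => //; exact: openT.
Qed.

Lemma derive_orbit (l : varspace (triples R) -> R^o) q : lin_cont l -> O (0, q) ->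
  'D_((1, 0) : R^o * plane R) (fun eq => l (Phi (eq.1, g eq.2))) (0, q) = l (Q (g q)).
Proof.
move=> [ll cl] Oq; have Dq := OD Oq; have Mq := lg_dom lg Dq.
have dP := smooth_diff (lg_smooth lg) Dq.
have dl := smooth_diff (slift oO) Oq.
have E1 : 'D_((1, 0) : R^o * plane R) lift (0, q) = (1, 0).
  rewrite derive_pair.
  - congr pair.
      by rewrite derive_fst.
    rewrite (derive_comp _ (differentiable_snd _) (smooth_diff sg Logic.I)).
    rewrite derive_snd.
    have := derive_dirZ (0 : plane R) (0 : R) (@smooth_diff _ _ _ _ _ q sg Logic.I).
    by rewrite !scale0r.
  - exact: differentiable_fst.
  - apply: differentiable_comp; first exact: differentiable_snd.
    exact: smooth_diff sg _.
have [dll Ell] := linear_diff (Phi (0, g q)) ll cl.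
apply: etrans (derive_comp _ (differentiable_comp dl dP) dll) _.
rewrite Ell; congr l.
apply: etrans (derive_comp _ dl dP) _.
rewrite E1; exact: derive_group0 lg gen _ Mq.
Qed.

Lemma orbit0 (l : varspace (triples R) -> R^o) q : O (0, q) -> l (Phi (0, g q)) = l (g q).
Proof. move=> Oq; have Dq : D (0, g q) := OD Oq; by rewrite (lg_id lg (lg_dom lg Dq)). Qed.

End Orbit.

Local Notation ddx := ((0, ((0, 1) : plane R)) : R^o * plane R).

(** Two restrictions near parameter 0: the vanishing t-coefficient makes the group keep [t], and the
    x-derivative of the moved x-coordinate, equal to 1 at the identity, stays nonzero. *)
Lemma orbit_domain p : M (g p) -> exists O : set (R^o * plane R), [/\ open O, O (0, p),
  forall eq, O eq -> D (eq.1, g eq.2),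
  forall eq, O eq -> (Phi (eq.1, g eq.2)).1.1 = eq.2.1 &
  forall eq, O eq -> 'D_ddx (fun eq => (Phi (eq.1, g eq.2)).1.2 : R^o) eq != 0].
Proof.
move=> Mp; have [lt ct] := (lin_cont_t R).
have [S [oS Sp SD St]] := group_preserves (findim_triples R) lg gen lt ct Qt Mp.
have oT : open (setT : set (R^o * plane R)) by exact: openT.
have oO1 := open_preimage_on oT oS (fun eq Teq => smooth_cont (slift oT) Teq).
set O1 := [set q | _] in oO1.
have OD1 eq : O1 eq -> D (eq.1, g eq.2) by move=> [_ /SD].
have sF := smooth_orbit oO1 OD1 (lin_cont_x R).
have oN : open [set x : R^o | x != 0] by exact: open_neq.
have oO := open_preimage_on oO1 oN (fun eq Oeq => smooth_cont (smooth_derive ddx sF) Oeq).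
exists [set q | O1 q /\ [set x | x != 0] ('D_ddx (fun eq => (Phi (eq.1, g eq.2)).1.2 : R^o) q)].
have O1p : O1 (0, p) by split.
split=> //.
- split=> //=.
  have -> : 'D_ddx (fun eq => (Phi (eq.1, g eq.2)).1.2 : R^o) (0, p) = 1.
    apply: etrans (@slice_value R O1 oO1 _ (fun q => q.2) p (0, 1) sF O1p _) _.
      by move=> q Oq; exact: (orbit0 OD1 (fun z => z.1.2) Oq).
    by rewrite derive_snd.
  exact: oner_neq0.
- by move=> eq [/OD1].
- by move=> eq [[_ /St]].
- by move=> eq [].
Qed.

(** The prolongation is nondegenerate because [t] is kept: a direction killed by the differential
    has no t-component, and its x-component is multiplied by a nonzero derivative. *)
Lemma transported_solution (O : set (R^o * plane R)) p e (h1 h2 h3 : plane R -> R^o) : open O ->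
  (forall eq, O eq -> D (eq.1, g eq.2)) ->
  (forall eq, O eq -> (Phi (eq.1, g eq.2)).1.1 = eq.2.1) ->
  (forall eq, O eq -> 'D_ddx (fun eq => (Phi (eq.1, g eq.2)).1.2 : R^o) eq != 0) ->
  DE1 A B C (fun q => (g1 q, g2 q, g3 q)) p -> O (e, p) ->
  smooth_on setT h1 -> smooth_on setT h2 -> smooth_on setT h3 ->
  (forall s : seq (plane R), (size s <= 2)%N -> [/\
      Defs.iterD s (fun q => h1 (q.1, (Phi (e, g q)).1.2)) p = Defs.iterD s (fun q => (Phi (e, g q)).2.1.1 : R^o) p,
      Defs.iterD s (fun q => h2 (q.1, (Phi (e, g q)).1.2)) p = Defs.iterD s (fun q => (Phi (e, g q)).2.1.2 : R^o) p &
      Defs.iterD s (fun q => h3 (q.1, (Phi (e, g q)).1.2)) p = Defs.iterD s (fun q => (Phi (e, g q)).2.2 : R^o) p]) ->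
  DE1 A B C (fun q => (h1 q, h2 q, h3 q)) (p.1, (Phi (e, g p)).1.2).
Proof.
move=> oO OD Ot Ox gp Oe sh1 sh2 sh3 ct.
have oe := @open_slice _ _ oO e; set Oe' := [set q | O (e, q)] in oe.
pose f (q : plane R) : R^o := (Phi (e, g q)).1.2.
have FE q : Oe' q -> (Phi (e, g q)).1 = (q.1, f q).
  by move=> Oq; rewrite -(Ot (e, q) Oq) /f; case: (Phi (e, g q)).1.
have sl (l : varspace (triples R) -> R^o) : lin_cont l -> smooth_on Oe' (fun q => l (Phi (e, g q))).
  by move=> ll; exact: (@smooth_slice R O (fun eq => l (Phi (eq.1, g eq.2))) oO (smooth_orbit oO OD ll) e).
have sf := sl _ (lin_cont_x R); have s1 := sl _ (lin_cont_g1 R); have s2 := sl _ (lin_cont_g2 R); have s3 := sl _ (lin_cont_g3 R).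
have sqf : smooth_on Oe' (fun q => (q.1, f q) : plane R).
  by apply: smooth_pair => //; exact: smooth_fst_plane.
have sh (h : plane R -> R^o) : smooth_on setT h -> smooth_on Oe' (fun q => h (q.1, f q)).
  by move=> s; exact: smooth_comp (findim_plane R) oe _ s sqf.
rewrite -/(f p) -(FE p Oe).
have oT := @openT (plane R).
apply: (sym (e := e) (p := p) (g := fun q => (g1 q, g2 q, g3 q))) gp.
- exact: (OD (e, p) Oe).
- by exists setT; split=> //; do 2?apply: smooth_pair => //.
- by exists setT; split=> //; do 2?apply: smooth_pair => //.
split=> [v|s ss].
  rewrite (@derive_on R (plane R) (plane R) Oe' (fun q => (Phi (e, g q)).1) (fun q => (q.1, f q)) v p oe Oe FE).
  rewrite derive_pair; [|exact: differentiable_fst|exact: smooth_diff sf Oe].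
  rewrite derive_fst.
  move=> /pair_equal_spec[v1 v2].
  have fx : Dx f p != 0.
    rewrite DxE (@derive_slice R O (fun eq => (Phi (eq.1, g eq.2)).1.2 : R^o) oO (smooth_orbit oO OD (lin_cont_x R)) e p (0, 1) Oe).
    exact: Ox Oe.
  move: v2; rewrite (derive_plane v (smooth_diff sf Oe)) v1 scale0r add0r => /eqP.
  rewrite scaler_eq0 (negbTE fx) orbF => /eqP v2.
  by rewrite (surjective_pairing v) v1 v2.
have [e1 e2 e3] := ct s ss.
pose H (q : plane R) : triples R := (h1 (q.1, f q), h2 (q.1, f q), h3 (q.1, f q)).
pose G (q : plane R) : triples R := ((Phi (e, g q)).2.1.1, (Phi (e, g q)).2.1.2, (Phi (e, g q)).2.2).
apply: etrans (@iterD_on R (plane R) (triples R) Oe' _ H s p oe Oe _) _.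
  by move=> q Oq; rewrite /H -(FE q Oq).
apply: etrans (_ : Defs.iterD s G p = _); last first.
  by congr (Defs.iterD s _ p); apply/funext => q; rewrite /G; case: (Phi (e, g q)) => a [[b c] d].
have s12 := smooth_pair oe s1 s2; have sh12 := smooth_pair oe (sh h1 sh1) (sh h2 sh2).
apply: etrans (iterD_pair s oe Oe sh12 (sh h3 sh3)) _.
apply: etrans _ (esym (iterD_pair s oe Oe s12 s3)).
congr pair; last exact: e3.
apply: etrans (iterD_pair s oe Oe (sh h1 sh1) (sh h2 sh2)) _.
apply: etrans _ (esym (iterD_pair s oe Oe s1 s2)).
by congr pair; [exact: e1|exact: e2].
Qed.

Local Notation al := (fun q : plane R => Dx A q / A q).
Local Notation be := (fun q : plane R => Dt A q / A q).

(** The germ has to satisfy [DE1] at the single point [p]: a point symmetry acts on jets, so the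
    remaining jet coordinates stay free. *)
Theorem germ_conditions p (X Y1 Y2 : plane R -> R^o) : M (g p) ->
  DE1 A B C (fun q => (g1 q, g2 q, g3 q)) p ->
  X = (fun q => (Q (g q)).1.2) -> Y1 = (fun q => (Q (g q)).2.1.1) -> Y2 = (fun q => (Q (g q)).2.1.2) ->
  lin1 (A p) (Dx A p * X p) (B p) (Dx B p * X p) (al p) (Dx al p * X p) (be p) (Dx be p * X p)
    (Dx B p) (Dx (Dx B) p * X p) (Dx (Dt B) p * X p) (Dx X p) (Dt X p) (Dx (Dx X) p)
    (g1 p) (Dx g1 p) (Dx (Dx g1) p) (Y1 p) (Dx Y1 p) (Dt Y1 p) (Dx (Dx Y1) p) (Dx g2 p) (Dx Y2 p) = 0 /\
  lin2 (A p) (Dx A p * X p) (B p) (Dx B p * X p) (C p) (Dx C p * X p)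
    (al p) (Dx al p * X p) (be p) (Dx be p * X p)
    (Dx C p) (Dx (Dx C) p * X p) (Dx (Dt C) p * X p) (Dx X p) (Dt X p) (Dx (Dx X) p)
    (g1 p) (Dx g1 p) (Y1 p) (Dx Y1 p) (g2 p) (Dx g2 p) (Dx (Dx g2) p)
    (Y2 p) (Dx Y2 p) (Dt Y2 p) (Dx (Dx Y2) p) = 0.
Proof.
move=> Mp gp XE Y1E Y2E; case: (orbit_domain Mp) => O [oO Op OD Ot Ox].
have sF := smooth_orbit oO OD (lin_cont_x R); have sG1 := smooth_orbit oO OD (lin_cont_g1 R).
have sG2 := smooth_orbit oO OD (lin_cont_g2 R); have sG3 := smooth_orbit oO OD (lin_cont_g3 R).
have OOm e : O (e, p) -> Om (p.1, (Phi (e, g p)).1.2).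
  move=> Oe; have := M_Om (lg_cod lg (OD _ Oe)); rewrite /= -(Ot _ Oe) /=.
  by case: (Phi (e, g p)) => [[a b] c].
have sm e h1 h2 h3 := @transported_solution O p e h1 h2 h3 oO OD Ot Ox gp.
have F0 (q : plane R) : O (0, q) -> (Phi (0, g q)).1.2 = q.2 by exact: (orbit0 OD (fun z => z.1.2)).
have G10 (q : plane R) : O (0, q) -> (Phi (0, g q)).2.1.1 = g1 q by exact: (orbit0 OD (fun z => z.2.1.1)).
have G20 (q : plane R) : O (0, q) -> (Phi (0, g q)).2.1.2 = g2 q by exact: (orbit0 OD (fun z => z.2.1.2)).
have FX (q : plane R) : O (0, q) -> 'D_((1, 0) : R^o * plane R) (fun eq => (Phi (eq.1, g eq.2)).1.2 : R^o) (0, q) = X q.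
  by move=> Oq; rewrite XE; exact: (derive_orbit oO OD (lin_cont_x R) Oq).
have GY1 (q : plane R) : O (0, q) -> 'D_((1, 0) : R^o * plane R) (fun eq => (Phi (eq.1, g eq.2)).2.1.1 : R^o) (0, q) = Y1 q.
  by move=> Oq; rewrite Y1E; exact: (derive_orbit oO OD (lin_cont_g1 R) Oq).
have GY2 (q : plane R) : O (0, q) -> 'D_((1, 0) : R^o * plane R) (fun eq => (Phi (eq.1, g eq.2)).2.1.2 : R^o) (0, q) = Y2 q.
  by move=> Oq; rewrite Y2E; exact: (derive_orbit oO OD (lin_cont_g2 R) Oq).
split.
  exact: (infinitesimal1 oO oOm sA sB A0 sF sG1 sG2 sG3 Op OOm (fun e => @Ox (e, p)) sm F0 G10 G20 FX GY1 GY2).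
exact: (infinitesimal2 oO oOm sA sB sC A0 sF sG1 sG2 sG3 Op OOm (fun e => @Ox (e, p)) sm F0 G10 G20 FX GY1 GY2).
Qed.
End Prolongation.

(** * Determining equations for the coefficients of the generator and their solution *)

Variables xi y1 y2 : E -> R^o.
Hypotheses (xiE : xi = (fun z => (Q z).1.2)) (y1E : y1 = (fun z => (Q z).2.1.1))
  (y2E : y2 = (fun z => (Q z).2.1.2)).

Local Notation al := (fun q : plane R => Dx A q / A q).
Local Notation be := (fun q : plane R => Dt A q / A q).

Lemma smooth_component (l : E -> R^o) : lin_cont l -> smooth_on M (fun z => l (Q z)).
Proof.
move=> [ll cl]; have sQ := smooth_generator (findim_triples R) oM lg gen.
apply: (smooth_comp (findim_triples R) oM _ _ sQ (U2 := setT)) => //.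
by apply: smooth_linear => //; exact: openT.
Qed.

Lemma smooth_xi : smooth_on M xi.
Proof. by rewrite xiE; exact: smooth_component (lin_cont_x R). Qed.

Lemma smooth_y1 : smooth_on M y1.
Proof. by rewrite y1E; exact: smooth_component (lin_cont_g1 R). Qed.

Lemma smooth_y2 : smooth_on M y2.
Proof. by rewrite y2E; exact: smooth_component (lin_cont_g2 R). Qed.

(** [DE1] is solved for the t-slopes [s1], [s2], [s3], which leaves [v1], [v2], [v3], [w1], [w2],
    [w3] and [r] arbitrary. *)
Lemma germ_equations p v1 v2 v3 w1 w2 w3 r s1 s2 s3 : M (p, (v1, v2, v3)) ->
  let z : E := (p, (v1, v2, v3)) in
  let K := 2%:R * w1 - Dx A p / A p * v1 - Dt A p / A p in
  s1 = A p * r + B p * w1 - K * (v1 + B p) - Dx B p * v1 - 2%:R * A p * w2 - Dt B p ->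
  s2 = B p * w2 - K * (v2 - C p) + Dx C p * v1 + Dt C p ->
  s3 = B p * w3 - K * v3 + C p * v3 ->
  let t1 (F : E -> R^o) := 'D_dt F z + s1 * 'D_d1 F z + s2 * 'D_d2 F z + s3 * 'D_d3 F z in
  let x1 (F : E -> R^o) := slope w1 w2 w3 F z in
  let x2 (F : E -> R^o) := slope w1 w2 w3 (slope w1 w2 w3 F) z + r * 'D_d1 F z in
  lin1 (A p) (Dx A p * xi z) (B p) (Dx B p * xi z) (al p) (Dx al p * xi z) (be p) (Dx be p * xi z)
    (Dx B p) (Dx (Dx B) p * xi z) (Dx (Dt B) p * xi z) (x1 xi) (t1 xi) (x2 xi)
    v1 w1 r (y1 z) (x1 y1) (t1 y1) (x2 y1) w2 (x1 y2) = 0 /\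
  lin2 (A p) (Dx A p * xi z) (B p) (Dx B p * xi z) (C p) (Dx C p * xi z)
    (al p) (Dx al p * xi z) (be p) (Dx be p * xi z)
    (Dx C p) (Dx (Dx C) p * xi z) (Dx (Dt C) p * xi z) (x1 xi) (t1 xi) (x2 xi)
    v1 w1 (y1 z) (x1 y1) v2 w2 0 (y2 z) (x1 y2) (t1 y2) (x2 y2) = 0.
Proof.
move=> Mz z K E1 E2 E3 t1 x1 x2.
pose g1 := germ p v1 w1 r s1; pose g2 := germ p v2 w2 0 s2; pose g3 := germ p v3 w3 0 s3.
have gp : (p, (g1 p, g2 p, g3 p)) = z by rewrite /g1 /g2 /g3 !germ_at.
have Mp : M (p, (g1 p, g2 p, g3 p)) by rewrite gp.
have de : DE1 A B C (fun q => (g1 q, g2 q, g3 q)) p.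
  have e1 := Dx_germ p v1 w1 r s1 p; have e2 := Dx_germ p v2 w2 0 s2 p; have e3 := Dx_germ p v3 w3 0 s3 p.
  rewrite subrr mul0r addr0 in e1; rewrite subrr mul0r addr0 in e2; rewrite subrr mul0r addr0 in e3.
  have f1 (h u ht hx hxx kx : R) : ht = s1 -> hxx = r -> hx = w1 -> u = v1 -> kx = w2 ->
      ht - A p * hxx - B p * hx + (2%:R * hx - Dx A p / A p * u - Dt A p / A p) * (u + B p)
      + Dx B p * u + 2%:R * A p * kx + Dt B p = 0.
    by move=> -> -> -> -> ->; rewrite E1 /K; ring.
  have f2 (u ux k ht hx hxx kx : R) : ht = s2 -> hxx = 0 -> hx = w2 -> u = v1 -> ux = w1 -> k = v2 ->
      ht - A p * hxx - B p * hx + (2%:R * ux - Dx A p / A p * u - Dt A p / A p) * (k - C p)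
      - Dx C p * u - Dt C p = 0.
    by move=> -> -> -> -> -> ->; rewrite E2 /K; ring.
  have f3 (u ux k ht hx hxx kx : R) : ht = s3 -> hxx = 0 -> hx = w3 -> u = v1 -> ux = w1 -> k = v3 ->
      ht - A p * hxx - B p * hx + (2%:R * ux - Dx A p / A p * u - Dt A p / A p) * k
      - C p * k = 0.
    by move=> -> -> -> -> -> ->; rewrite E3 /K; ring.
  split.
  - exact: (f1 0 _ _ _ _ _ (Dt_germ _ _ _ _ _ _) (DxDx_germ _ _ _ _ _ _) e1 (germ_at _ _ _ _ _) e2).
  - exact: (f2 _ _ _ _ _ _ 0 (Dt_germ _ _ _ _ _ _) (DxDx_germ _ _ _ _ _ _) e2 (germ_at _ _ _ _ _) e1 (germ_at _ _ _ _ _)).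
  - exact: (f3 _ _ _ _ _ _ 0 (Dt_germ _ _ _ _ _ _) (DxDx_germ _ _ _ _ _ _) e3 (germ_at _ _ _ _ _) e1 (germ_at _ _ _ _ _)).
have XE : (fun q => xi (q, (g1 q, g2 q, g3 q))) = (fun q => (Q (q, (g1 q, g2 q, g3 q))).1.2) by rewrite xiE.
have Y1E : (fun q => y1 (q, (g1 q, g2 q, g3 q))) = (fun q => (Q (q, (g1 q, g2 q, g3 q))).2.1.1) by rewrite y1E.
have Y2E : (fun q => y2 (q, (g1 q, g2 q, g3 q))) = (fun q => (Q (q, (g1 q, g2 q, g3 q))).2.1.2) by rewrite y2E.
have [l1 l2] := germ_conditions (@smooth_germ R p v1 w1 r s1)
  (@smooth_germ R p v2 w2 0 s2) (@smooth_germ R p v3 w3 0 s3) Mp de XE Y1E Y2E.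
have e0 (F : E -> R^o) := congr1 F gp.
have ec (a : R) (F : E -> R^o) : a * F (p, (g1 p, g2 p, g3 p)) = a * F z by rewrite gp.
have et F sF : Dt (fun q => F (q, (g1 q, g2 q, g3 q))) p = t1 F := @Dt_germ_graph R M oM p v1 v2 v3 w1 w2 w3 r s1 s2 s3 Mz F sF.
have ex F sF : Dx (fun q => F (q, (g1 q, g2 q, g3 q))) p = x1 F := @Dx_germ_graph R M oM p v1 v2 v3 w1 w2 w3 r s1 s2 s3 Mz F sF.
have exx F sF : Dx (Dx (fun q => F (q, (g1 q, g2 q, g3 q)))) p = x2 F := @DxDx_germ_graph R M oM p v1 v2 v3 w1 w2 w3 r s1 s2 s3 Mz F sF.
have e1 v w r' s : Dx (germ p v w r' s) p = w by rewrite Dx_germ subrr mul0r addr0.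
split.
  exact: (lin1_eq erefl (ec _ xi) erefl (ec _ xi) erefl (ec _ xi) erefl (ec _ xi) erefl (ec _ xi) (ec _ xi)
    (ex xi smooth_xi) (et xi smooth_xi) (exx xi smooth_xi) (germ_at _ _ _ _ _) (e1 _ _ _ _) (DxDx_germ _ _ _ _ _ _)
    (e0 y1) (ex y1 smooth_y1) (et y1 smooth_y1) (exx y1 smooth_y1) (e1 _ _ _ _) (ex y2 smooth_y2) l1).
exact: (lin2_eq erefl (ec _ xi) erefl (ec _ xi) erefl (ec _ xi) erefl (ec _ xi) erefl (ec _ xi) erefl (ec _ xi) (ec _ xi)
    (ex xi smooth_xi) (et xi smooth_xi) (exx xi smooth_xi) (germ_at _ _ _ _ _) (e1 _ _ _ _)
    (e0 y1) (ex y1 smooth_y1) (germ_at _ _ _ _ _) (e1 _ _ _ _) (DxDx_germ _ _ _ _ _ _)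
    (e0 y2) (ex y2 smooth_y2) (et y2 smooth_y2) (exx y2 smooth_y2) l2).
Qed.

(** The coefficient of [r] in the first condition, isolated as the value at [r = 1] minus the value
    at [r = 0]. The contributions of [r] through the t-slope of g1 cancel those through the second
    total derivatives. *)
Lemma second_order_terms p v1 v2 v3 w1 w2 w3 : M (p, (v1, v2, v3)) ->
  2%:R * A p * slope w1 w2 w3 xi (p, (v1, v2, v3)) = Dx A p * xi (p, (v1, v2, v3)).
Proof.
move=> Mz; set z : E := (p, (v1, v2, v3)).
set K := 2%:R * w1 - Dx A p / A p * v1 - Dt A p / A p.
set s1 : R^o := B p * w1 - K * (v1 + B p) - Dx B p * v1 - 2%:R * A p * w2 - Dt B p.
have S1 (r : R^o) : s1 + A p * r = A p * r + B p * w1 - K * (v1 + B p) - Dx B p * v1 - 2%:R * A p * w2 - Dt B p.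
  by rewrite /s1; ring.
have fact (a ax x b b' al al' be be' bx bx' bt' Xx xt x1 x2 x3 Xxx u ux Y Yx yt k1 k2 k3 s2 s3 Yxx vx Zx s : R) :
    lin1 a (ax * x) b b' al al' be be' bx bx' bt' Xx (xt + (s + a * 1) * x1 + s2 * x2 + s3 * x3) (Xxx + 1 * x1)
      u ux 1 Y Yx (yt + (s + a * 1) * k1 + s2 * k2 + s3 * k3) (Yxx + 1 * k1) vx Zx = 0 ->
    lin1 a (ax * x) b b' al al' be be' bx bx' bt' Xx (xt + (s + a * 0) * x1 + s2 * x2 + s3 * x3) (Xxx + 0 * x1)
      u ux 0 Y Yx (yt + (s + a * 0) * k1 + s2 * k2 + s3 * k3) (Yxx + 0 * k1) vx Zx = 0 ->
    2%:R * a * Xx = ax * x.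
  rewrite /lin1 => e1 e2; apply/eqP; rewrite -subr_eq0; apply/eqP.
  by rewrite -[RHS]subr0 -{1}e1 -e2; ring.
have [l1 _] := germ_equations Mz (S1 1) erefl erefl (w3 := w3).
have [l0 _] := germ_equations Mz (S1 0) erefl erefl (w3 := w3).
exact: (fact _ _ _ _ _ _ _ _ _ _ _ _ _ _ _ _ _ _ _ _ _ _ _ _ _ _ _ _ _ _ _ _ l1 l0).
Qed.

(** The identity for the coefficient of [r] is affine in the free slopes, and its right side
    contains none of them. *)
Lemma xi_projectable z : M z ->
  [/\ 'D_d1 xi z = 0, 'D_d2 xi z = 0, 'D_d3 xi z = 0 & 2%:R * A z.1 * 'D_dx xi z = Dx A z.1 * xi z].
Proof.
move: z => [p [[v1 v2] v3]] Mz; set z : E := (p, (v1, v2, v3)).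
have H w1 w2 w3 := second_order_terms w1 w2 w3 Mz; rewrite /slope -/z in H.
have a0 : A p != 0 := A0 (M_Om Mz).
have fact (a ax x dx d1 d2 d3 : R) : a != 0 ->
  (forall w1 w2 w3 : R, 2%:R * a * (dx + w1 * d1 + w2 * d2 + w3 * d3) = ax * x) ->
  [/\ d1 = 0, d2 = 0, d3 = 0 & 2%:R * a * dx = ax * x].
  move=> n0 h; have h0 := h 0 0 0; have h1 := h 1 0 0; have h2 := h 0 1 0; have h3 := h 0 0 1.
  have aux d : 2%:R * a * d = 0 -> d = 0.
    by move/eqP; rewrite !mulf_eq0 pnatr_eq0 (negbTE n0) /= => /eqP.
  by split; [apply: aux; lra|apply: aux; lra|apply: aux; lra|lra].
exact: (fact _ _ _ _ _ _ _ a0 H).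
Qed.

Lemma derive_vanishing (F : E -> R^o) z u : (forall z, M z -> F z = 0) -> M z -> 'D_u F z = 0.
Proof.
move=> F0 Mz; apply: etrans (@derive_on R E R^o M F (fun=> 0) u z oM Mz F0) _.
exact: derive_cst.
Qed.

Lemma slope_xi w1 w2 w3 z : M z -> slope w1 w2 w3 xi z = 'D_dx xi z.
Proof. by move=> /xi_projectable[e1 e2 e3 _]; rewrite /slope e1 e2 e3 !mulr0 !addr0. Qed.

Lemma slope_slope_xi w1 w2 w3 r z : M z ->
  slope w1 w2 w3 (slope w1 w2 w3 xi) z + r * 'D_d1 xi z = 'D_dx ('D_dx xi) z.
Proof.
move=> Mz; have [e1 _ _ _] := xi_projectable Mz; rewrite e1 mulr0 addr0.
have N (F : E -> R^o) : (forall z, M z -> F z = 0) -> forall u, 'D_u F z = 0.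
  by move=> F0 u; exact: derive_vanishing F0 Mz.
have n1 := N ('D_d1 xi) (fun z Mz => let: And4 e _ _ _ := xi_projectable Mz in e).
have n2 := N ('D_d2 xi) (fun z Mz => let: And4 _ e _ _ := xi_projectable Mz in e).
have n3 := N ('D_d3 xi) (fun z Mz => let: And4 _ _ e _ := xi_projectable Mz in e).
apply: etrans (slope_slope oM w1 w2 w3 smooth_xi Mz) _.
have fact (a b1 b2 b3 b4 b5 b6 b7 b8 b9 : R) : b1 = 0 -> b2 = 0 -> b3 = 0 -> b4 = 0 -> b5 = 0 ->
    b6 = 0 -> b7 = 0 -> b8 = 0 -> b9 = 0 ->
    a + 2%:R * (w1 * b1 + w2 * b2 + w3 * b3) + (w1 * w1 * b4 + w2 * w2 * b5 + w3 * w3 * b6) +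
    2%:R * (w1 * w2 * b7 + w1 * w3 * b8 + w2 * w3 * b9) = a.
  by move=> -> -> -> -> -> -> -> -> ->; ring.
exact: (fact _ _ _ _ _ _ _ _ _ _ (n1 dx) (n2 dx) (n3 dx) (n1 d1) (n2 d2) (n3 d3) (n2 d1) (n3 d1) (n3 d2)).
Qed.

(* The coefficients of [w3], [w2], [w1] in the first determining equation and
   of [w2] in the second one, up to factors 2. *)
Definition eqn3 z : R^o := - (A z.1 * 'D_dx ('D_d3 y1) z) + 'D_d3 y1 z * (z.2.1.1 + B z.1) + A z.1 * 'D_d3 y2 z.
Definition eqn2 z : R^o := - (A z.1 * 'D_d1 y1 z) - A z.1 * 'D_dx ('D_d2 y1) z + 'D_d2 y1 z * (z.2.1.1 + B z.1) +
  Dx A z.1 * xi z + A z.1 * ('D_d2 y2 z - 'D_dx xi z).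
Definition eqn1 z : R^o := - (2%:R * (z.2.1.2 - C z.1) * 'D_d2 y1 z) - 2%:R * z.2.2 * 'D_d3 y1 z - 'D_dt xi z -
  2%:R * A z.1 * 'D_dx ('D_d1 y1) z + A z.1 * 'D_dx ('D_dx xi) z - B z.1 * 'D_dx xi z + Dx B z.1 * xi z -
  2%:R * 'D_dx xi z * z.2.1.1 + 2%:R * y1 z + 2%:R * A z.1 * 'D_d1 y2 z.
Definition eqn0 z : R^o := - (2%:R * A z.1 * 'D_d1 y2 z) - 'D_dt xi z - 2%:R * A z.1 * 'D_dx ('D_d2 y2) z +
  A z.1 * 'D_dx ('D_dx xi) z + B z.1 * 'D_dx xi z - Dx B z.1 * xi z + 2%:R * 'D_d2 y1 z * (z.2.1.2 - C z.1).

Lemma lin1_eq4 (a a' b b' al al' be be' bx bx' bt' Xx Xt Xxx u ux uxx Y Yx Yt Yxx vx Zx Xx_ Xt_ Xxx_ Yxx_ : R) :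
  Xx = Xx_ -> Xt = Xt_ -> Xxx = Xxx_ -> Yxx = Yxx_ ->
  lin1 a a' b b' al al' be be' bx bx' bt' Xx Xt Xxx u ux uxx Y Yx Yt Yxx vx Zx = 0 ->
  lin1 a a' b b' al al' be be' bx bx' bt' Xx_ Xt_ Xxx_ u ux uxx Y Yx Yt Yxx_ vx Zx = 0.
Proof. by move=> -> -> -> ->. Qed.

Lemma lin2_eq4 (a a' b b' c c' al al' be be' cx cx' ct' Xx Xt Xxx u ux Y Yx v vx vxx Z Zx Zt Zxx Xx_ Xt_ Xxx_ Zxx_ : R) :
  Xx = Xx_ -> Xt = Xt_ -> Xxx = Xxx_ -> Zxx = Zxx_ ->
  lin2 a a' b b' c c' al al' be be' cx cx' ct' Xx Xt Xxx u ux Y Yx v vx vxx Z Zx Zt Zxx = 0 ->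
  lin2 a a' b b' c c' al al' be be' cx cx' ct' Xx_ Xt_ Xxx_ u ux Y Yx v vx vxx Z Zx Zt Zxx_ = 0.
Proof. by move=> -> -> -> ->. Qed.

(** As [xi] depends on [(t, x)] only, its total derivatives contain no slopes. The conditions at
    [r = 0] are then quadratic in the slopes, whereas products of slopes with second total
    derivatives of [xi] could make them cubic. *)
Lemma determining_equations z : M z ->
  [/\ [/\ 'D_d1 ('D_d1 y1) z = 0, 'D_d1 ('D_d2 y1) z = 0 & 'D_d1 ('D_d3 y1) z = 0],
      [/\ 'D_d1 ('D_d1 y2) z = 0, 'D_d1 ('D_d2 y2) z = 0 & 'D_d1 ('D_d3 y2) z = 0] &
      [/\ eqn3 z = 0, eqn2 z = 0, eqn1 z = 0 & eqn0 z = 0]].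
Proof.
move: z => [p [[v1 v2] v3]] Mz; rewrite /eqn3 /eqn2 /eqn1 /eqn0 /=.
have G w1 w2 w3 := germ_equations (r := 0) (w1 := w1) (w2 := w2) (w3 := w3) Mz erefl erefl erefl.
cbv zeta beta in G; move: G Mz; set z : E := (p, (v1, v2, v3)) => G Mz.
have a0 : A p != 0 := A0 (M_Om Mz).
have xT s1 s2 s3 : 'D_dt xi z + s1 * 'D_d1 xi z + s2 * 'D_d2 xi z + s3 * 'D_d3 xi z = 'D_dt xi z.
  by have [e1 e2 e3 _] := xi_projectable Mz; rewrite e1 e2 e3 !mulr0 !addr0.
have SS F (sF : smooth_on M F) w1 w2 w3 := slope_slope oM w1 w2 w3 sF Mz.
have H1 w1 w2 w3 := lin1_eq4 (slope_xi w1 w2 w3 Mz) (xT _ _ _) (slope_slope_xi w1 w2 w3 0 Mz)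
  (congr1 (fun a => a + 0 * 'D_d1 y1 z) (SS y1 smooth_y1 w1 w2 w3)) (proj1 (G w1 w2 w3)).
have H2 w1 w2 w3 := lin2_eq4
  (slope_xi w1 w2 w3 Mz) (xT _ _ _) (slope_slope_xi w1 w2 w3 0 Mz)
  (congr1 (fun a => a + 0 * 'D_d1 y2 z) (SS y2 smooth_y2 w1 w2 w3)) (proj2 (G w1 w2 w3)).
have [q1 c3 c2 c1] := coefficients1 a0 H1.
have [q21 q22 q23 c0] := coefficients2 a0 H2.
exact: (And3 q1 (And3 q21 q22 q23) (And4 c3 c2 c1 c0)).
Qed.

Lemma hasD0_derive (F : E -> R^o) u v : smooth_on M F -> (forall z, M z -> 'D_u F z = 0) ->
  hasD M u ('D_v F) (fun=> 0).
Proof.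
move=> sF F0; split=> [|z Mz]; first exact: smooth_derive.
exact: etrans (schwarz u v oM Mz sF) (derive_vanishing v F0 Mz).
Qed.

Lemma hasD_base (a : plane R -> R^o) : smooth_on Om a -> hasD M d1 (fun z => a z.1) (fun=> 0).
Proof.
move=> sa.
have sf : smooth_on M (fun z : E => z.1) by exact: smooth_linear oM (@fst_linear _ _ _) (@fst_continuous _ _ _).
have [s e] := hasD_comp d1 (findim_plane R) oM M_Om sa sf; split=> [|z Mz]; first exact: s.
apply: etrans (e z Mz) _.
rewrite derive_fst.
rewrite dir_1.unlock /=; have := derive_dirZ (0 : plane R) (0 : R) (smooth_diff sa (M_Om Mz)).
by rewrite !scale0r.
Qed.

Lemma hasD_g1 : hasD M d1 (fun z => z.2.1.1 : R^o) (fun=> 1).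
Proof.
have [l c] := lin_cont_g1 R; split=> [|z Mz]; first exact: smooth_linear.
by have [_ ->] := linear_diff z l c; rewrite dir_1.unlock.
Qed.

Let hA := hasD_base sA.
Let hB := hasD_base sB.
Let hAx := hasD_base (smooth_Dx sA).
Let hBx := hasD_base (smooth_Dx sB).
Let hv := hasD_g1.

Lemma hasD_zero (V : normedModType R) (U : set V) u (F F' : V -> R^o) z : open U -> hasD U u F F' ->
  (forall z, U z -> F z = 0) -> U z -> F' z = 0.
Proof.
move=> oU [_ e] F0 Uz; rewrite -(e z Uz).
by apply: etrans (@derive_on R V R^o U F (fun=> 0) u z oU Uz F0) _; exact: derive_cst.
Qed.

(** In [eqn3] the variable g1 is visible only as the factor of ['D_d3 y1], and every other
    ingredient has zero derivative along [d1]; differentiating along [d1] leaves ['D_d3 y1]. *)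
Lemma generator_g3 z : M z -> 'D_d3 y1 z = 0.
Proof.
have fact (a b v fx f g : E -> R^o) : hasD M d1 a (fun=> 0) -> hasD M d1 b (fun=> 0) -> hasD M d1 v (fun=> 1) ->
    hasD M d1 fx (fun=> 0) -> hasD M d1 f (fun=> 0) -> hasD M d1 g (fun=> 0) ->
    (forall z, M z -> - (a z * fx z) + f z * (v z + b z) + a z * g z = 0) -> forall z, M z -> f z = 0.
  move=> ha hb hv' hfx hf hg e {}z Mz.
  eassert (H : hasD M d1 (fun z => - (a z * fx z) + f z * (v z + b z) + a z * g z) _) by hasD.
  by apply: etrans (hasD_zero oM H e Mz) => /=; ring.
have Dq z' Mz' := determining_equations (z := z') Mz'.
have s31 := smooth_derive d3 smooth_y1.
have h3 z' (Mz' : M z') : 'D_d1 ('D_d3 y1) z' = 0 by have [[_ _ e] _ _] := Dq z' Mz'; exact: e.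
have k3 z' (Mz' : M z') : 'D_d1 ('D_d3 y2) z' = 0 by have [_ [_ _ e] _] := Dq z' Mz'; exact: e.
apply: (fact _ _ _ _ _ _ hA hB hv (hasD0_derive dx s31 h3) (conj s31 h3) (conj (smooth_derive d3 smooth_y2) k3)).
by move=> z' Mz'; have [_ _ [e _ _ _]] := Dq z' Mz'; exact: e.
Qed.

Let xi1 z (Mz : M z) : 'D_d1 xi z = 0. Proof. by have [e _ _ _] := xi_projectable Mz; exact: e. Qed.

(** The same differentiation along [d1], now of [eqn2]. *)
Lemma generator_g2 z : M z -> 'D_d2 y1 z = 0.
Proof.
have fact (a b v fx f f1 ax x g xx : E -> R^o) : hasD M d1 a (fun=> 0) -> hasD M d1 b (fun=> 0) -> hasD M d1 v (fun=> 1) ->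
    hasD M d1 fx (fun=> 0) -> hasD M d1 f (fun=> 0) -> hasD M d1 f1 (fun=> 0) -> hasD M d1 ax (fun=> 0) ->
    hasD M d1 x (fun=> 0) -> hasD M d1 g (fun=> 0) -> hasD M d1 xx (fun=> 0) ->
    (forall z, M z -> - (a z * f1 z) - a z * fx z + f z * (v z + b z) + ax z * x z + a z * (g z - xx z) = 0) ->
    forall z, M z -> f z = 0.
  move=> ha hb hv' hfx hf hf1 hax hx hg hxx e {}z Mz.
  eassert (H : hasD M d1 (fun z => - (a z * f1 z) - a z * fx z + f z * (v z + b z) + ax z * x z + a z * (g z - xx z)) _) by hasD.
  by apply: etrans (hasD_zero oM H e Mz) => /=; ring.
have Dq z' Mz' := determining_equations (z := z') Mz'.
have s2 := smooth_derive d2 smooth_y1.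
have h1 z' (Mz' : M z') : 'D_d1 ('D_d1 y1) z' = 0 by have [[e _ _] _ _] := Dq z' Mz'; exact: e.
have h2 z' (Mz' : M z') : 'D_d1 ('D_d2 y1) z' = 0 by have [[_ e _] _ _] := Dq z' Mz'; exact: e.
have k2 z' (Mz' : M z') : 'D_d1 ('D_d2 y2) z' = 0 by have [_ [_ e _] _] := Dq z' Mz'; exact: e.
apply: (fact _ _ _ _ _ _ _ _ _ _ hA hB hv (hasD0_derive dx s2 h2) (conj s2 h2) (conj (smooth_derive d1 smooth_y1) h1)
  hAx (conj smooth_xi xi1) (conj (smooth_derive d2 smooth_y2) k2) (hasD0_derive dx smooth_xi xi1)).
by move=> z' Mz'; have [_ _ [_ e _ _]] := Dq z' Mz'; exact: e.
Qed.

(** With the g2- and g3-derivatives of [y1] gone, the derivative of [eqn1] along [d1] keeps only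
    twice the difference of the two sides. *)
Lemma generator_g1 z : M z -> 'D_d1 y1 z = 'D_dx xi z.
Proof.
have fact (a b bx v xt fx xxx xx x y f g : E -> R^o) : hasD M d1 a (fun=> 0) -> hasD M d1 b (fun=> 0) ->
    hasD M d1 bx (fun=> 0) -> hasD M d1 v (fun=> 1) -> hasD M d1 xt (fun=> 0) ->
    hasD M d1 fx (fun=> 0) -> hasD M d1 xxx (fun=> 0) -> hasD M d1 xx (fun=> 0) ->
    hasD M d1 x (fun=> 0) -> hasD M d1 y f -> hasD M d1 g (fun=> 0) ->
    (forall z, M z -> - xt z - 2%:R * a z * fx z + a z * xxx z - b z * xx z + bx z * x z -
      2%:R * xx z * v z + 2%:R * y z + 2%:R * a z * g z = 0) ->
    forall z, M z -> f z = xx z.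
  move=> ha hb hbx hv' hxt hfx hxxx hxx hx hy hg e {}z Mz.
  eassert (H : hasD M d1 (fun z => - xt z - 2%:R * a z * fx z + a z * xxx z - b z * xx z + bx z * x z -
      2%:R * xx z * v z + 2%:R * y z + 2%:R * a z * g z) _) by hasD.
  have K := hasD_zero oM H e Mz; cbv beta in K.
  have : 2%:R * (f z - xx z) = 0 by apply: etrans K; ring.
  by move/eqP; rewrite mulf_eq0 pnatr_eq0 /= subr_eq0 => /eqP.
have Dq z' Mz' := determining_equations (z := z') Mz'.
have h1 z' (Mz' : M z') : 'D_d1 ('D_d1 y1) z' = 0 by have [[e _ _] _ _] := Dq z' Mz'; exact: e.
have k1 z' (Mz' : M z') : 'D_d1 ('D_d1 y2) z' = 0 by have [_ [e _ _] _] := Dq z' Mz'; exact: e.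
have [sxx xx1] := hasD0_derive dx smooth_xi xi1.
apply: (fact _ _ _ _ _ _ _ _ _ _ _ _ hA hB hBx hv (hasD0_derive dt smooth_xi xi1) (hasD0_derive dx (smooth_derive d1 smooth_y1) h1)
  (hasD0_derive dx sxx xx1) (conj sxx xx1) (conj smooth_xi xi1) (hasD_leaf d1 smooth_y1) (conj (smooth_derive d1 smooth_y2) k1)).
have simp (c2 c3 f2 f3 xt m1 m2 m3 m4 m5 m6 m7 : R) : f2 = 0 -> f3 = 0 ->
    - (c2 * f2) - c3 * f3 - xt - m1 + m2 - m3 + m4 - m5 + m6 + m7 = 0 ->
    - xt - m1 + m2 - m3 + m4 - m5 + m6 + m7 = 0.
  by move=> -> ->; rewrite !mulr0 oppr0 !add0r.
move=> z' Mz'; have [_ _ [_ _ e _]] := Dq z' Mz'.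
exact: (simp _ _ _ _ _ _ _ _ _ _ _ _ (generator_g2 Mz') (generator_g3 Mz') e).
Qed.

(** The sum of [eqn1] and [eqn0]: the terms with ['D_d1 y2], [B] and [Dx B] cancel, and so do the
    two [A xi_xx] against [2 A] times the x-derivative of ['D_d1 y1 = xi_x]. *)
Theorem generator_coefficient z : M z -> y1 z = 'D_dt xi z + 'D_dx xi z * z.2.1.1.
Proof.
have Dq z' Mz' := determining_equations (z := z') Mz'.
(* In [eqn2], ['D_d1 y1 = xi_x] and [A_x xi = 2 A xi_x] balance the first order terms and leave [A]
   times ['D_d2 y2]. *)
have k2 z' (Mz' : M z') : 'D_d2 y2 z' = 0.
  have [_ _ [_ e _ _]] := Dq z' Mz'; have [_ _ _ p] := xi_projectable Mz'.
  have f2 := derive_vanishing dx generator_g2 Mz'.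
  have a0 := A0 (M_Om Mz').
  have fact (a f1 fx f vb ax x g xx : R) : a != 0 -> - (a * f1) - a * fx + f * vb + ax * x + a * (g - xx) = 0 ->
      f1 = xx -> fx = 0 -> f = 0 -> 2%:R * a * xx = ax * x -> g = 0.
    move=> n0 E1 z1 z2 z3 E2; have : a * g = 0 by rewrite -E1 -E2 z1 z2 z3; ring.
    by move/eqP; rewrite mulf_eq0 (negbTE n0) => /eqP.
  exact: (fact _ _ _ _ _ _ _ _ _ a0 e (generator_g1 Mz') f2 (generator_g2 Mz') p).
move=> Mz; have [_ _ [_ _ e1 e0]] := Dq z Mz.
have fx1 : 'D_dx ('D_d1 y1) z = 'D_dx ('D_dx xi) z.
  exact: (@derive_on R E R^o M ('D_d1 y1) ('D_dx xi) dx z oM Mz generator_g1).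
have fx2 := derive_vanishing dx k2 Mz.
have fact (a b bx c2 c3 f2 f3 xt xxx xx x v y g1 fx gx k : R) :
    - (c2 * f2) - c3 * f3 - xt - 2%:R * a * fx + a * xxx - b * xx + bx * x - 2%:R * xx * v + 2%:R * y + 2%:R * a * g1 = 0 ->
    - (2%:R * a * g1) - xt - 2%:R * a * gx + a * xxx + b * xx - bx * x + 2%:R * f2 * k = 0 ->
    f2 = 0 -> f3 = 0 -> fx = xxx -> gx = 0 -> y = xt + xx * v.
  move=> E1 E0 z2 z3 zx zg; have : 2%:R * (y - (xt + xx * v)) = 0.
    by rewrite -[RHS]addr0 -{1}E1 -E0 z2 z3 zx zg; ring.
  by move/eqP; rewrite mulf_eq0 pnatr_eq0 /= subr_eq0 => /eqP.
exact: (fact _ _ _ _ _ _ _ _ _ _ _ _ _ _ _ _ _ e1 e0 (generator_g2 Mz) (generator_g3 Mz) fx1 fx2).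
Qed.

End SymmetryCondition.

(** * Invariant solutions *)

Section LocalFlow.
Variable R : realType.

(** The half of the argument without symmetries of [DE1]: the two identities for [xi] are all that
    is used of the generator, and [tau] serves as the multiplier of the equivalence. *)
Lemma reduction_op_Lie (A B C xi g1 g2 g3 : plane R -> R^o) (U : set (plane R)) (p : plane R) :
  open U -> U p -> smooth_on U A -> smooth_on U B -> smooth_on U C ->
  smooth_on U xi -> smooth_on U g1 -> smooth_on U g2 -> smooth_on U g3 ->
  (forall q, U q -> A q != 0) -> (forall q, U q -> xi q != 0) ->
  (forall q, U q -> 2%:R * A q * Dx xi q = Dx A q * xi q) ->
  (forall q, U q -> xi q * Dx g1 q = Dt xi q + Dx xi q * g1 q) ->
  (forall q, U q -> DE1 A B C (fun q => (g1 q, g2 q, g3 q)) q) ->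
  exists V : set (plane R), [/\ open V, V p, V `<=` U &
    exists Q : varspace (scalars R) -> varspace (scalars R),
      equivalent_on [set z | V z.1] (reduction_op g1 g2 g3) Q /\
      Lie_invariance_operator (eqL A B C) [set z | V z.1] Q].
Proof.
move=> oU Up sA sB sC sxi sg1 sg2 sg3 A0 xi0 Axi comm de.
pose sign (x : R) : R := if 0 < x then 1 else -1.
have signP (x : R) : x != 0 -> 0 < sign x * x.
  by rewrite /sign; case: (ltgtP 0 x) => // h _; rewrite ?mul1r ?mulN1r ?oppr_gt0.
have signV (x : R) : sign x * sign x = 1 by rewrite /sign; case: ifP => _; rewrite ?mulr1 ?mulrNN ?mulr1.
(* The signs are frozen at [p] and persist on [U2]. There [om] is the absolute value of [xi], and it
   satisfies the same identities because they are linear and homogeneous in [xi]. *)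
pose sg := sign (A p); pose sx := sign (xi p).
pose om : plane R -> R^o := fun q => sx * xi q.
have som : smooth_on U om by rewrite /om; smooth.
have omt q : U q -> Dt om q = sx * Dt xi q.
  move=> Uq; derive_at H (Dt (fun q => sx * xi q) q) Uq.
  by apply: etrans H _; rewrite mul0r add0r.
have omx q : U q -> Dx om q = sx * Dx xi q.
  move=> Uq; derive_at H (Dx (fun q => sx * xi q) q) Uq.
  by apply: etrans H _; rewrite mul0r add0r.
have ssA : smooth_on U (fun q => sg * A q) by smooth.
have oP : open [set x : R^o | 0 < (x : R)] by exact: open_gt.
have oU1 := open_preimage_on oU oP (fun q Uq => smooth_cont ssA Uq).
set U1 := [set q | _] in oU1.
have U1U : U1 `<=` U by move=> q [].
have oU2 := open_preimage_on oU1 oP (fun q Uq => smooth_cont som (U1U q Uq)).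
set U2 := [set q | _] in oU2.
have U2U : U2 `<=` U by move=> q [[]].
have U2p : U2 p by split; [split=> //; exact: signP (A0 p Up)|exact: signP (xi0 p Up)].
have sA2 := smooth_sub U2U sA; have som2 := smooth_sub U2U som.
have A2 q : U2 q -> A q != 0 by move=> /U2U; exact: A0.
pose tau : plane R -> R^o := fun q => sg * (om q * om q) / A q.
have stau : smooth_on U2 tau by rewrite /tau; smooth.
have tauA q : U2 q -> tau q * A q = sg * (om q * om q).
  by move=> Uq; rewrite /tau divfK//; exact: A2.
have tau0 q : U2 q -> 0 < (tau q : R).
  move=> Uq; have [[_ sA0] om0] := Uq; rewrite /= in sA0 om0.
  rewrite /tau (_ : sg * (om q * om q) / A q = (sg * A q) * (om q * om q) / (A q * A q)); last first.
    by field; exact: A2.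
  have AA : 0 < A q * A q :> R by rewrite -expr2 exprn_even_gt0//=; exact: A2.
  exact: divr_gt0 (mulr_gt0 sA0 (mulr_gt0 om0 om0)) AA.
have taux q : U2 q -> Dx tau q = 0.
  move=> Uq; derive_at H (Dx (fun q => sg * (om q * om q) / A q) q) Uq.
  apply: etrans H _; have := Axi q (U2U q Uq); have := A2 q Uq; rewrite (omx q (U2U q Uq)) /om.
  have fact (a x y z : R) : a != 0 -> 2%:R * a * y = z * x ->
      (0 * (sx * x * (sx * x)) + sg * (sx * y * (sx * x) + sx * x * (sx * y))) / a +
      sg * (sx * x * (sx * x)) * (- z / a / a) = 0.
    move=> a0 e; apply: etrans (_ : sg * (sx * sx) * x * (2%:R * a * y - z * x) / (a * a) = 0); first by field.
    by rewrite e subrr mulr0 mul0r.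
  exact: fact.
(* The logarithmic t-derivative of [tau] is [2 xi_t / xi - A_t / A]; inserting
   [xi_t = xi g1_x - xi_x g1] and [2 xi_x / xi = A_x / A] gives K. *)
have taut q : U2 q -> Dt tau q = tau q * Kcoef A g1 q.
  move=> Uq; derive_at H (Dt (fun q => sg * (om q * om q) / A q) q) Uq.
  apply: etrans H _; have := comm q (U2U q Uq); have := Axi q (U2U q Uq); have := A2 q Uq.
  rewrite (omt q (U2U q Uq)) /Kcoef /tau /om.
  have fact (a x y z g gx t s : R) : a != 0 -> 2%:R * a * y = z * x -> x * gx = t + y * g ->
      (0 * (sx * x * (sx * x)) + sg * (sx * t * (sx * x) + sx * x * (sx * t))) / a +
      sg * (sx * x * (sx * x)) * (- s / a / a) =
      sg * (sx * x * (sx * x)) / a * (2%:R * gx - z / a * g - s / a).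
    move=> a0 e e'; apply/eqP; rewrite -subr_eq0; apply/eqP.
    have et : t = x * gx - y * g by rewrite e' addrK.
    apply: etrans (_ : - (sg * (sx * sx) * x * g / (a * a)) * (2%:R * a * y - z * x) = 0).
      by rewrite et; field.
    by rewrite e subrr mulr0.
  exact: fact.
have commom q : U2 q -> om q * Dx g1 q = Dt om q + Dx om q * g1 q.
  move=> /U2U Uq; rewrite (omt q Uq) (omx q Uq) /om -mulrA comm//.
  by rewrite mulrDr mulrA.
have sg12 := smooth_sub U2U sg1.
have om0 q : U2 q -> 0 < (om q : R) by case.
have [V0 [T [W [d [Z [d0 V0p V02 st]]]]]] := straightened_exists oU2 U2p stau som2 sg12 tau0 om0 taux commom.
have V0U : V0 `<=` U := subset_trans V02 U2U.
(* The radius is halved twice: for [n], and then for [k], whose transport equation contains [n]. *)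
have d1 : 0 < d / 2 by lra.
have d1d : d / 2 < d by lra.
have d2 : 0 < d / 2 / 2 by lra.
have d2d : d / 2 / 2 < d / 2 by lra.
have [n [sn Rn]] := chart_primitive st (smooth_sub V0U sg2) d1 d1d.
have st1 := straightened_part st (ltW d1d).
set V1 := chart_part _ _ _ _ _ in sn Rn st1.
have V10 : V1 `<=` V0 by move=> q [].
have V1U : V1 `<=` U := subset_trans V10 V0U.
have oV1 := st_open st1; have sg31 := smooth_sub V1U sg3.
have sf : smooth_on V1 (fun q => expR (- n q) * g3 q) by smooth.
have [k [sk Rk]] := chart_primitive st1 sf d2 d2d.
have st2 := straightened_part st1 (ltW d2d).
set V := chart_part _ _ _ _ _ in sk Rk st2.
have VV1 : V `<=` V1 by move=> q [].
have VU : V `<=` U := subset_trans VV1 V1U.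
have VU2 : V `<=` U2 := subset_trans VV1 (subset_trans V10 V02).
have Vp : V p by split; [split|]; rewrite //; exact: box_center.
have oV := st_open st2.
exists V; split=> //; exists (flow_generator tau g1 g2 g3); split.
  exists (fun z => tau z.1); split; last first.
    by move=> z Vz; split; [exact: lt0r_neq0 (tau0 _ (VU2 _ Vz))|].
  have oT : open (setT : set (varspace (scalars R))) by exact: openT.
  have sf1 : smooth_on setT (fun z : varspace (scalars R) => z.1).
    exact: smooth_linear oT (@fst_linear _ _ _) (@fst_continuous _ _ _).
  have oz : open [set z : varspace (scalars R) | V z.1].
    rewrite (_ : [set z | _] = [set z : varspace (scalars R) | setT z /\ V z.1]); last first.
      by apply/seteqP; split=> q /=; [split|case].
    exact: (open_preimage_on oT oV (fun z Tz => smooth_cont sf1 Tz)).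
  apply: (@smooth_comp R _ _ _ _ V tau (fun z : varspace (scalars R) => z.1) (findim_plane R) oz _ (smooth_sub VU2 stau)) => //.
  exact: smooth_linear oz (@fst_linear _ _ _) (@fst_continuous _ _ _).
have sub (f : plane R -> R^o) (sf' : smooth_on U f) : smooth_on V f := smooth_sub VU sf'.
apply: (@flow_Lie R A B C tau om g1 g2 g3 n k sg V T W _ _ Z st2 (sub _ sA) (sub _ sB) (sub _ sC) (sub _ sg2) (sub _ sg3) (smooth_sub VV1 sn) sk).
- by move=> q /VU; exact: A0.
- by move=> q Vq; have [e _ _] := de q (VU q Vq); exact: e.
- by move=> q Vq; have [_ e _] := de q (VU q Vq); exact: e.
- by move=> q Vq; have [_ _ e] := de q (VU q Vq); exact: e.
- by move=> q /VV1; exact: Rn.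
- exact: Rk.
- by move=> q /VU2; exact: tauA.
- by move=> q /VU2; exact: taut.
- by move=> q /VU2; exact: taux.
Qed.
End LocalFlow.

Theorem proposition2 (R : realType) (Om : set (plane R))
  (A B C : plane R -> R^o)
  (open_Om : open Om)
  (anA : analytic_on Om A) (anB : analytic_on Om B) (anC : analytic_on Om C)
  (A_neq0 : forall p, Om p -> A p != 0)
  (M : set (varspace (triples R)))
  (open_M : open M)
  (M_Om : forall z, M z -> Om z.1)
  (Q1 : varspace (triples R) -> varspace (triples R))
  (Q1_Lie : Lie_invariance_operator (DE1 A B C) M Q1)
  (Q1_t : forall z, M z -> coef_t Q1 z = 0)
  (Q1_x : forall z, M z -> coef_x Q1 z != 0)
  (U : set (plane R)) (g1 g2 g3 : plane R -> R^o)
  (open_U : open U)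
  (g_M : forall p, U p -> M (p, (g1 p, g2 p, g3 p)))
  (g_sol : solution_on (DE1 A B C) U (fun p => (g1 p, g2 p, g3 p)))
  (g_inv : invariant_on Q1 U (fun p => (g1 p, g2 p, g3 p))) :
  forall p : plane R, U p ->
    exists V : set (plane R),
      [/\ open V, V p, V `<=` U &
          exists Q : varspace (scalars R) -> varspace (scalars R),
            equivalent_on [set z | V z.1] (reduction_op g1 g2 g3) Q /\
            Lie_invariance_operator (eqL A B C) [set z | V z.1] Q].

Proof.
have [D [Phi [lg gen sym]]] := Q1_Lie.
have [sA _] := anA; have [sB _] := anB; have [sC _] := anC; have [sg de] := g_sol.
have UOm : U `<=` Om by move=> q /g_M /M_Om.
pose y1 z : R^o := (Q1 z).2.1.1; pose y2 z : R^o := (Q1 z).2.1.2; pose xi z : R^o := (Q1 z).1.2.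
have sxi : smooth_on M xi := smooth_xi open_M lg gen erefl.
pose G (q : plane R) : varspace (triples R) := (q, (g1 q, g2 q, g3 q)).
have sG : smooth_on U G.
  by apply: smooth_pair => //; apply: smooth_linear => // x; exact: cvg_id.
have component (l : varspace (triples R) -> R^o) : lin_cont l -> smooth_on U (fun q => l (G q)).
  move=> [ll cl]; apply: (smooth_comp (findim_triples R) open_U (U2 := setT) _ _ sG) => //.
  by apply: smooth_linear => //; exact: openT.
have sg1 := component _ (lin_cont_g1 R); have sg2 := component _ (lin_cont_g2 R).
have sg3 := component _ (lin_cont_g3 R); rewrite /= in sg1 sg2 sg3.
have dg v q : U q -> 'D_v G q = (v, ('D_v g1 q, 'D_v g2 q, 'D_v g3 q)).
  move=> Uq; have d1 := smooth_diff sg1 Uq; have d2 := smooth_diff sg2 Uq; have d3 := smooth_diff sg3 Uq.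
  rewrite derive_pair; [|exact: ex_diff|by do 2?apply: differentiable_pair].
  rewrite derive_id derive_pair; [|by apply: differentiable_pair|by []].
  by rewrite derive_pair.
have proj z (Mz : M z) := xi_projectable open_Om sA sB sC A_neq0 open_M M_Om lg gen sym Q1_t (xi := xi) (y1 := y1) (y2 := y2) erefl erefl erefl Mz.
have coef z (Mz : M z) := generator_coefficient open_Om sA sB sC A_neq0 open_M M_Om lg gen sym Q1_t (xi := xi) (y1 := y1) (y2 := y2) erefl erefl erefl Mz.
pose om (q : plane R) : R^o := xi (G q).
have som : smooth_on U om := smooth_comp (findim_triples R) open_U g_M sxi sG.
(* Along the graph, [xi] has no derivatives in the directions g1, g2, g3, so its total derivatives
   are its partial ones. *)
have dom v q : U q -> 'D_v om q = v.1 * 'D_(dir_t R) xi (G q) + v.2 * 'D_(dir_x R) xi (G q).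
  move=> Uq; have dxi := smooth_diff sxi (g_M q Uq).
  apply: etrans (derive_comp v (smooth_diff sG Uq) dxi) _.
  rewrite (derive_dirE _ dxi) (dg v q Uq) /=; have [e1 e2 e3 _] := proj (G q) (g_M q Uq).
  by rewrite e1 e2 e3 !mulr0 !addr0.
have omt q : U q -> Dt om q = 'D_(dir_t R) xi (G q).
  by move=> Uq; rewrite DtE (dom _ q Uq) mul1r mul0r addr0.
have omx q : U q -> Dx om q = 'D_(dir_x R) xi (G q).
  by move=> Uq; rewrite DxE (dom _ q Uq) mul1r mul0r add0r.
move=> p Up.
apply: (reduction_op_Lie (xi := om)) => //.
- exact: smooth_sub UOm sA.
- exact: smooth_sub UOm sB.
- exact: smooth_sub UOm sC.
- by move=> q /UOm; exact: A_neq0.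
- by move=> q /g_M; exact: Q1_x.
- by move=> q Uq; rewrite (omx q Uq); have [_ _ _ e] := proj (G q) (g_M q Uq); exact: e.
move=> q Uq; rewrite (omt q Uq) (omx q Uq) -(coef (G q) (g_M q Uq)).
have d1 := smooth_diff sg1 Uq; have d2 := smooth_diff sg2 Uq; have d3 := smooth_diff sg3 Uq.
(* With zero t-coefficient, invariance says that [xi] times the x-derivative of the solution equals
   the remaining coefficients of [Q1]; its g1-component is the commutation identity. *)
have := g_inv q Uq; rewrite (Q1_t _ (g_M q Uq) : coef_t Q1 (q, (g1 q, g2 q, g3 q)) = 0) scale0r add0r DxE derive_pair; [|by apply: differentiable_pair|by []].
rewrite derive_pair// => e.
exact: (congr1 (fun y : triples R => y.1.1 : R^o) e).
Qed.
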